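(* Let $\Omega\subset\mathbb{R}^n$ be open and bounded with Lipschitz boundary and let $b\in W^{1,\infty}(\Omega)$. Then the Dirichlet problem $$\Delta_\infty u=0\ \text{ in }\Omega,\qquad u=b\ \text{ on }\partial\Omega,$$ has a viscosity solution $u_\infty\in W^{1,\infty}(\Omega)$.
   Context: $\Delta_\infty u:=Du\otimes Du:D^2u=\sum_{i,j}D_iu\,D_ju\,D^2_{ij}u$ is the $\infty$-Laplacian. $\mathbb{S}(n)$ is the space of real symmetric $n\times n$ matrices, and $X:z\otimes z=\sum_{i,j}X_{ij}z_iz_j$. For $u:\Omega\to\mathbb{R}$ and $x\in\Omega$, $\mathcal{J}^{2,+}u(x)$ is the set of all $(p,X)\in\mathbb{R}^n\times\mathbb{S}(n)$ such that $u(x+z)\le u(x)+p\cdot z+\frac12X:z\otimes z+o(|z|^2)$ as $z\to0$; $\mathcal{J}^{2,-}u(x)$ is defined in the same way with $\le$ replaced by $\ge$. A viscosity solution of the Dirichlet problem is a function $u_\infty\in C^0(\overline{\Omega})$ with $u_\infty=b$ pointwise on $\partial\Omega$ (where $b$ is identified with its continuous representative on $\overline{\Omega}$) such that for all $x\in\Omega$: $X:p\otimes p\ge0$ for every $(p,X)\in\mathcal{J}^{2,+}u_\infty(x)$, and $X:p\otimes p\le0$ for every $(p,X)\in\mathcal{J}^{2,-}u_\infty(x)$. *)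

(* Defs.v *)
(* MathComp-Analysis, over an arbitrary R : realType; R^n is 'rV[R]_n, n >= 1
   being written n.+1. The topology of 'rV[R]_n comes from the sup norm. *)
From HB Require Import structures.
From mathcomp Require Import all_boot all_order all_algebra.
From mathcomp Require Import all_classical all_reals all_analysis.

Set Implicit Arguments.
Unset Strict Implicit.
Unset Printing Implicit Defensive.

Import Order.TTheory GRing.Theory Num.Theory.
Import numFieldNormedType.Exports.

Local Open Scope classical_set_scope.
Local Open Scope ring_scope.

Definition rV_display : measure_display. Proof. exact. Qed.

(* The sigma-algebra generated by the coordinate maps, i.e. the Borel
   sigma-algebra of R^n. *)
Section measurable_rV.
Variables (R : realType) (n : nat).

Definition rV_coord (i : 'I_n) (v : 'rV[R]_n) : measurableTypeR R := v ord0 i.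

Let rV_set0 : g_sigma_preimage rV_coord set0.
Proof. exact: sigma_algebra0. Qed.

Let rV_setC A : g_sigma_preimage rV_coord A -> g_sigma_preimage rV_coord (~` A).
Proof. exact: sigma_algebraC. Qed.

Let rV_bigcup (F : _^nat) : (forall i, g_sigma_preimage rV_coord (F i)) ->
  g_sigma_preimage rV_coord (\bigcup_i (F i)).
Proof. exact: sigma_algebra_bigcup. Qed.

HB.instance Definition _ := @isMeasurable.Build rV_display 'rV[R]_n
  (g_sigma_preimage rV_coord) rV_set0 rV_setC rV_bigcup.

End measurable_rV.

Lemma measurable_rV_coord (R : realType) n (i : 'I_n) :
  measurable_fun [set: 'rV[R]_n] (@rV_coord R n i).
Proof.
move=> _ Y mY; rewrite setTI; apply: sub_sigma_algebra => /=.
rewrite -bigcup_seq/=; exists i => /=; first by rewrite mem_index_enum.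
by exists Y => //; rewrite setTI.
Qed.

Lemma measurable_to_rV d (T : measurableType d) (R : realType) n
    (f : T -> 'rV[R]_n) :
  (forall i, measurable_fun [set: T] (@rV_coord R n i \o f)) ->
  measurable_fun [set: T] f.
Proof.
move=> mf _ A mA.
suff : g_sigma_preimage (fun i => @rV_coord R n i \o f) `<=` measurable.
  by rewrite g_sigma_preimage_comp; apply; exists A.
apply: smallest_sub; first exact: sigma_algebra_measurable.
by rewrite -bigcup_seq/=; apply: bigcup_sub => i _ B [C mC <-]; exact: mf.
Qed.

Section lebesgue_step.
Variables (R : realType) (n : nat).

Definition rV_cons (p : measurableTypeR R * 'rV[R]_n) : 'rV[R]_n.+1 :=
  row_mx (p.1 : R)%:M p.2 : 'rV[R]_(1 + n).

Lemma rV_cons0 p : rV_cons p ord0 ord0 = p.1.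
Proof.
rewrite /rV_cons (_ : (ord0 : 'I_n.+1) = lshift n (ord0 : 'I_1));
  last exact/val_inj.
by rewrite (row_mxEl (p.1%:M : 'M[R]_1)) mxE mulr1n.
Qed.

Lemma rV_consS p i : rV_cons p ord0 (lift ord0 i) = p.2 ord0 i.
Proof.
rewrite /rV_cons (_ : lift ord0 i = rshift 1 i); last exact/val_inj.
by rewrite (row_mxEr (p.1%:M : 'M[R]_1)).
Qed.

Lemma measurable_rV_cons : measurable_fun setT rV_cons.
Proof.
apply: measurable_to_rV => i; case: (unliftP ord0 i) => [j|] ->.
  rewrite (_ : _ \o _ = @rV_coord R n j \o snd).
    by apply: measurableT_comp => //; exact: measurable_rV_coord.
  by apply/funext => p; rewrite /rV_coord/= rV_consS.
rewrite (_ : _ \o _ = fst)//.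
by apply/funext => p; rewrite /rV_coord/= rV_cons0.
Qed.

HB.instance Definition _ := isMeasurableFun.Build _ _ _ _ rV_cons
  measurable_rV_cons.

Definition rV_uncons (v : 'rV[R]_n.+1) : measurableTypeR R * 'rV[R]_n :=
  (v ord0 ord0, \row_i v ord0 (lift ord0 i)).

Lemma rV_consK : rV_uncons \o rV_cons = id.
Proof.
apply/funext => -[x v]; rewrite /rV_uncons/= rV_cons0; congr pair.
by apply/rowP => i; rewrite mxE rV_consS.
Qed.

Lemma measurable_rV_uncons : measurable_fun setT rV_uncons.
Proof.
apply: measurable_fun_pair; first exact: (measurable_rV_coord ord0).
apply: measurable_to_rV => i.
rewrite (_ : _ \o _ = @rV_coord R n.+1 (lift ord0 i)).
  exact: measurable_rV_coord.
by apply/funext => v; rewrite /rV_coord/= mxE.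
Qed.

Variable m : {sigma_finite_measure set 'rV[R]_n -> \bar R}.

Definition lebesgue_step : set 'rV[R]_n.+1 -> \bar R :=
  pushforward ((@lebesgue_measure R) \x m)%E rV_cons.

Let lebesgue_step0 : lebesgue_step set0 = 0%E.
Proof. by rewrite /lebesgue_step /pushforward preimage_set0 measure0. Qed.

Let lebesgue_step_ge0 A : (0 <= lebesgue_step A)%E.
Proof. exact: measure_ge0. Qed.

Let lebesgue_step_sigma_additive : semi_sigma_additive lebesgue_step.
Proof.
exact: measure_semi_sigma_additive.
Qed.

HB.instance Definition _ := isMeasure.Build _ _ _ lebesgue_step
  lebesgue_step0 lebesgue_step_ge0 lebesgue_step_sigma_additive.

Let lebesgue_step_sigma_finite : sigma_finite setT lebesgue_step.
Proof.
have /sigma_finiteP[F [FT ndF Foo]] := sigma_finiteT (@lebesgue_measure R).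
have /sigma_finiteP[G [GT ndG Goo]] := sigma_finiteT m.
exists (fun k => rV_uncons @^-1` (F k `*` G k)).
  apply/seteqP; split=> // v _.
  have [k _ Fk] : (\bigcup_k F k) (v ord0 ord0) by rewrite -FT.
  have [l _ Gl] : (\bigcup_k G k) (\row_i v ord0 (lift ord0 i)) by rewrite -GT.
  exists (maxn k l) => //; split => /=.
  - by move: Fk; exact/subsetPset/ndF/leq_maxl.
  - by move: Gl; exact/subsetPset/ndG/leq_maxr.
move=> k; have [mF Fk] := Foo k; have [mG Gk] := Goo k; split.
  rewrite -[X in measurable X]setTI; apply: measurable_rV_uncons => //.
  exact: measurableX.
rewrite /lebesgue_step /pushforward -comp_preimage rV_consK.
by rewrite product_measure1E// lte_mul_pinfty// ge0_fin_numE.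
Qed.

HB.instance Definition _ := Measure_isSigmaFinite.Build _ _ _ lebesgue_step
  lebesgue_step_sigma_finite.

End lebesgue_step.

Fixpoint lebesgue_rV (R : realType) (n : nat) :
    {sigma_finite_measure set 'rV[R]_n -> \bar R} :=
  if n is n'.+1 then lebesgue_step (lebesgue_rV R n') else dirac (0 : 'rV[R]_0).

Lemma lebesgue_rVX (R : realType) n (A : set (measurableTypeR R))
    (B : set 'rV[R]_n) : measurable A -> measurable B ->
  lebesgue_rV R n.+1 (@rV_uncons R n @^-1` (A `*` B)) =
  (lebesgue_measure A * lebesgue_rV R n B)%E.
Proof.
move=> mA mB; rewrite /= /lebesgue_step /pushforward -comp_preimage rV_consK.
exact: product_measure1E.
Qed.

Definition boundary (T : topologicalType) (A : set T) : set T :=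
  closure A `\` A^°.

(* Near each boundary point, after an orthogonal change of coordinates
   y |-> y *m Q, A is the region above the graph of a Lipschitz function of
   the first n coordinates. *)
Definition lipschitz_boundary (R : realType) n (A : set 'rV[R]_n.+1) :=
  forall x, boundary A x ->
  exists (Q : 'M[R]_n.+1) (g : 'rV[R]_n -> R),
    [/\ Q *m Q^T = 1%:M, lipschitz g &
        \forall y \near x,
          A y <-> g (col' ord_max (y *m Q)) < (y *m Q) ord0 ord_max].

Section sobolev.
Variables (R : realType) (n : nat).
Local Notation V := 'rV[R]_n.+1.
Local Notation mu := (lebesgue_rV R n.+1).
Implicit Types (Om : set V) (u v g phi : V -> R).

Definition basis_vec (i : 'I_n.+1) : V := delta_mx ord0 i.

Fixpoint Ck (k : nat) (f : V -> R) : Prop :=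
  continuous f /\
  if k is k'.+1 then
    forall i, (forall x, derivable f x (basis_vec i)) /\
              Ck k' ('D_(basis_vec i) f)
  else True.

(* Elements of C_c^oo(Om), extended by zero to R^n. *)
Definition test_function Om phi :=
  [/\ forall k, Ck k phi, compact (closure [set x | phi x != 0]) &
      closure [set x | phi x != 0] `<=` Om].

Definition weak_partial Om (i : 'I_n.+1) u g :=
  forall phi, test_function Om phi ->
    \int[mu]_(x in Om) (u x * 'D_(basis_vec i) phi x) =
    - \int[mu]_(x in Om) (g x * phi x).

Definition Linfty Om : set (V -> R) := [set u | u \_ Om \in Lfun mu +oo%E].

(* u is a representative of a class in W^{1,oo}(Om); values outside Om are
   irrelevant. Since Lfun consists of Borel functions, u is asked only to agree
   a.e. in Om with such a function v, so that Lebesgue measurable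
   representatives are covered. *)
Definition W1oo Om u :=
  exists v, [/\ {ae mu, forall x, Om x -> u x = v x}, Linfty Om v &
    forall i, exists2 g, Linfty Om g & weak_partial Om i v g].

(* v is the continuous representative of u on the closure of Om. It is unique
   there when Om is open. *)
Definition continuous_representative Om u v :=
  {within closure Om, continuous v} /\ {ae mu, forall x, Om x -> v x = u x}.

End sobolev.

Section viscosity.
Variables (R : realType) (n : nat).
Local Notation V := 'rV[R]_n.+1.
Implicit Types (Om : set V) (u b : V -> R) (p x z : V) (X : 'M[R]_n.+1).

Definition dotv p z : R := \sum_i p ord0 i * z ord0 i.

Definition enorm z : R := Num.sqrt (dotv z z).

Definition quad X z : R := \sum_i \sum_j X i j * z ord0 i * z ord0 j.

(* For x in an open domain of u, x + z is in the domain for z near 0. *)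
Definition superjet u x (pX : V * 'M[R]_n.+1) :=
  pX.2^T = pX.2 /\
  exists2 r : V -> R, r =o_ (0 : V) (fun z => enorm z ^+ 2) &
    \forall z \near (0 : V),
      u (x + z) <= u x + dotv pX.1 z + 2^-1 * quad pX.2 z + r z.

Definition subjet u x (pX : V * 'M[R]_n.+1) :=
  pX.2^T = pX.2 /\
  exists2 r : V -> R, r =o_ (0 : V) (fun z => enorm z ^+ 2) &
    \forall z \near (0 : V),
      u (x + z) >= u x + dotv pX.1 z + 2^-1 * quad pX.2 z + r z.

Definition viscosity_solution Om b u :=
  [/\ {within closure Om, continuous u},
      exists2 v, continuous_representative Om b v &
        forall x, boundary Om x -> u x = v x,
      forall x p X, Om x -> superjet u x (p, X) -> 0 <= quad X p &
      forall x p X, Om x -> subjet u x (p, X) -> quad X p <= 0].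

End viscosity.

(* Main.v *)
From HB Require Import structures.
Require Import Defs.
From mathcomp Require Import all_boot all_order all_algebra.
From mathcomp Require Import all_classical all_reals all_analysis.
From mathcomp Require Import measurable_realfun ess_sup_inf ring lra.

(** The proof joins two halves by a bounded Lipschitz function W on the whole space
that agrees with b almost everywhere in Om.

Regularity of the data. Testing the weak derivatives of b against products of
one-variable profiles shows that the average of b over a box changes by at most a
constant times the sum of the sides when the box shrinks ([avg_shrink],
[avg_subbox]). So the averages over boxes shrinking to a point x converge with a
rate, and their limit is Lipschitz in x near each point of Om ([box_rep_close],
[box_rep_lipschitz_ball]). It equals b almost everywhere, because a function whose
integral over small boxes is of smaller order than their volume has integral 0
over all of them ([box_integral_halving], [boxes_integral_ae_eq0]). Two points of
Om near the same boundary point are joined inside Om by two segments whose lengths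
are comparable to their distance; with compactness this gives a global Lipschitz
bound ([boundary_lipschitz], [global_lipschitz]), and the limit extends to W
([mcshane_extension]).

Existence. The solution is a limit of values of tug of war. For a step size e,
monotonicity alone yields a bounded function u_e that equals W outside Om and, in
Om, the mean of its supremum and infimum over the closed ball of radius e
([game_value_exists]). Such functions satisfy a comparison principle with the
cones c + a e k, where k counts the steps to the vertex ([cone_comparison]). Cones
with vertices outside and inside Om show that u_e is Lipschitz, up to an error of
order e, with the constant of W ([game_lipschitz]). Along an ultrafilter of step
sizes tending to 0 the values converge to a function u that is Lipschitz and
satisfies, as does - u, comparison with cones from above
([cone_extension_exists]). This comparison implies the viscosity inequalities: if
(p, X) is in the superjet of u at x and X is negative at p, then u lies below a cone of
slope |p| with vertex x by a quadratic amount, and a cone with vertex slightly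
behind x contradicts comparison ([cones_above_superjet]). Subjets of u are
opposites of superjets of - u.

Finally u is in the Sobolev space because weak-star limits of the difference
quotients of a Lipschitz function are weak derivatives ([weak_star_limit],
[lipschitz_W1oo]). *)

Set Implicit Arguments.
Unset Strict Implicit.
Unset Printing Implicit Defensive.

Import Order.TTheory GRing.Theory Num.Theory.
Import numFieldNormedType.Exports.

Local Open Scope classical_set_scope.
Local Open Scope ring_scope.

(** * The midrange equation and discrete cone comparison *)
Section game.
Variables (R : realType) (T : Type) (N : T -> set T).
Hypothesis Nx : forall x, N x x.
Implicit Types (u h W : T -> R) (D : set T).

(** One round of tug of war: a fair coin decides which player moves. *)
Definition midrange u x : R := 2^-1 * (sup (u @` N x) + inf (u @` N x)).

Lemma sup_nbh_le u x c : (forall z, N x z -> u z <= c) -> sup (u @` N x) <= c.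
Proof.
move=> uc; apply: ge_sup; first by exists (u x), x.
by move=> _ [z /uc ? <-].
Qed.

Lemma inf_nbh_le u x z M : (forall y, `|u y| <= M) -> N x z ->
  inf (u @` N x) <= u z.
Proof.
move=> uM xz; apply: ge_inf; last by exists z.
by exists (- M) => _ [y _ <-]; move: (uM y); rewrite ler_norml => /andP[].
Qed.

Lemma sup_nbh_ge u x z M : (forall y, `|u y| <= M) -> N x z ->
  u z <= sup (u @` N x).
Proof.
move=> uM xz; apply: ub_le_sup; last by exists z.
by exists M => _ [y _ <-]; move: (uM y); rewrite ler_norml => /andP[].
Qed.

Lemma inf_nbh_ge u x c : (forall z, N x z -> c <= u z) -> c <= inf (u @` N x).
Proof.
move=> uc; apply: lb_le_inf; first by exists (u x), x.
by move=> _ [z /uc ? <-].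
Qed.

Lemma midrange_mono h u M x : (forall y, `|h y| <= M) -> (forall y, `|u y| <= M) ->
  (forall y, h y <= u y) -> midrange h x <= midrange u x.
Proof.
move=> hM uM hu; rewrite ler_pM2l ?invr_gt0//; apply: lerD.
  by apply: sup_nbh_le => z /(sup_nbh_ge uM); exact: le_trans.
apply: inf_nbh_ge => z /(inf_nbh_le hM) hz; exact: le_trans hz (hu z).
Qed.

Lemma midrange_bound u M x : (forall y, `|u y| <= M) -> `|midrange u x| <= M.
Proof.
move=> uM; rewrite ler_norml /midrange.
have h1 : sup (u @` N x) <= M.
  by apply: sup_nbh_le => z _; move: (uM z); rewrite ler_norml => /andP[].
have h2 : - M <= inf (u @` N x).
  by apply: inf_nbh_ge => z _; move: (uM z); rewrite ler_norml => /andP[].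
have h3 := sup_nbh_ge uM (Nx x); have h4 := inf_nbh_le uM (Nx x).
lra.
Qed.

Lemma midrangeN u x : midrange (fun y => - u y) x = - midrange u x.
Proof.
rewrite /midrange /inf.
have -> : [set - y | y in [set - u y | y in N x]] = u @` N x.
  apply/seteqP; split=> [_ [_ [z Nz <-] <-]|_ [z Nz <-]].
    by rewrite opprK; exists z.
  by exists (- u z); rewrite ?opprK//; exists z.
have -> : [set - y | y in u @` N x] = [set - u y | y in N x].
  apply/seteqP; split=> [_ [_ [z Nz <-] <-]|_ [z Nz <-]]; first by exists z.
  by exists (u z) => //; exists z.
by lra.
Qed.

(** The midrange is monotone but not a contraction, so the solution is taken
as the supremum of the subsolutions, as in the Knaster-Tarski theorem; the common
bound M makes the suprema exist. *)
Lemma game_value_exists (Om : set T) W M : (forall x, `|W x| <= M) ->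
  exists u, [/\ forall x, `|u x| <= M, forall x, ~ Om x -> u x = W x &
    forall x, Om x -> u x = midrange u x].
Proof.
move=> WM.
pose P h x := if `[< Om x >] then midrange h x else W x.
have PM h : (forall x, `|h x| <= M) -> forall x, `|P h x| <= M.
  by move=> hM x; rewrite /P; case: asboolP => // _; exact: midrange_bound.
have Pmono h u : (forall y, `|h y| <= M) -> (forall y, `|u y| <= M) ->
    (forall y, h y <= u y) -> forall x, P h x <= P u x.
  move=> hM uM hu x; rewrite /P; case: asboolP => // _.
  exact: midrange_mono hM uM hu.
pose S := [set h | (forall x, `|h x| <= M) /\ forall x, h x <= P h x].
have S0 : S (fun=> - M).
  have h0 : T -> forall x : T, `|- M| <= M.
    by move=> y _; rewrite normrN ger0_norm// (le_trans (normr_ge0 _) (WM y)).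
  by split=> [x|x]; [exact: h0|have := PM _ (h0 x) x; rewrite ler_norml => /andP[]].
pose u x := sup [set h x | h in S].
have uS h x : S h -> h x <= u x.
  move=> Sh; apply: ub_le_sup; last by exists h.
  by exists M => _ [g [gM _] <-]; move: (gM x); rewrite ler_norml => /andP[].
have ule x c : (forall h, S h -> h x <= c) -> u x <= c.
  move=> hc; apply: ge_sup; first by exists (- M), (fun=> - M).
  by move=> _ [h /hc ? <-].
have uM x : `|u x| <= M.
  rewrite ler_norml (uS _ x S0)/=; apply: ule => h [+ _] => /(_ x).
  by rewrite ler_norml => /andP[].
have uP x : u x <= P u x.
  apply: ule => h Sh; have [hM hP] := Sh.
  by apply: le_trans (hP x) _; apply: Pmono => // y; exact: uS.
have Pu x : P u x = u x.
  apply/le_anti; rewrite uP andbT; apply: (uS (P u)).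
  by split; [exact: PM|move=> y; apply: Pmono => //; exact: PM].
exists u; split=> // x Ox; rewrite -{1}Pu /P; case: asboolP => //.
Qed.

(** Here k is an integer distance to a vertex: a move raises it by at most one,
and some move lowers it. The function f below is a strictly concave function of k
just above the cone, so u - f cannot be almost maximal, with a positive value, at
a point of D: the best move upwards reaches level (k x).+1, the best move downwards
at least level (k x).-1, and the midrange of f loses by concavity. *)
Lemma cone_comparison D u (k : T -> nat) (a c M : R) (K : nat) : 0 <= a ->
  (forall x, `|u x| <= M) -> (forall x, D x -> u x <= midrange u x) ->
  (forall x, D x -> (k x <= K)%N) ->
  (forall x z, D x -> N x z -> (k z <= (k x).+1)%N) ->
  (forall x, D x -> exists2 z, N x z & (k z < k x)%N) ->
  (forall x z, D x -> N x z -> ~ D z -> u z <= c + a * (k z)%:R) ->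
  forall x, D x -> u x <= c + a * (k x)%:R.
Proof.
move=> a0 uM usub kK kup kdown ubd x0 Dx0.
apply/ler_addgt0Pr => eta eta0.
(* The geometric term bends the cone by an amount bounded below for k <= K. *)
pose f (j : nat) : R := c + a * j%:R + eta * (1 - 2^-1 ^+ j).
have f_incr i j : (i <= j)%N -> f i <= f j.
  move=> ij; rewrite /f lerD// ?lerD2l ?ler_wpM2l ?ler_nat// ?(ltW eta0)//.
  by rewrite lerD2l lerN2 ler_wiXn2l// ?invr_ge0// invf_le1// ler1n.
have f_concave j : f j.+2 + f j = 2 * f j.+1 - eta * 2^-1 ^+ j.+2.
  rewrite /f 2!exprS -!natr1.
  by set q : R := _ ^+ j; field.
pose S := [set u x - f (k x) | x in D].
have fge x : c <= f (k x).
  rewrite /f -addrA lerDl addr_ge0 ?mulr_ge0 ?(ltW eta0)// subr_ge0.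
  by rewrite exprn_ile1 ?invr_ge0// invf_le1// ler1n.
have uM' x : u x <= M by move: (uM x); rewrite ler_norml => /andP[].
have Sub : has_sup S.
  split; first by exists (u x0 - f (k x0)), x0.
  exists (M - c) => _ [x Dx <-]; apply: lerB => //.
have mS x : D x -> u x <= f (k x) + sup S.
  by move=> Dx; rewrite addrC -lerBlDr; apply: ub_le_sup; [exact: Sub.2|exists x].
suff m0 : sup S <= 0.
  apply: le_trans (mS _ Dx0) _; apply: (@le_trans _ _ (f (k x0))).
    by rewrite gerDl.
  rewrite /f lerD2l ler_piMr ?(ltW eta0)//.
rewrite leNgt; apply/negP => m0.
(* The least loss by concavity over the levels k <= K. *)
pose d := eta * 2^-1 ^+ K.+1 / 2.
have d0 : 0 < d by rewrite /d !mulr_gt0// exprn_gt0// invr_gt0.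
have [_ [x Dx <-]] := sup_adherent d0 Sub => xlt.
have unb z : N x z -> u z <= f (k z) + sup S.
  move=> xz; have [Dz|nDz] := pselect (D z); first exact: mS.
  apply: le_trans (ubd _ _ Dx xz nDz) _; rewrite ler_wpDr ?(ltW m0)//.
  by rewrite /f lerDl mulr_ge0 ?(ltW eta0)// subr_ge0 exprn_ile1 ?invr_ge0// invf_le1// ler1n.
have [z xz kz] := kdown _ Dx.
have h1 : sup (u @` N x) <= f (k x).+1 + sup S.
  apply: sup_nbh_le => y xy; apply: le_trans (unb _ xy) _.
  by rewrite lerD2r; apply/f_incr/kup.
have h2 : inf (u @` N x) <= f (k x).-1 + sup S.
  apply: le_trans (inf_nbh_le uM xz) (le_trans (unb _ xz) _).
  by rewrite lerD2r; apply: f_incr; rewrite -ltnS prednK//; apply: leq_trans kz.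
have := usub _ Dx; rewrite /midrange.
have kx : (k x).-1.+1 = k x by rewrite prednK//; apply: leq_trans kz.
have := f_concave (k x).-1; rewrite kx.
have : eta * 2^-1 ^+ K.+1 <= eta * 2^-1 ^+ (k x).+1.
  rewrite ler_wpM2l ?(ltW eta0)// ler_wiXn2l ?invr_ge0// ?invf_le1 ?ler1n//.
  by rewrite ltnS kK.
move: xlt; rewrite /d; lra.
Qed.

End game.

(** * Sup norm and Euclidean norm *)
Section sup_norm.
Variables (R : realType) (m : nat).
Implicit Types x : 'rV[R]_m.

Lemma mx_norm_coord x i : `|x ord0 i| <= `|x|.
Proof.
rewrite [leRHS]/Num.Def.normr /= mx_normrE; apply/bigmax_geP; right => /=.
by exists (ord0, i).
Qed.

Lemma mx_norm_le x (s : R) : 0 <= s -> (forall j, `|x ord0 j| <= s) -> `|x| <= s.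
Proof.
move=> s0 h; rewrite [leLHS]/Num.Def.normr /= mx_normrE.
by apply/bigmax_leP; split=> // -[i j] _ /=; rewrite (ord1 i).
Qed.

Lemma mx_norm_lt x (s : R) : 0 < s -> (forall j, `|x ord0 j| < s) -> `|x| < s.
Proof.
move=> s0 h; rewrite [ltLHS]/Num.Def.normr /= mx_normrE.
by apply/bigmax_ltP; split=> // -[i j] _ /=; rewrite (ord1 i).
Qed.

End sup_norm.

Section euclidean.
Variables (R : realType) (n : nat).
Local Notation V := 'rV[R]_n.+1.
Implicit Types (p x y z : V).

Lemma dotvC x y : dotv x y = dotv y x.
Proof. by apply: eq_bigr => i _; rewrite mulrC. Qed.

Lemma dotvDr p x y : dotv p (x + y) = dotv p x + dotv p y.
Proof. by rewrite -big_split/=; apply: eq_bigr => i _; rewrite mxE mulrDr. Qed.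

Lemma dotvZr p a x : dotv p (a *: x) = a * dotv p x.
Proof. by rewrite mulr_sumr; apply: eq_bigr => i _; rewrite mxE mulrCA. Qed.

Lemma dotvDl p x y : dotv (x + y) p = dotv x p + dotv y p.
Proof. by rewrite !(dotvC _ p) dotvDr. Qed.

Lemma dotvZl p a x : dotv (a *: x) p = a * dotv x p.
Proof. by rewrite !(dotvC _ p) dotvZr. Qed.

Lemma dotvv_ge0 x : 0 <= dotv x x.
Proof. by apply: sumr_ge0 => i _; rewrite -expr2 sqr_ge0. Qed.

Lemma enorm_ge0 x : 0 <= enorm x. Proof. exact: sqrtr_ge0. Qed.

Lemma sqr_enorm x : enorm x ^+ 2 = dotv x x.
Proof. by rewrite sqr_sqrtr// dotvv_ge0. Qed.

Lemma enormZ a x : enorm (a *: x) = `|a| * enorm x.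
Proof.
by rewrite /enorm dotvZl dotvZr mulrA -expr2 sqrtrM ?sqr_ge0// sqrtr_sqr.
Qed.

Lemma enormN x : enorm (- x) = enorm x.
Proof. by rewrite -scaleN1r enormZ normrN1 mul1r. Qed.

Lemma enormB x y : enorm (x - y) = enorm (y - x).
Proof. by rewrite -opprB enormN. Qed.

Lemma enorm0 : enorm (0 : V) = 0.
Proof. by rewrite -(scale0r (0 : V)) enormZ normr0 mul0r. Qed.

Lemma coord_le_enorm x i : `|x ord0 i| <= enorm x.
Proof.
rewrite -sqrtr_sqr ler_sqrt ?dotvv_ge0// expr2 /dotv (bigD1 i)//= lerDl.
by apply: sumr_ge0 => j _; rewrite -expr2 sqr_ge0.
Qed.

Lemma norm_le_enorm x : `|x| <= enorm x.
Proof. by apply: mx_norm_le => [|i]; [exact: enorm_ge0|exact: coord_le_enorm]. Qed.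

Lemma enorm_le_norm x : enorm x <= n.+1%:R * `|x|.
Proof.
rewrite -(@ler_pXn2r _ 2)// ?nnegrE ?enorm_ge0 ?mulr_ge0//.
rewrite sqr_enorm; apply: (@le_trans _ _ (\sum_(i < n.+1) `|x| ^+ 2)).
  apply: ler_sum => i _; rewrite -expr2 -real_normK ?num_real//.
  by rewrite ler_pXn2r ?nnegrE// mx_norm_coord.
rewrite sumr_const card_ord -[leLHS]mulr_natl exprMn ler_wpM2r ?sqr_ge0//.
by rewrite -natrX ler_nat leq_pmulr.
Qed.

Lemma enorm_eq0 x : enorm x = 0 -> x = 0.
Proof.
move=> x0; apply/normr0_eq0/le_anti; rewrite normr_ge0 andbT.
by rewrite -x0 norm_le_enorm.
Qed.

Lemma enorm_gt0 x : x != 0 -> 0 < enorm x.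
Proof.
move=> x0; rewrite lt_neqAle enorm_ge0 andbT eq_sym.
by apply: contra x0 => /eqP/enorm_eq0 ->.
Qed.

Lemma dotv_le x y : dotv x y <= enorm x * enorm y.
Proof.
have [->|x0] := eqVneq x 0.
  by rewrite -(scale0r (0 : V)) dotvZl enormZ normr0 !mul0r.
have [->|y0] := eqVneq y 0.
  by rewrite -(scale0r (0 : V)) dotvZr enormZ normr0 !mul0r mulr0.
have ex := enorm_gt0 x0; have ey := enorm_gt0 y0.
have := dotvv_ge0 (enorm y *: x - enorm x *: y).
rewrite -scaleNr !(dotvDl, dotvDr, dotvZl, dotvZr) -!sqr_enorm (dotvC y x).
move=> h; have : 0 <= enorm x * enorm y * (enorm x * enorm y - dotv x y) by lra.
by rewrite pmulr_rge0 ?mulr_gt0// subr_ge0.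
Qed.

Lemma enormD x y : enorm (x + y) <= enorm x + enorm y.
Proof.
rewrite -(@ler_pXn2r _ 2)// ?nnegrE ?addr_ge0 ?enorm_ge0//.
rewrite sqrrD !sqr_enorm !(dotvDl, dotvDr) (dotvC y x).
by have := dotv_le x y; lra.
Qed.

Lemma enorm_dist x y z : enorm (x - z) <= enorm (x - y) + enorm (y - z).
Proof. by rewrite (le_trans _ (enormD _ _))// addrA subrK. Qed.

(** * Tug of war with steps of size e *)
Lemma nceil_le (t : R) (m : nat) : 0 <= t ->
  (`|Num.ceil t| <= m)%N = (t <= m%:R).
Proof.
move=> t0; rewrite -lez_nat gez0_abs ?ceil_le_int//.
by rewrite real_ceil_ge0 ?num_real// (lt_le_trans _ t0)// ltrN10.
Qed.

Lemma nceil_ge (t : R) : 0 <= t -> t <= `|Num.ceil t|%:R.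
Proof. by move=> t0; rewrite -nceil_le. Qed.

Lemma nceil_lt (t : R) : 0 <= t -> (`|Num.ceil t|)%:R <= t + 1.
Proof.
move=> t0; have := ltW (ceilB1_lt t); rewrite intrD lerBlDr.
by rewrite -[in X in X -> _](@gez0_abs (Num.ceil t))// real_ceil_ge0 ?num_real// (lt_le_trans _ t0)// ltrN10.
Qed.

Definition nbh (e : R) x : set V := [set z | enorm (z - x) <= e].

(** The number of moves of length at most e that lead from x to y. *)
Definition steps (e : R) y x : nat := `|Num.ceil (enorm (x - y) / e)|%N.

Lemma nbh_refl e x : 0 < e -> nbh e x x.
Proof. by move=> e0; rewrite /nbh/= subrr enorm0 ltW. Qed.

Lemma steps_up e y x z : 0 < e -> nbh e x z -> (steps e y z <= (steps e y x).+1)%N.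
Proof.
move=> e0 xz; rewrite nceil_le ?divr_ge0 ?enorm_ge0 ?(ltW e0)//.
have h := @nceil_ge (enorm (x - y) / e).
rewrite -natr1 (@le_trans _ _ (enorm (x - y) / e + 1))//.
  rewrite ler_pdivrMr// mulrDl mul1r divfK ?gt_eqF//.
  by rewrite (addrC _ e) (le_trans (enorm_dist z x y))// lerD2r.
by rewrite lerD2r h// divr_ge0 ?enorm_ge0 ?(ltW e0).
Qed.

Lemma steps_down e y x : 0 < e -> x != y ->
  exists2 z, nbh e x z & (steps e y z < steps e y x)%N.
Proof.
move=> e0 xy; have d0 : 0 < enorm (x - y) by rewrite enorm_gt0// subr_eq0.
have [xe|ex] := leP (enorm (x - y)) e.
  exists y; first by rewrite /nbh/= enormB.
  rewrite {1}/steps subrr enorm0 mul0r ceil0 absz0.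
  by rewrite ltnNge nceil_le ?divr_ge0 ?enorm_ge0 ?(ltW e0)// -ltNge divr_gt0.
pose d := enorm (x - y).
(* A move of length e straight towards y. *)
exists (x - (e / d) *: (x - y)).
  rewrite /nbh/= addrAC subrr add0r enormN enormZ gtr0_norm ?divr_gt0//.
  by rewrite divfK ?gt_eqF.
have ed : e / d <= 1 by rewrite ler_pdivrMr// mul1r ltW.
have k1 : (0 < steps e y x)%N.
  by rewrite ltnNge nceil_le ?divr_ge0 ?enorm_ge0 ?(ltW e0)// -ltNge divr_gt0.
rewrite -[X in (_ < X)%N]prednK// ltnS.
have -> : steps e y (x - (e / d) *: (x - y)) = `|Num.ceil (d / e - 1)|%N.
  rewrite /steps; have -> : x - (e / d) *: (x - y) - y = (1 - e / d) *: (x - y).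
    by rewrite scalerBl scale1r addrAC.
  rewrite enormZ ger0_norm ?subr_ge0//; congr (`|Num.ceil _|%N).
  by rewrite -/d mulrBl mul1r divfK ?gt_eqF// mulrBl divff ?gt_eqF.
rewrite nceil_le ?subr_ge0 ?ler_pdivlMr ?mul1r ?(ltW ex)//.
rewrite lerBlDr natr1 prednK//.
by apply: nceil_ge; rewrite divr_ge0 ?enorm_ge0 ?(ltW e0).
Qed.

Lemma steps_lower e y x : 0 < e -> enorm (x - y) <= e * (steps e y x)%:R.
Proof.
move=> e0; rewrite mulrC -ler_pdivrMr//; apply: nceil_ge.
by rewrite divr_ge0 ?enorm_ge0 ?(ltW e0).
Qed.

Lemma steps_upper e y x : 0 < e -> e * (steps e y x)%:R <= enorm (x - y) + e.
Proof.
move=> e0; rewrite mulrC -ler_pdivlMr// mulrDl divff ?gt_eqF//.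
by apply: nceil_lt; rewrite divr_ge0 ?enorm_ge0 ?(ltW e0).
Qed.

Lemma stepsC e y x : steps e y x = steps e x y.
Proof. by rewrite /steps enormB. Qed.

Lemma euclidean_cone_comparison (D : set V) (u : V -> R) y (e a c M B : R) :
  0 < e -> 0 <= a ->
  (forall x, `|u x| <= M) -> (forall x, D x -> enorm x <= B) ->
  ~ D y -> (forall x, D x -> u x <= midrange (nbh e) u x) ->
  (forall x z, D x -> nbh e x z -> ~ D z -> u z <= c + a * (e * (steps e y z)%:R)) ->
  forall x, D x -> u x <= c + a * (e * (steps e y x)%:R).
Proof.
move=> e0 a0 uM DB Dy usub ubd x Dx; rewrite mulrA.
apply: (@cone_comparison _ _ (nbh e) (fun x => nbh_refl x e0) D u (steps e y)
  (a * e) c M `|Num.ceil ((B + enorm y) / e)|%N) => //.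
- by rewrite mulr_ge0// ltW.
- move=> z Dz; rewrite nceil_le ?divr_ge0 ?enorm_ge0 ?(ltW e0)//.
  have Bz : enorm (z - y) <= B + enorm y.
    by rewrite (le_trans (enormD _ _))// enormN lerD2r DB.
  apply: (@le_trans _ _ ((B + enorm y) / e)).
    by rewrite ler_pM2r ?invr_gt0.
  by apply: nceil_ge; rewrite divr_ge0 ?(ltW e0)// (le_trans _ Bz)// enorm_ge0.
- by move=> z t _; exact: steps_up.
- by move=> z Dz; apply: steps_down => //; apply/eqP => zy; apply: Dy; rewrite -zy.
- by move=> z t Dz zt Dt; rewrite -mulrA; exact: ubd zt Dt.
Qed.

Section game_solution.
Variables (Om : set V) (W : V -> R) (M L B e : R).
Hypotheses (e0 : 0 < e) (L0 : 0 <= L) (OmB : forall x, Om x -> enorm x <= B).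

Definition game_value (u : V -> R) := [/\ forall x, `|u x| <= M,
  forall x, ~ Om x -> u x = W x & forall x, Om x -> u x = midrange (nbh e) u x].

(** The Lipschitz bound puts W below the cone of slope L with vertex y, and
cone comparison carries this into Om. *)
Lemma game_boundary_upper (u : V -> R) y : 
  (forall x y, `|W x - W y| <= L * enorm (x - y)) -> game_value u -> ~ Om y ->
  forall x, u x <= W y + L * (e * (steps e y x)%:R).
Proof.
move=> WL [uM uW um] Oy.
have out z : ~ Om z -> u z <= W y + L * (e * (steps e y z)%:R).
  move=> Oz; rewrite uW// addrC -lerBlDr (le_trans (ler_norm _))//.
  by rewrite (le_trans (WL _ _))// ler_wpM2l// steps_lower.
move=> x; have [Ox|Ox] := pselect (Om x); last exact: out.
apply: (@euclidean_cone_comparison Om u y e L (W y) M B) => //.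
  by move=> z Oz; rewrite -um.
by move=> z t _ _; exact: out.
Qed.

End game_solution.

Lemma game_valueN Om W M e u : game_value Om W M e u ->
  game_value Om (fun x => - W x) M e (fun x => - u x).
Proof.
move=> [uM uW um]; split=> x; first by rewrite normrN.
  by move=> /uW ->.
by move=> /um Ox; rewrite midrangeN -Ox.
Qed.

(** For a vertex y outside Om this is the boundary comparison. For y in Om the
cone comparison is applied on Om without y, where the inequality at outer points z
comes from the boundary comparison for - u with vertex z. *)
Lemma game_lipschitz Om W M L B e u : 0 < e -> 0 <= L ->
  (forall x, Om x -> enorm x <= B) ->
  (forall x y, `|W x - W y| <= L * enorm (x - y)) -> game_value Om W M e u ->
  forall x y, `|u x - u y| <= L * (enorm (x - y) + e).
Proof.
move=> e0 L0 OmB WL uv.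
suff H x y : u x <= u y + L * (e * (steps e y x)%:R).
  have H' x y : u x - u y <= L * (enorm (x - y) + e).
    by rewrite lerBlDl (le_trans (H x y))// lerD2l ler_wpM2l// steps_upper.
  by move=> x y; rewrite ler_norml H' andbT lerNl opprB enormB H'.
have [uM uW um] := uv.
have [Oy|Oy] := pselect (Om y); last first.
  by rewrite (uW _ Oy); exact: (game_boundary_upper e0 L0 OmB WL uv).
have out z : ~ Om z -> u z <= u y + L * (e * (steps e y z)%:R).
  move=> Oz; have NL x' y' : `|- W x' - - W y'| <= L * enorm (x' - y').
    by rewrite -opprD normrN.
  have := game_boundary_upper e0 L0 OmB NL (game_valueN uv) Oz y.
  by rewrite stepsC (uW _ Oz) /=; lra.
have [Ox|Ox] := pselect (Om x); last exact: out.
have [->|xy] := eqVneq x y.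
  by rewrite lerDl !mulr_ge0// ltW.
apply: (@euclidean_cone_comparison (Om `\ y) u y e L (u y) M B) => //.
- by move=> z [Oz _]; exact: OmB.
- by move=> [_]; exact.
- by move=> z [Oz _]; rewrite -um.
- move=> z t [Oz _] _ nOt; have [->|ty] := eqVneq t y.
    by rewrite lerDl !mulr_ge0// ltW.
  by apply: out => Ot; apply: nOt; split=> //; apply/eqP.
- by split=> //; apply/eqP.
Qed.

End euclidean.

(** * Limits of the game values *)
Lemma ultra_fmap (T S : Type) (f : T -> S) (F : set_system T) :
  UltraFilter F -> UltraFilter (f @ F).
Proof.
move=> FU; split; first exact: fmap_proper_filter.
move=> G GP FG; apply/seteqP; split=> // A GA.
have [//|FA] := in_ultra_setVsetC (f @^-1` A) FU.
have GA' : G (~` A) by apply: FG.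
by have [z [? ?]] := filter_ex (filterI GA GA').
Qed.

Lemma ultra_bounded_cvg (R : realType) (T : Type) (F : set_system T) (f : T -> R)
    (M : R) : UltraFilter F -> (forall x, `|f x| <= M) ->
  exists2 l, `|l| <= M & f x @[x --> F] --> l.
Proof.
move=> FU fM; have FfU := ultra_fmap f FU.
have FM : (f @ F) `[- M, M]%classic.
  rewrite /fmap/=; apply: (@filterE _ F) => x /=; by rewrite in_itv/= -ler_norml.
have : compact `[- M, M]%classic by exact: segment_compact.
rewrite compact_ultra => /(_ _ FfU FM)[l [lM fl]].
by exists l => //; move: lM; rewrite /= in_itv/= ler_norml.
Qed.

(** Every bounded sequence converges along such an ultrafilter, which replaces
the extraction of subsequences. *)
Lemma ultra_sequence_ex : exists2 U : set_system nat, UltraFilter U & U `=>` \oo.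
Proof. by have [U [? ?]] := ultraFilterLemma eventually_filter; exists U. Qed.

Lemma compact_norm_ball (R : realType) n (rho : R) :
  compact [set z : 'rV[R]_n.+1 | `|z| <= rho].
Proof.
apply: bounded_closed_compact.
  exists rho; split; first exact: num_real.
  by move=> M rM x /= xr; rewrite (le_trans xr)// ltW.
rewrite (_ : mkset _ = (fun z : 'rV[R]_n.+1 => `|z|) @^-1` [set y | y <= rho])//.
by apply: preimage_closed => [x _|]; [exact: norm_continuous|exact: closed_le].
Qed.

Section limit.
Variables (R : realType) (n : nat).
Local Notation V := 'rV[R]_n.+1.

(** Comparison with cones from above, in a ball: the bound c is asked on a shell
rather than on a sphere because the moves of the game jump over spheres. *)
Definition cones_above (Om : set V) (u : V -> R) := forall y r eta c x,
  0 < r -> 0 < eta -> (forall z, enorm (z - y) < r -> Om z) ->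
  (forall w, r <= enorm (w - y) -> enorm (w - y) <= r + eta -> u w <= c) ->
  u y <= c -> enorm (x - y) < r ->
  u x <= u y + (c - u y) / r * enorm (x - y).

(** Pointwise convergence is locally uniform because the u k are Lipschitz up
to the vanishing error e k. *)
Lemma almost_lipschitz_ultra_unif (U : set_system nat) (u : nat -> V -> R)
    (v : V -> R) (e : nat -> R) (L rho eta : R) : UltraFilter U ->
  0 <= L -> 0 < eta ->
  e k @[k --> U] --> (0 : R) ->
  (forall k x y, `|u k x - u k y| <= L * (enorm (x - y) + e k)) ->
  (forall x, u k x @[k --> U] --> v x) ->
  \forall k \near U, forall z, `|z| <= rho -> `|u k z - v z| <= eta.
Proof.
move=> UU L0 eta0 e0 uL uv.
have vL x y : `|v x - v y| <= L * enorm (x - y).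
  apply: (@ler_cvg_to nat U _ R (fun k => `|u k x - u k y|) (fun k => L * (enorm (x - y) + e k))).
  - by apply: cvg_norm; apply: cvgB; exact: uv.
  - rewrite -[X in _ --> X]/(L * enorm (x - y)).
    rewrite -[X in _ * X]addr0; apply: cvgMl_tmp; apply: cvgD => //; exact: cvg_cst.
  - by apply: filterE => k; exact: uL.
have K := @compact_norm_ball R n rho.
move/compact_near_coveringP : K => /(_ nat U (fun k z => `|u k z - v z| <= eta)).
apply => //= x _.
pose d := eta / (4 * (L + 1) * n.+1%:R).
have L1 : 0 < L + 1 by rewrite ltr_wpDl.
have d0 : 0 < d by rewrite /d divr_gt0// !mulr_gt0.
exists (ball x d, [set k | `|u k x - v x| <= eta / 4 /\ e k <= eta / (4 * (L + 1))]).
  split; first exact: nbhsx_ballx.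
  near=> k; split.
    rewrite distrC; near: k; apply: (cvgr_dist_le _ _ (uv x)); exact: divr_gt0.
  near: k; apply: (cvgr_le _ e0); by rewrite divr_gt0// mulr_gt0.
move=> [z k] /= [xz [ukx ek]].
have nxz : enorm (z - x) <= eta / (4 * (L + 1)).
  rewrite (le_trans (enorm_le_norm _))// mulrC -ler_pdivlMr//.
  move: xz; rewrite -ball_normE /ball_/= => /ltW; rewrite distrC => /le_trans; apply.
  by rewrite /d invfM mulrA.
have LL : L * (eta / (4 * (L + 1))) <= eta / 4.
  rewrite (_ : L * _ = (eta / 4) * (L / (L + 1))); last by field; rewrite gt_eqF.
  by rewrite ler_piMr ?divr_ge0 ?(ltW eta0)// ler_pdivrMr// mul1r lerDl.
have h1 := uL k z x; have h2 := vL z x.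
have h3 : L * (enorm (z - x) + e k) <= L * (eta / (4 * (L + 1)) + eta / (4 * (L + 1))).
  by rewrite ler_wpM2l// lerD.
have h4 : L * enorm (z - x) <= L * (eta / (4 * (L + 1))) by rewrite ler_wpM2l.
rewrite mulrDr in h3.
move: h1 h2 ukx; rewrite !ler_norml => /andP[? ?] /andP[? ?] /andP[? ?].
apply/andP; split; lra.
Unshelve. all: by end_near. Qed.

(** Once the steps are shorter than the width of the shell, a move from the
ball ends in the ball or in the shell, so u k obeys the discrete cone comparison
with a slope slightly above that of the limit cone. *)
Lemma game_limit_cones (Om : set V) (U : set_system nat) (W : V -> R)
    (u : nat -> V -> R) (v : V -> R) (e : nat -> R) (M L : R) : UltraFilter U ->
  0 <= L -> (forall k, 0 < e k) -> e k @[k --> U] --> (0 : R) ->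
  (forall k, game_value Om W M (e k) (u k)) ->
  (forall k x y, `|u k x - u k y| <= L * (enorm (x - y) + e k)) ->
  (forall x, u k x @[k --> U] --> v x) ->
  cones_above Om v.
Proof.
move=> UU L0 ep e0 gv uL uv y r eta c x r0 eta0 ballOm shell vyc xr.
set d := enorm (x - y).
(* C collects the factors of s in the errors below; s bounds the step size and the
   distance of u k to v. *)
pose C := 2 + 2 * (d + 1) / r + (c - v y) / r.
have C0 : 0 < C.
  rewrite /C ltr_wpDr ?divr_ge0 ?(ltW r0) ?subr_ge0//.
  by rewrite ltr_wpDr// divr_ge0 ?(ltW r0)// mulr_ge0// addr_ge0// enorm_ge0.
apply/ler_addgt0Pr => eps eps0.
pose s := Num.min (Num.min 1 (eps / C)) eta.
have s0 : 0 < s by rewrite /s !lt_min ltr01 divr_gt0//= eta0.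
have sC : s * C <= eps by rewrite -ler_pdivlMr// /s !ge_min lexx orbT.
have s1 : s <= 1 by rewrite /s !ge_min lexx.
have se : s <= eta by rewrite /s !ge_min lexx !orbT.
have [k [kunif ek]] : exists k,
    (forall z, `|z| <= enorm y + r + eta -> `|u k z - v z| <= s) /\ e k <= s.
  apply: (@filter_ex _ U); near=> k; split.
    by near: k; exact: (@almost_lipschitz_ultra_unif U u v e L).
  by near: k; apply: (cvgr_le _ e0).
have near_y z : enorm (z - y) <= r + eta -> `|u k z - v z| <= s.
  move=> zy; apply: kunif; rewrite (le_trans (norm_le_enorm _))// -[z](subrK y).
  by rewrite (le_trans (enormD _ _))// addrC -addrA lerD2l.
have yy : enorm (y - y) = 0 by rewrite subrr enorm0.
have uky : `|u k y - v y| <= s by apply: near_y; rewrite yy addr_ge0// ltW.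
have [uM _ um] := gv k.
pose a := (c - v y + 2 * s) / r.
have a0 : 0 <= a by rewrite divr_ge0 ?(ltW r0)// addr_ge0 ?subr_ge0// mulr_ge0// ltW.
have ar : a * r = c - v y + 2 * s by rewrite /a divfK// gt_eqF.
have ae t : 0 <= a * (e k * (steps (e k) y t)%:R).
  by apply: mulr_ge0 => //; apply: mulr_ge0 => //; apply: ltW.
have key : u k x <= u k y + a * (e k * (steps (e k) y x)%:R).
  have [->|xy] := eqVneq x y.
    by rewrite lerDl ae.
  apply: (@euclidean_cone_comparison _ _ [set z | enorm (z - y) < r /\ z != y]
    (u k) y (e k) a (u k y) M (enorm y + r)) => //.
  - move=> z [zy _]; rewrite -[z](subrK y) (le_trans (enormD _ _))// addrC.
    by rewrite lerD2l ltW.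
  - by move=> [_]; rewrite eqxx.
  - by move=> z [/ballOm/um <-].
  - move=> z t [zr zy] zt nt.
    have [->|ty] := eqVneq t y.
      by rewrite lerDl ae.
    have rt : r <= enorm (t - y).
      by rewrite leNgt; apply/negP => tr; apply: nt.
    have tre : enorm (t - y) <= r + eta.
      rewrite (le_trans (enorm_dist t z y))// addrC lerD ?(ltW zr)//.
      by rewrite (le_trans zt)// (le_trans ek).
    have vt := shell _ rt tre.
    have := near_y _ tre; rewrite ler_norml => /andP[_ h1].
    move: uky; rewrite ler_norml => /andP[h2 _].
    have h3 := steps_lower y t (ep k).
    have : a * r <= a * (e k * (steps (e k) y t)%:R).
      by rewrite ler_wpM2l// (le_trans rt).
    rewrite ar; lra.
have ux : `|u k x - v x| <= s.
  by apply: near_y; rewrite (le_trans (ltW xr))// lerDl ltW.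
have h : a * (e k * (steps (e k) y x)%:R) <= a * (d + s).
  by rewrite ler_wpM2l// (le_trans (steps_upper _ _ (ep k)))// lerD2l.
have -> : v y + (c - v y) / r * d + eps =
    v y + a * (d + s) + 2 * s + (eps - (2 * s + 2 * s * (d + s) / r + (c - v y) * s / r)).
  by rewrite /a; field; rewrite gt_eqF.
have h5 : 2 * s + 2 * s * (d + s) / r + (c - v y) * s / r <= s * C.
  rewrite (_ : s * C = 2 * s + 2 * s * (d + 1) / r + (c - v y) * s / r); last first.
    by rewrite /C; field; rewrite gt_eqF.
  rewrite lerD2r lerD2l ler_pM2r ?invr_gt0//; apply: ler_wpM2l; last by rewrite lerD2l.
  by apply: mulr_ge0 => //; apply: ltW.
move: ux uky; rewrite !ler_norml => /andP[? ?] /andP[? ?]; lra.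
Unshelve. all: by end_near. Qed.

(** The midrange equation is invariant under u -> - u, so the limit enjoys
comparison with cones from above and from below, that is, it is absolutely
minimizing. *)
Lemma cone_extension_exists (Om : set V) (W : V -> R) (M L B : R) : 0 <= L ->
  (forall x, Om x -> enorm x <= B) -> (forall x, `|W x| <= M) ->
  (forall x y, `|W x - W y| <= L * enorm (x - y)) ->
  exists u : V -> R, [/\ forall x y, `|u x - u y| <= L * enorm (x - y),
    forall x, `|u x| <= M,
    forall x, ~ Om x -> u x = W x, cones_above Om u &
    cones_above Om (fun x => - u x)].
Proof.
move=> L0 OmB WM WL.
pose e (k : nat) : R := k.+1%:R^-1.
have ep k : 0 < e k by rewrite invr_gt0.
have [u uP] : {u : nat -> V -> R & forall k, game_value Om W M (e k) (u k)}.
  apply: (@choice nat (V -> R) (fun k v => game_value Om W M (e k) v)) => k.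
  by have [v [? ? ?]] := game_value_exists (fun x => nbh_refl x (ep k)) Om WM; exists v.
have [U UU ooU] := ultra_sequence_ex.
have e0 : e k @[k --> U] --> (0 : R).
  by apply: cvg_trans (@cvg_harmonic R); exact: cvg_app.
have uL k x y := game_lipschitz (ep k) L0 OmB WL (uP k) x y.
have [v vP] : {v : V -> R & forall x, u k x @[k --> U] --> v x}.
  apply: (@choice V R (fun x l => u k x @[k --> U] --> l)) => x.
  have [|l _ ul] := @ultra_bounded_cvg R nat U (fun k => u k x) M UU; last by exists l.
  by move=> k; have [] := uP k.
exists v; split.
- move=> x y; apply: (@ler_cvg_to nat U _ R (fun k => `|u k x - u k y|) (fun k => L * (enorm (x - y) + e k))).
  + by apply: cvg_norm; apply: cvgB; exact: vP.
  + rewrite -[X in _ --> X]/(L * enorm (x - y)).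
    rewrite -[X in _ * X]addr0; apply: cvgMl_tmp; apply: cvgD => //; exact: cvg_cst.
  + by apply: filterE => k; exact: uL.
- move=> x; apply: (cvgr_to_le (cvg_norm (vP x))); apply: filterE => k.
  by have [] := uP k.
- move=> x Ox; have ux k : u k x = W x by have [_ ->] := uP k.
  have := vP x; under eq_fun do rewrite ux.
  by move/(@norm_cvg_unique _ R^o _ _); apply; exact: cvg_cst.
- exact: (@game_limit_cones Om U W u v e M L).
- apply: (@game_limit_cones Om U (fun x => - W x) (fun k x => - u k x) _ e M L) => //.
  + by move=> k; exact: game_valueN.
  + by move=> k x y; rewrite -opprD normrN.
  + by move=> x; apply: cvgN.
Qed.

End limit.

(** * From comparison with cones to jets *)
Section jets.
Variables (R : realType) (n : nat).
Local Notation V := 'rV[R]_n.+1.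
Implicit Types (X : 'M[R]_n.+1) (x y z p : V).

Lemma quadZ X a z : quad X (a *: z) = a ^+ 2 * quad X z.
Proof.
rewrite /quad mulr_sumr; apply: eq_bigr => i _; rewrite mulr_sumr.
by apply: eq_bigr => j _; rewrite !mxE; ring.
Qed.

Lemma quadN X z : quad (- X) z = - quad X z.
Proof.
rewrite /quad -sumrN; apply: eq_bigr => i _; rewrite -sumrN.
by apply: eq_bigr => j _; rewrite !mxE; ring.
Qed.

Lemma quad_lipschitz X : exists2 K, 0 <= K & forall w e, enorm w = 1 ->
  enorm e = 1 -> quad X w <= quad X e + K * enorm (w - e).
Proof.
exists (2 * \sum_i \sum_j `|X i j|).
  by rewrite mulr_ge0// sumr_ge0// => i _; rewrite sumr_ge0.
move=> w e w1 e1; rewrite -lerBlDl mulr_sumr mulr_suml /quad -sumrB.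
apply: ler_sum => i _; rewrite mulr_sumr mulr_suml -sumrB.
apply: ler_sum => j _.
set d := enorm (w - e).
have := coord_le_enorm w i; have := coord_le_enorm e j; rewrite w1 e1 => ej wi.
have := coord_le_enorm (w - e) i; have := coord_le_enorm (w - e) j.
rewrite !mxE -/d => dj di.
apply: le_trans (ler_norm _) _.
rewrite (_ : _ - _ = X i j * (w ord0 i * (w ord0 j - e ord0 j) +
  (w ord0 i - e ord0 i) * e ord0 j)); last by ring.
rewrite normrM -mulrA mulrCA; apply: ler_wpM2l => //.
apply: le_trans (ler_normD _ _) _; rewrite !normrM mulrDl mul1r lerD//.
  by rewrite -[leRHS]mul1r ler_pM.
by rewrite -[leRHS]mulr1 ler_pM.
Qed.

(** The hypothesis only controls X in the direction p. For z of length s in a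
direction at distance t from that of p, the linear term loses |p| s t ^ 2 / 2, and
this beats the possible gain K t s ^ 2 of the quadratic term up to a multiple of
s ^ 3. Hence near x the function u lies below the cone of slope |p| with vertex x
by a quadratic amount in every direction. *)
Lemma superjet_radial_bound (u : V -> R) x p X : superjet u x (p, X) ->
  quad X p < 0 -> exists rho kappa, [/\ 0 < rho, 0 < kappa,
   (forall z, enorm z <= rho ->
     u (x + z) <= u x + enorm p * enorm z - kappa * enorm z ^+ 2) &
   (forall t, 0 <= t -> t * enorm p <= rho -> u (x - t *: p) <= u x - t * enorm p ^+ 2)].
Proof.
move=> [_ [r ro ur]] qlt /=.
have p0 : p != 0.
  apply: contraTneq qlt => ->; rewrite -(scale0r (0 : V)) quadZ expr0n/= mul0r.
  by rewrite ltxx.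
set P := enorm p; have P0 : 0 < P by exact: enorm_gt0.
set q := quad X p in qlt.
have [e [pe e1 qe]] : exists e, [/\ p = P *: e, enorm e = 1 & quad X e = q / P ^+ 2].
  exists (P^-1 *: p); rewrite scalerA mulfV ?gt_eqF// scale1r quadZ exprVn mulrC.
  by rewrite enormZ gtr0_norm ?invr_gt0// mulVf ?gt_eqF.
pose kap := - q / (4 * P ^+ 2).
have kap0 : 0 < kap by rewrite divr_gt0 ?oppr_gt0// mulr_gt0// exprn_gt0.
have [K K0 KX] := quad_lipschitz X.
have /eqoP/(_ (kap / 2)) := ro; rewrite divr_gt0// => /(_ isT) rsmall.
have [d /= d0 H] := nbhs_norm0P.1 (filterI rsmall ur).
have {}H z : enorm z < d -> `|r z| <= kap / 2 * enorm z ^+ 2 /\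
    u (x + z) <= u x + dotv p z + 2^-1 * quad X z + r z.
  move=> zd; have [|h1 h2] := H z; first exact: le_lt_trans (norm_le_enorm z) zd.
  by split=> //; rewrite (le_trans h1)// ger0_norm// sqr_ge0.
pose rho := Num.min (d / 2) (kap * P / (K ^+ 2 + 1)).
have K21 : 0 < K ^+ 2 + 1 by rewrite ltr_wpDl// sqr_ge0.
have rho0 : 0 < rho by rewrite lt_min !divr_gt0// mulr_gt0.
have rhod s : s <= rho -> s < d.
  rewrite /rho le_min => /andP[h _]; lra.
have rhoK s : 0 <= s -> s <= rho -> s * K ^+ 2 <= kap * P.
  rewrite /rho le_min => s0 /andP[_]; rewrite ler_pdivlMr// => h.
  by apply: le_trans h; rewrite mulrDr mulr1 lerDl.
exists rho, kap; split=> //.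
  move=> z zrho; have [h1 h2] := H _ (rhod _ zrho).
  have [->|z0] := eqVneq z 0.
    by rewrite addr0 enorm0 expr0n/= !mulr0 subr0 addr0.
  set s := enorm z in zrho h1 *.
  have s0 : 0 < s by exact: enorm_gt0.
  have [w [zw w1]] : exists w, z = s *: w /\ enorm w = 1.
    exists (s^-1 *: z); rewrite scalerA mulfV ?gt_eqF// scale1r.
    by rewrite enormZ gtr0_norm ?invr_gt0// mulVf ?gt_eqF.
  set t := enorm (w - e).
  have t2 : dotv p z = s * P * (1 - t ^+ 2 / 2).
    rewrite {1}zw dotvZr -mulrA; congr (_ * _).
    rewrite pe dotvZl; congr (_ * _).
    rewrite /t sqr_enorm -(scaleN1r e) !(dotvDl, dotvDr, dotvZl, dotvZr).
    by rewrite -!sqr_enorm w1 e1 (dotvC e w); field.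
  have qz : quad X z <= s ^+ 2 * (q / P ^+ 2 + K * t).
    by rewrite zw quadZ ler_pM2l ?exprn_gt0// -qe; apply: KX.
  have rz : r z <= kap / 2 * s ^+ 2 by exact: le_trans (ler_norm _) h1.
  have qkap : q / P ^+ 2 = - 4 * kap.
    by rewrite /kap; field; rewrite gt_eqF.
  rewrite qkap in qz.
  have sK := rhoK _ (ltW s0) zrho.
  (* Young's inequality; the last term uses s K ^ 2 <= kap P, the choice of rho. *)
  have amgm : s * (K * t) <= P * t ^+ 2 / 2 + s * (kap / 2).
    have : 0 <= (P * t - s * K) ^+ 2 by exact: sqr_ge0.
    have : s * (s * K ^+ 2) <= s * (kap * P) by rewrite ler_pM2l.
    rewrite sqrrB !exprMn => h3 h4.
    have h5 : P * (s * (K * t)) <= P * (P * t ^+ 2 / 2 + s * (kap / 2)) by lra.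
    by rewrite ler_pM2l in h5.
  have : s * (s * (K * t)) <= s * (P * t ^+ 2 / 2 + s * (kap / 2)).
    by rewrite ler_pM2l.
  rewrite t2 in h2.
  have : 0 <= s * (P * t ^+ 2) by rewrite mulr_ge0 ?(ltW s0)// mulr_ge0 ?(ltW P0)// sqr_ge0.
  have : 0 < kap * s ^+ 2 by rewrite mulr_gt0// exprn_gt0.
  have e2 : s ^+ 2 = s * s by rewrite expr2.
  rewrite e2 in qz rz *.
  lra.
move=> t t0 tP.
have etp : enorm (- (t *: p)) = t * P by rewrite enormN enormZ ger0_norm.
have := H (- (t *: p)); rewrite etp => /(_ (rhod _ tP))[h1 h2].
rewrite -scaleNr dotvZr quadZ -sqr_enorm -/P -/q sqrrN in h2.
have {}h1 : r (- t *: p) <= kap / 2 * (t * P) ^+ 2.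
  by rewrite scaleNr; exact: le_trans (ler_norm _) h1.
rewrite scaleNr in h1 h2.
have kP : kap * P ^+ 2 = - q / 4 by rewrite /kap; field; rewrite gt_eqF.
have h3 : kap / 2 * (t * P) ^+ 2 = - (t ^+ 2 * q) / 8.
  rewrite exprMn (_ : kap / 2 * _ = t ^+ 2 / 2 * (kap * P ^+ 2)); last by ring.
  by rewrite kP; field.
have h4 : t ^+ 2 * q <= 0 by rewrite mulr_ge0_le0 ?sqr_ge0// ltW.
rewrite /= in h2; lra.
Qed.

(** Take a cone whose vertex y lies slightly behind x, at distance m in the
direction - p. On the shell of radius r around y, u is below u x + |p| r by about
kap r ^ 2, so comparison bounds the slope of u from y to x by less than |p|; but
u x - u y is at least m |p|. The choice of m against kap r ^ 2 / |p| makes the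
two incompatible. *)
Lemma cones_above_superjet (Om : set V) (u : V -> R) x p X : open Om ->
  cones_above Om u -> Om x -> superjet u x (p, X) -> 0 <= quad X p.
Proof.
move=> oOm cu Ox sj; rewrite leNgt; apply/negP => qlt.
have [rho [kap [rho0 kap0 rad line]]] := superjet_radial_bound sj qlt.
have p0 : p != 0.
  apply: contraTneq qlt => ->; rewrite -(scale0r (0 : V)) quadZ expr0n/= mul0r.
  by rewrite ltxx.
set P := enorm p in rad line; have P0 : 0 < P by exact: enorm_gt0.
have [d /= d0 dOm] := (nbhs_normP _ _).1 (open_nbhs_nbhs (conj oOm Ox)).
pose r := Num.min (rho / 4) (d / 4).
have r0 : 0 < r by rewrite lt_min !divr_gt0.
have rrho : r <= rho / 4 by rewrite ge_min lexx.
have rd : r <= d / 4 by rewrite ge_min lexx orbT.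
pose m := Num.min (r / 2) (kap * r ^+ 2 / (16 * P)).
have m0 : 0 < m by rewrite lt_min !divr_gt0// ?mulr_gt0// exprn_gt0.
have mr : m <= r / 2 by rewrite ge_min lexx.
have mP : 16 * (m * P) <= kap * r ^+ 2.
  by rewrite mulrCA -ler_pdivlMr ?mulr_gt0// ge_min lexx orbT.
pose y := x - (m / P) *: p.
have xy : enorm (x - y) = m.
  by rewrite opprB addrC subrK enormZ gtr0_norm ?divr_gt0// divfK ?gt_eqF.
have uy : u y <= u x - m * P.
  apply: (le_trans (line (m / P) _ _)).
  - by rewrite divr_ge0 ?ltW.
  - by rewrite divfK ?gt_eqF//; lra.
  - by rewrite expr2 mulrA divfK ?gt_eqF.
pose c := u x + P * (r + 2 * m) - kap * (r - m) ^+ 2.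
have shell w : r <= enorm (w - y) -> enorm (w - y) <= r + m -> u w <= c.
  move=> w1 w2.
  have s1 : enorm (w - x) <= r + 2 * m.
    by have := enorm_dist w y x; rewrite (enormB y x) xy; lra.
  have s2 : r - m <= enorm (w - x).
    by have := enorm_dist w x y; rewrite xy; lra.
  have h := rad (w - x); rewrite (addrC x) subrK in h.
  apply: le_trans (h _) _; first by lra.
  rewrite /c lerB// ?lerD2l ?ler_pM2l//.
  by rewrite ler_pXn2r ?nnegrE ?enorm_ge0//; lra.
have ball z : enorm (z - y) < r -> Om z.
  move=> zr; apply: dOm; rewrite /= distrC.
  apply: le_lt_trans (norm_le_enorm _) _.
  by have := enorm_dist z y x; rewrite (enormB y x) xy; lra.
have mP0 : 0 < m * P by rewrite mulr_gt0.
have [uyc|cuy] := leP (u y) c; last first.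
  have h := cu y r m (u y) x r0 m0 ball; rewrite xy subrr !mul0r addr0 in h.
  have : u x <= u y.
    apply: h => //; last by lra.
    by move=> w w1 w2; rewrite (le_trans (shell w w1 w2))// ltW.
  lra.
have := cu y r m c x r0 m0 ball shell uyc; rewrite xy => /(_ _) h.
have {}h : u x <= u y + (c - u y) / r * m by apply: h; lra.
have h1 : u x * r <= u y * (r - m) + c * m.
  rewrite -ler_pdivlMr// (le_trans h)// le_eqVlt; apply/orP; left; apply/eqP.
  by field; rewrite gt_eqF.
have h2 : u y * (r - m) <= (u x - m * P) * (r - m) by rewrite ler_wpM2r//; lra.
have h3 : 0 <= m * (3 * (m * P) - kap * (r - m) ^+ 2).
  by rewrite /c in h1; lra.
rewrite pmulr_rge0// in h3.
have h4 : kap * (r / 2) ^+ 2 <= kap * (r - m) ^+ 2.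
  by rewrite ler_pM2l// ler_pXn2r ?nnegrE//; lra.
lra.
Qed.

Lemma subjet_superjetN (u : V -> R) x p X : subjet u x (p, X) ->
  superjet (fun y => - u y) x (- p, - X).
Proof.
move=> [/= XT [r ro ur]]; split; first by rewrite /= linearN/= XT.
exists (- r).
  by apply/eqoP => e e0; have /eqoP/(_ _ e0) := ro; apply: filterS => z; rewrite normrN.
apply: filterS ur => z /=; rewrite quadN -(scaleN1r p) dotvZl /=.
rewrite [(- r) z](_ : _ = - r z)//; lra.
Qed.

Lemma cones_below_subjet (Om : set V) (u : V -> R) x p X : open Om ->
  cones_above Om (fun x => - u x) -> Om x -> subjet u x (p, X) -> quad X p <= 0.
Proof.
move=> oOm cu Ox /subjet_superjetN/(cones_above_superjet oOm cu Ox).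
by rewrite quadN -(scaleN1r p) quadZ sqrrN expr1n mul1r oppr_ge0.
Qed.

End jets.

(** * Boxes and Lebesgue measure *)
Section boxes.
Variables (R : realType).
Implicit Types m : nat.

(** Half-open boxes are stable under intersection and can be cut into boxes
without overlap. *)
Definition box m (a b : 'rV[R]_m) : set 'rV[R]_m :=
  [set x | forall i, a ord0 i < x ord0 i <= b ord0 i].

Definition boxes m : set (set 'rV[R]_m) := [set Q | exists a b, Q = box a b].

Lemma measurable_box m (a b : 'rV[R]_m) : measurable (box a b).
Proof.
have -> : box a b = \bigcap_(i in [set: 'I_m])
    (@rV_coord R m i @^-1` `]a ord0 i, b ord0 i]%classic).
  by apply/seteqP; split=> [x xab i _|x xab i] /=; [|have := xab i I];
    rewrite /rV_coord/= in_itv/=.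
apply: fin_bigcap_measurable => // i _.
rewrite -[X in measurable X]setTI; apply: measurable_rV_coord => //.
Qed.

Lemma box_setI m (a b c d : 'rV[R]_m) : box a b `&` box c d =
  box (\row_i Num.max (a ord0 i) (c ord0 i)) (\row_i Num.min (b ord0 i) (d ord0 i)).
Proof.
apply/seteqP; split=> x /=.
  move=> [h1 h2] i; have /andP[? ?] := h1 i; have /andP[? ?] := h2 i.
  by rewrite !mxE gt_max le_min; apply/andP; split; apply/andP.
by move=> h; split=> i; have := h i; rewrite !mxE gt_max le_min;
  move=> /andP[/andP[? ?] /andP[? ?]]; apply/andP.
Qed.

Lemma boxes_setI_closed m : setI_closed (@boxes m).
Proof.
by move=> _ _ [a [b ->]] [c [d ->]]; rewrite box_setI; do 2 eexists.
Qed.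

Definition cube m (k : nat) : set 'rV[R]_m := box (const_mx (- k%:R)) (const_mx k%:R).

Lemma norm_cube m (x : 'rV[R]_m) (k : nat) : `|x| < k%:R -> @cube m k x.
Proof.
move=> xk i; rewrite !mxE; have := le_lt_trans (mx_norm_coord x i) xk.
by rewrite ltr_norml => /andP[-> /ltW].
Qed.

Lemma cube_norm m (x : 'rV[R]_m) (k : nat) : @cube m k x -> `|x| <= k%:R.
Proof.
move=> xk; apply: mx_norm_le => // j.
have := xk j; rewrite !mxE => /andP[/ltW h1 h2].
by rewrite ler_norml; apply/andP; split.
Qed.

Lemma cube_cover m : \bigcup_k @cube m k = setT.
Proof.
apply/seteqP; split=> // x _; exists (Num.truncn `|x|).+1 => //.
by apply: norm_cube; rewrite truncnS_gt.
Qed.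

Lemma boxes_generate m : @measurable _ 'rV[R]_m = <<s @boxes m >>.
Proof.
apply/seteqP; split; last first.
  apply: smallest_sub; first exact: sigma_algebra_measurable.
  by move=> _ [a [b ->]]; exact: measurable_box.
apply: smallest_sub; first exact: smallest_sigma_algebra.
rewrite -bigcup_seq/=; apply: bigcup_sub => i _ B [C mC <-].
pose T := g_sigma_algebraType (@boxes m).
suff : measurable_fun [set: T] (@rV_coord R m i : T -> measurableTypeR R).
  by move=> /(_ measurableT C mC).
apply: (@measurability _ _ T (measurableTypeR R) setT _ (@ocitv R)) => //.
move=> _ [_ [[x y] _ <-] <-]; rewrite setTI.
have -> : (@rV_coord R m i) @^-1` `]x, y]%classic = \bigcup_k
    box (\row_j if j == i then x else - k%:R) (\row_j if j == i then y else k%:R).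
  apply/seteqP; split=> z /=.
    rewrite in_itv/= => zxy.
    have [k _ kz] : (\bigcup_k @cube m k) z by rewrite cube_cover.
    exists k => // j; rewrite !mxE; case: eqP => [->//|_].
    by have := kz j; rewrite !mxE.
  by move=> [k _ /(_ i)]; rewrite !mxE eqxx in_itv.
apply: (@bigcupT_measurable _ T) => k; apply: sub_sigma_algebra.
by do 2 eexists.
Qed.

Lemma box0 m (a b : 'rV[R]_m) : ~ (forall i, a ord0 i <= b ord0 i) ->
  box a b = set0.
Proof.
move=> h; apply/seteqP; split=> // x xab; apply: h => i.
by have /andP[/ltW h1] := xab i; exact: le_trans.
Qed.

Lemma lebesgue_box m (a b : 'rV[R]_m) : (forall i, a ord0 i <= b ord0 i) ->
  lebesgue_rV R m (box a b) = (\prod_i (b ord0 i - a ord0 i))%:E.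
Proof.
elim: m a b => [|m IHm] a b ab.
  rewrite big_ord0 /= diracE mem_set// => i; by case: i.
pose a' : 'rV[R]_m := \row_i a ord0 (lift ord0 i).
pose b' : 'rV[R]_m := \row_i b ord0 (lift ord0 i).
have -> : box a b = @rV_uncons R m @^-1` (`]a ord0 ord0, b ord0 ord0]%classic `*` box a' b').
  apply/seteqP; split=> x /=.
    by move=> h; split=> [|i] /=; [rewrite in_itv; exact: h|rewrite !mxE; exact: h].
  move=> [] /=; rewrite in_itv/= => h0 h i.
  case: (unliftP ord0 i) => [j|] -> //.
  by have := h j; rewrite !mxE.
rewrite lebesgue_rVX//; last exact: measurable_box.
rewrite [X in (_ * X)%E]IHm; last by move=> i; rewrite !mxE.
rewrite big_ord_recl EFinM; congr (_ * _)%E; last first.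
  by congr EFin; apply: eq_bigr => i _; rewrite !mxE.
rewrite lebesgue_measure_itv/= lte_fin; case: ltP => //.
by move=> ba; rewrite (le_anti (_ : b ord0 ord0 <= a ord0 ord0 <= b ord0 ord0)%R)
  ?subrr// ba ab.
Qed.

Lemma lebesgue_box_fin m (a b : 'rV[R]_m) : (lebesgue_rV R m (box a b) < +oo)%E.
Proof.
have [ab|nab] := pselect (forall i, a ord0 i <= b ord0 i).
  by rewrite lebesgue_box// ltry.
by rewrite box0// measure0.
Qed.

Lemma lebesgue_bounded_fin m (A : set 'rV[R]_m) : measurable A -> bounded_set A ->
  (lebesgue_rV R m A < +oo)%E.
Proof.
move=> mA [M [_ AM]]; pose k := (Num.truncn (M + 1)).+1.
apply: (@le_lt_trans _ _ (lebesgue_rV R m (@cube m k))); last exact: lebesgue_box_fin.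
apply: le_measure; rewrite ?inE//; first exact: measurable_box.
move=> x Ax; apply: norm_cube; apply: le_lt_trans (AM (M + 1) _ x Ax) _.
  by rewrite ltrDl.
exact: truncnS_gt.
Qed.

Lemma boxes_measure_unique m (m1 m2 : {measure set 'rV[R]_m -> \bar R}) :
  (forall a b, m1 (box a b) = m2 (box a b)) -> (forall a b, m1 (box a b) < +oo)%E ->
  forall A, measurable A -> m1 A = m2 A.
Proof.
move=> m12 m1oo A mA; apply: (@g_sigma_algebra_measure_unique _ R 'rV[R]_m (@boxes m) _ (@cube m)) => //.
- by move=> _ [a [b ->]]; exact: measurable_box.
- by move=> k; do 2 eexists.
- exact: cube_cover.
- exact: boxes_setI_closed.
- by move=> _ [a [b ->]].
- by move=> k; exact: m1oo.
- by rewrite -boxes_generate.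
Qed.

Definition translate m (h x : 'rV[R]_m) := x + h.

Lemma measurable_translate m (h : 'rV[R]_m) :
  measurable_fun [set: 'rV[R]_m] (translate h).
Proof.
apply: measurable_to_rV => i.
rewrite (_ : _ \o _ = (fun x => rV_coord i x + h ord0 i)); last first.
  by apply/funext => x; rewrite /rV_coord/= mxE.
by apply: measurable_funD => //; exact: measurable_rV_coord.
Qed.

(** The product formula on boxes is translation invariant, and boxes determine the
measure. *)
Lemma lebesgue_translate m (h : 'rV[R]_m) A : measurable A ->
  lebesgue_rV R m (translate h @^-1` A) = lebesgue_rV R m A.
Proof.
move=> mA; pose nu := pushforward (lebesgue_rV R m) (translate h).
have mh := @measurable_translate m h.
pose H := isMeasurableFun.Build _ _ _ _ (@translate m h) mh.
pose tr : {mfun 'rV[R]_m >-> 'rV[R]_m} := HB.pack (translate h) H.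
suff : pushforward (lebesgue_rV R m) tr A = lebesgue_rV R m A by [].
have E (a b : 'rV[R]_m) : translate h @^-1` box a b = box (a - h) (b - h).
  apply/seteqP; split=> x /= H' i; have := H' i; rewrite !mxE.
    by rewrite ltrBlDr lerBrDr.
  by rewrite ltrBlDr lerBrDr.
apply: boxes_measure_unique => // a b.
  rewrite /= /pushforward /= E.
  have [ab|nab] := pselect (forall i, a ord0 i <= b ord0 i).
    rewrite !lebesgue_box//; last by move=> i; rewrite !mxE lerD2r.
    by congr EFin; apply: eq_bigr => i _; rewrite !mxE; ring.
  rewrite !box0// => ab; apply: nab => i; have := ab i.
  by rewrite !mxE lerD2r.
by rewrite /= /pushforward /= E; exact: lebesgue_box_fin.
Qed.

End boxes.

Section inner_boxes.
Variables (R : realType) (n : nat).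
Local Notation V := 'rV[R]_n.+1.
Implicit Types (Om : set V) (a b c d x y : V) (i j : 'I_n.+1).

Definition cbox a b : set V := [set x | forall i, a ord0 i <= x ord0 i <= b ord0 i].

(** The margin eta leaves room for test functions in Om that converge to the
indicator of the box. *)
Definition inner_box Om c d := (forall j, c ord0 j < d ord0 j) /\
  exists2 eta : R, 0 < eta & cbox c (d + const_mx eta) `<=` Om.

Lemma inner_box_sub Om c d : inner_box Om c d -> box c d `<=` Om.
Proof.
move=> [cd [eta eta0 sub]] x xQ; apply: sub => j; rewrite !mxE.
by have /andP[/ltW -> h] := xQ j; rewrite (le_trans h)// lerDl ltW.
Qed.

Lemma inner_box_ball Om x c d (r : R) : (forall y, `|x - y| < r -> Om y) ->
  (forall j, c ord0 j < d ord0 j) -> `|x - c| < r -> `|x - d| < r -> inner_box Om c d.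
Proof.
move=> xr cd xc xd; split=> //; exists ((r - `|x - d|) / 2); first by lra.
move=> y yQ; apply: xr; apply: mx_norm_lt => [|j].
  by move: (normr_ge0 (x - d)); lra.
rewrite !mxE; have := yQ j; rewrite !mxE => /andP[y1 y2].
move: (mx_norm_coord (x - c) j) (mx_norm_coord (x - d) j); rewrite !mxE => h1 h2.
by move: h1 h2; rewrite !ler_norml !ltr_norml => /andP[? ?] /andP[? ?]; apply/andP; split; lra.
Qed.

Definition rat_lo (q : 'rV[rat]_n.+1 * nat) : V :=
  \row_i ratr (q.1 ord0 i) - const_mx q.2.+1%:R^-1.
Definition rat_hi (q : 'rV[rat]_n.+1 * nat) : V :=
  \row_i ratr (q.1 ord0 i) + const_mx q.2.+1%:R^-1.

Lemma open_rat_inner_box Om x : open Om -> Om x ->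
  exists q, inner_box Om (rat_lo q) (rat_hi q) /\ box (rat_lo q) (rat_hi q) x.
Proof.
move=> oA Ax.
have [e /= e0 xe] := (nbhs_normP _ _).1 (open_nbhs_nbhs (conj oA Ax)).
pose k := Num.truncn (2 / e).
have ke : k.+1%:R^-1 < e / 2.
  by rewrite invf_plt ?posrE ?divr_gt0// invf_div truncnS_gt.
have k0 : 0 < k.+1%:R^-1 :> R by rewrite invr_gt0 ltr0n.
have /choice[q qP] : forall i, exists q : rat,
    x ord0 i - k.+1%:R^-1 < ratr q < x ord0 i + k.+1%:R^-1.
  move=> i; have [|q] := @rat_in_itvoo R (x ord0 i - k.+1%:R^-1) (x ord0 i + k.+1%:R^-1).
    by rewrite ltrD2l gtrN.
  by rewrite in_itv; exists q.
exists (\row_i q i, k); split; last first.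
  move=> i; rewrite !mxE /=; have /andP[h3 h4] := qP i.
  move: (k.+1%:R^-1 : R) h3 h4 => t h3 h4; apply/andP; split; lra.
apply: (@inner_box_ball Om x _ _ e) => // [j||]; first by rewrite !mxE; move: (k.+1%:R^-1 : R) k0 => t; lra.
- apply: mx_norm_lt => // i; rewrite !mxE /=; have /andP[h3 h4] := qP i.
  move: (k.+1%:R^-1 : R) ke k0 h3 h4 => t ke k0 h3 h4; rewrite ltr_norml; apply/andP; split; lra.
- apply: mx_norm_lt => // i; rewrite !mxE /=; have /andP[h3 h4] := qP i.
  move: (k.+1%:R^-1 : R) ke k0 h3 h4 => t ke k0 h3 h4; rewrite ltr_norml; apply/andP; split; lra.
Qed.

(** Boxes with rational data make the cover countable; the code of a box that is not
inner to Om stands for the empty box. *)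
Lemma inner_box_cover Om : open Om -> exists Q : nat -> V * V,
  (forall k, inner_box Om (Q k).1 (Q k).2 \/ box (Q k).1 (Q k).2 = set0) /\
  Om = \bigcup_k box (Q k).1 (Q k).2.
Proof.
move=> oOm; pose Q (k : nat) : V * V := if unpickle k is Some q then
  if pselect (inner_box Om (rat_lo q) (rat_hi q)) is left _ then (rat_lo q, rat_hi q)
  else (0, 0) else (0, 0).
have box00 : box (0 : V) 0 = set0.
  by apply/seteqP; split=> // x /(_ ord0); rewrite mxE => /andP[/lt_le_trans h /h]; rewrite ltxx.
have QP k : inner_box Om (Q k).1 (Q k).2 \/ box (Q k).1 (Q k).2 = set0.
  by rewrite /Q; case: unpickle => [q|]; [case: pselect => [h|_]; [left|right]|right].
exists Q; split=> //; apply/seteqP; split=> [x Ox|x [k _]].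
  have [q [gq xq]] := open_rat_inner_box oOm Ox; exists (pickle q) => //.
  by rewrite /Q pickleK; case: pselect.
by case: (QP k) => [/inner_box_sub|->//]; exact.
Qed.

Lemma open_measurable_rV (A : set V) : open A -> measurable A.
Proof.
move=> /inner_box_cover[Q [_ ->]]; apply: bigcupT_measurable => k.
exact: measurable_box.
Qed.

Lemma continuous_measurable_rV (f : V -> R) : continuous f ->
  measurable_fun setT f.
Proof.
move=> cf; apply: (measurability _ (RGenOpens.measurableE R)) => //.
move=> _ [_ [x [y ->]] <-]; rewrite setTI; apply: open_measurable_rV.
by move/continuousP : cf; apply; exact: interval_open.
Qed.

End inner_boxes.

(** * Integrals of bounded functions *)
Section bounded_measurable.
Context d (T : measurableType d) (R : realType).
Variable mu : {measure set T -> \bar R}.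
Implicit Types (D E : set T) (f g : T -> R).

(** Over sets of finite measure this class is closed under sums and products and
consists of integrable functions. *)
Definition bounded_meas D f :=
  measurable_fun D f /\ exists C, forall x, D x -> `|f x| <= C.

Lemma bounded_meas_integrable D f : measurable D -> (mu D < +oo)%E ->
  bounded_meas D f -> mu.-integrable D (EFin \o f).
Proof.
move=> mD Doo [mf [C fC]]; apply: measurable_bounded_integrable => //.
by exists C; split; [exact: num_real|move=> M CM x Dx; apply: le_trans (fC x Dx) (ltW CM)].
Qed.

Lemma bounded_measS D E f : measurable D -> E `<=` D ->
  bounded_meas D f -> bounded_meas E f.
Proof.
move=> mD ED [mf [C fC]]; split; first exact: measurable_funS mf.
by exists C => x /ED; exact: fC.
Qed.

Lemma bounded_meas_cst D (c : R) : bounded_meas D (cst c).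
Proof. by split=> //; exists `|c|. Qed.

Lemma bounded_measD D f g : bounded_meas D f -> bounded_meas D g ->
  bounded_meas D (fun x => f x + g x).
Proof.
move=> [mf [C fC]] [mg [C' gC]]; split; first exact: measurable_funD.
by exists (C + C') => x Dx; rewrite (le_trans (ler_normD _ _))// lerD ?fC ?gC.
Qed.

Lemma bounded_measM D f g : bounded_meas D f -> bounded_meas D g ->
  bounded_meas D (fun x => f x * g x).
Proof.
move=> [mf [C fC]] [mg [C' gC]]; split; first exact: measurable_funM.
by exists (C * C') => x Dx; rewrite normrM ler_pM ?fC ?gC.
Qed.

Lemma bounded_measN D f : bounded_meas D f -> bounded_meas D (fun x => - f x).
Proof.
move=> [mf [C fC]]; split; first exact: measurableT_comp.
by exists C => x Dx; rewrite normrN fC.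
Qed.

Lemma bounded_measB D f g : bounded_meas D f -> bounded_meas D g ->
  bounded_meas D (fun x => f x - g x).
Proof. by move=> hf /bounded_measN; exact: bounded_measD. Qed.

Lemma bounded_meas_indic D A : measurable A -> bounded_meas D (\1_A : T -> R).
Proof.
move=> mA; split; first exact: measurable_indic.
by exists 1 => x _; rewrite indicE ger0_norm// lern1 leq_b1.
Qed.

Lemma bounded_meas_sum D (I : Type) (s : seq I) (F : I -> T -> R) :
  (forall i, bounded_meas D (F i)) -> bounded_meas D (fun x => \sum_(i <- s) F i x).
Proof.
move=> h; elim: s => [|i s IH].
  by under eq_fun do rewrite big_nil; exact: bounded_meas_cst.
by under eq_fun do rewrite big_cons; exact: bounded_measD.
Qed.

Section domain.
Variable D : set T.
Hypotheses (mD : measurable D) (Doo : (mu D < +oo)%E).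

Lemma bounded_Rintegral f (C : R) : bounded_meas D f ->
  (forall x, D x -> `|f x| <= C) -> `|\int[mu]_(x in D) f x| <= C * fine (mu D).
Proof.
move=> bf fC; rewrite (le_trans (le_normr_Rintegral _ _))//.
  exact: bounded_meas_integrable.
rewrite -Rintegral_cst//; apply: le_Rintegral => //.
- apply: (@bounded_meas_integrable D (fun x => `|f x|)) => //; case: bf => mf [C' fC'].
  by split; [exact: measurableT_comp|exists C' => x /fC'; rewrite normr_id].
- by apply: bounded_meas_integrable => //; exact: bounded_meas_cst.
Qed.

Lemma bounded_RintegralD f g : bounded_meas D f -> bounded_meas D g ->
  \int[mu]_(x in D) (f x + g x) = \int[mu]_(x in D) f x + \int[mu]_(x in D) g x.
Proof. by move=> hf hg; rewrite RintegralD//; exact: bounded_meas_integrable. Qed.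

Lemma bounded_RintegralB f g : bounded_meas D f -> bounded_meas D g ->
  \int[mu]_(x in D) (f x - g x) = \int[mu]_(x in D) f x - \int[mu]_(x in D) g x.
Proof. by move=> hf hg; rewrite RintegralB//; exact: bounded_meas_integrable. Qed.

Lemma bounded_RintegralZ (c : R) f : bounded_meas D f ->
  \int[mu]_(x in D) (c * f x) = c * \int[mu]_(x in D) f x.
Proof. by move=> hf; rewrite RintegralZl//; exact: bounded_meas_integrable. Qed.

Lemma bounded_RintegralN f : bounded_meas D f ->
  \int[mu]_(x in D) (- f x) = - \int[mu]_(x in D) f x.
Proof.
move=> hf; rewrite -[RHS]mulN1r -bounded_RintegralZ//.
by apply: eq_Rintegral => x _; rewrite mulN1r.
Qed.

Lemma bounded_Rintegral_sum (I : Type) (s : seq I) (F : I -> T -> R) :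
  (forall i, bounded_meas D (F i)) ->
  \int[mu]_(x in D) (\sum_(i <- s) F i x) = \sum_(i <- s) \int[mu]_(x in D) F i x.
Proof.
move=> h; elim: s => [|i s IH].
  rewrite big_nil (@eq_Rintegral _ _ _ mu D (fun=> 0)).
    by rewrite Rintegral_cst// mul0r.
  by move=> x _; rewrite big_nil.
rewrite big_cons -IH -bounded_RintegralD//; last exact: bounded_meas_sum.
by apply: eq_Rintegral => x _; rewrite big_cons.
Qed.

Lemma Rintegral_indic_mul A f : 
  \int[mu]_(x in D) (f x * \1_A x) = \int[mu]_(x in D `&` A) f x.
Proof.
rewrite Rintegral_mkcondr; apply: eq_Rintegral => x _.
by rewrite patchE indicE; case: ifP => _; rewrite ?mulr1 ?mulr0.
Qed.

Lemma bounded_Rintegral_cvg (f_ : nat -> T -> R) f (C : R) :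
  (forall k, measurable_fun D (f_ k)) -> measurable_fun D f ->
  (forall k x, D x -> `|f_ k x| <= C) ->
  (forall x, D x -> f_ k x @[k --> \oo] --> f x) ->
  \int[mu]_(x in D) f_ k x @[k --> \oo] --> \int[mu]_(x in D) f x.
Proof.
move=> mf_ mf fC ff.
have fC' x : D x -> `|f x| <= C.
  move=> Dx; apply: (cvgr_to_le (cvg_norm (ff x Dx))); apply: filterE => k.
  exact: fC.
have bf : bounded_meas D f by split=> //; exists C.
have If := bounded_meas_integrable mD Doo bf.
apply: fine_cvg; rewrite fineK; last exact: integrable_fin_num.
apply: (@dominated_cvg _ _ _ mu D mD _ (EFin \o f) (EFin \o cst C)) => //.
- by move=> k; apply/measurable_EFinP.
- by move=> x Dx; apply: cvg_EFin; [exact: nearW|exact: ff].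
- by apply: bounded_meas_integrable => //; exact: bounded_meas_cst.
Qed.

End domain.
End bounded_measurable.

(** * Weak-star limits of bounded sequences *)
(** The excess g - L would have an integral that is both nonnegative and
nonpositive over the set where it is positive. *)
Lemma Rintegral_le_ae_le d (T : measurableType d) (R : realType)
    (mu : {measure set T -> \bar R}) (D : set T) (g : T -> R) (L : R) :
  measurable D -> (mu D < +oo)%E -> mu.-integrable D (EFin \o g) ->
  (forall A, measurable A -> A `<=` D -> \int[mu]_(x in A) g x <= L * fine (mu A)) ->
  mu (D `&` [set x | L < g x]) = 0%E.
Proof.
move=> mD Doo ig gA; set A := D `&` _.
have mg : measurable_fun D g by exact/measurable_EFinP/(measurable_int mu).
have mA : measurable A.
  rewrite /A (_ : [set x | _] = g @^-1` `]L, +oo[%classic).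
    exact: (mg mD _ (measurable_itv _)).
  by apply/seteqP; split=> x /=; rewrite in_itv/= andbT.
have AD : A `<=` D by exact: subIsetl.
have Aoo : (mu A < +oo)%E by apply: le_lt_trans Doo; apply: le_measure; rewrite ?inE.
have igA : mu.-integrable A (EFin \o g) by exact: integrableS ig.
have icA : mu.-integrable A (EFin \o cst L).
  by apply: bounded_meas_integrable => //; exact: bounded_meas_cst.
have ih : mu.-integrable A (EFin \o (fun x => g x - L)).
  by have := integrableB mA igA icA; apply: eq_integrable.
have h0 : \int[mu]_(x in A) (g x - L) = 0.
  apply/le_anti/andP; split.
    by rewrite RintegralB// Rintegral_cst// subr_le0 gA.
  by apply: Rintegral_ge0 => x [_ /= /ltW]; rewrite subr_ge0.
have mh : measurable_fun A (EFin \o (fun x => g x - L)) by exact: measurable_int ih.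
have : ae_eq mu A (EFin \o (fun x => g x - L)) (cst 0%E).
  apply/(ae_eq_integral_abs mu mA mh).
  rewrite (@eq_integral _ _ _ mu A (EFin \o (fun x => g x - L))).
    by rewrite -[LHS]fineK ?integrable_fin_num//; rewrite [X in X%:E]h0.
  move=> x /set_mem[_ /= /ltW Lg].
  by rewrite ger0_norm// subr_ge0.
move=> [N [mN N0 AN]]; apply: (subset_measure0 _ _ _ N0) => //.
move=> x [Dx Lg]; apply: AN => /= /(_ (conj Dx Lg)) [] h.
by move: Lg; rewrite /= -subr_gt0 h ltxx.
Qed.

Lemma sum_step_approx (R : realType) (t : R) (N : nat) : 0 <= t -> t <= N%:R + 1 ->
  `|t - \sum_(0 <= j < N) (j.+1%:R <= t)%R%:R| <= 1.
Proof.
move=> t0; have full M : M%:R <= t -> \sum_(0 <= j < M) (j.+1%:R <= t)%R%:R = M%:R :> R.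
  elim: M => [_|M IH Mt]; first by rewrite big_geq.
  rewrite big_nat_recr//= IH ?Mt ?natr1//.
  by apply: le_trans Mt; rewrite ler_nat.
elim: N => [|N IH] tN.
  by rewrite big_geq// subr0 ger0_norm//; move: tN; rewrite add0r.
have [Nt|tN1] := leP N.+1%:R t.
  by rewrite full// ler_norml; apply/andP; split; lra.
rewrite big_nat_recr//= [N.+1%:R <= t]leNgt tN1 addr0.
by apply: IH; rewrite natr1 ltW.
Qed.

Section weak_star.
Context d (T : measurableType d) (R : realType).
Variable mu : {sigma_finite_measure set T -> \bar R}.
Variables (D : set T) (mD : measurable D) (Doo : (mu D < +oo)%E).
Variables (U : set_system nat) (UU : UltraFilter U).
Variables (f : nat -> T -> R) (L : R).
Hypothesis mf : forall k, measurable_fun D (f k).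
Hypothesis fL : forall k x, D x -> `|f k x| <= L.
Hypothesis L0 : 0 <= L.

Let m A := fine (mu (D `&` A)).

Let DAoo A : measurable A -> (mu (D `&` A) < +oo)%E.
Proof.
by move=> mA; apply: le_lt_trans Doo; apply: le_measure; rewrite ?inE//; exact: measurableI.
Qed.

Let bf k A : measurable A -> bounded_meas (D `&` A) (f k).
Proof.
move=> mA; apply: (@bounded_measS _ _ _ D) => //.
by split; [exact: mf|exists L => x; exact: fL].
Qed.

Let fA k A : measurable A -> `|\int[mu]_(x in D `&` A) f k x| <= L * m A.
Proof.
move=> mA; apply: bounded_Rintegral; [exact: measurableI|exact: DAoo|exact: bf|].
by move=> x [Dx _]; exact: fL.
Qed.

Let nuR_ex A : exists l : R, measurable A ->
  (\int[mu]_(x in D `&` A) f k x) @[k --> U] --> l.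
Proof.
have [mA|nA] := pselect (measurable A); last by exists 0.
have [l _ fl] := ultra_bounded_cvg UU (fun k => fA k mA).
by exists l.
Qed.

Let nuR A : R := sval (cid (nuR_ex A)).

Let nuR_cvg A : measurable A -> (\int[mu]_(x in D `&` A) f k x) @[k --> U] --> nuR A.
Proof. exact: svalP (cid (nuR_ex A)). Qed.

Let nuR_bound A : measurable A -> `|nuR A| <= L * m A.
Proof.
move=> mA; apply: (cvgr_to_le (cvg_norm (nuR_cvg mA))); apply: filterE => k.
exact: fA.
Qed.

Let nuR_unique A l : measurable A -> (\int[mu]_(x in D `&` A) f k x) @[k --> U] --> l ->
  nuR A = l.
Proof. by move=> mA h; apply: (@norm_cvg_unique _ R^o) (nuR_cvg mA) h. Qed.

Let nuRU A B : measurable A -> measurable B -> [disjoint A & B] ->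
  nuR (A `|` B) = nuR A + nuR B.
Proof.
move=> mA mB AB; apply: nuR_unique; first exact: measurableU.
rewrite (_ : (fun k => _) = fun k => \int[mu]_(x in D `&` A) f k x + \int[mu]_(x in D `&` B) f k x).
  by apply: cvgD; exact: nuR_cvg.
apply/funext => k; rewrite setIUr Rintegral_setU//.
- exact: measurableI.
- exact: measurableI.
- rewrite -setIUr; apply: bounded_meas_integrable; [|apply: DAoo|apply: bf].
  + by apply: measurableI => //; exact: measurableU.
  + exact: measurableU.
  + exact: measurableU.
- apply/disj_setPS => x [[_ Ax] [_ Bx]].
  by move/disj_setPS : AB => /(_ x); apply.
Qed.

Let mU A B : measurable A -> measurable B -> [disjoint A & B] ->
  m (A `|` B) = m A + m B.
Proof.
move=> mA mB AB; rewrite /m setIUr measureU; first 1 last.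
- exact: measurableI.
- exact: measurableI.
- by rewrite setIACA; move/disj_set2P : AB => ->; rewrite setI0.
by rewrite fineD// ge0_fin_numE// DAoo.
Qed.

Let nu A : \bar R := (nuR A)%:E.

Let nu0 : nu set0 = 0%E.
Proof.
rewrite /nu (@nuR_unique _ 0)//.
by under eq_fun do rewrite setI0 Rintegral_set0; exact: cvg_cst.
Qed.

Let nu_fin A : measurable A -> nu A \is a fin_num. Proof. by []. Qed.

(** By finite additivity the defect of countable additivity is the value on a tail,
and there nuR is at most L times m. *)
Let m_sum (F : nat -> set T) n : (forall i, measurable (F i)) -> trivIset setT F ->
  m (\bigcup_i F i) - \sum_(0 <= i < n) m (F i) = m (\bigcup_(i >= n) F i) /\
  nuR (\bigcup_i F i) - \sum_(0 <= i < n) nuR (F i) = nuR (\bigcup_(i >= n) F i).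
Proof.
move=> mF tF; elim: n => [|n [IH1 IH2]].
  rewrite !big_geq// !subr0.
  suff -> : \bigcup_(i >= 0) F i = \bigcup_i F i by [].
  by apply: eq_bigcupl; split.
rewrite !big_nat_recr//= !opprD !addrA IH1 IH2.
have E : \bigcup_(i >= n) F i = F n `|` \bigcup_(i >= n.+1) F i.
  apply/seteqP; split=> x.
    move=> [i /=]; rewrite leq_eqVlt => /orP[/eqP <-|ni] Fx; first by left.
    by right; exists i.
  move=> [Fx|[i /= ni Fx]]; first by exists n => //=.
  by exists i => //=; exact: ltnW.
have mB : measurable (\bigcup_(i >= n.+1) F i) by exact: bigcup_measurable.
have dj : [disjoint F n & \bigcup_(i >= n.+1) F i].
  apply/disj_setPS => x [Fn [i /= ni Fi]].
  have : n = i by apply: tF => //; exists x.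
  by move=> e; rewrite e ltnn in ni.
by rewrite E mU// nuRU// ![_ + _ - _]addrAC !subrr !add0r.
Qed.

Let nu_sigma_additive : semi_sigma_additive nu.
Proof.
move=> F mF tF mUF.
rewrite (_ : (fun n => _) = EFin \o (fun n => \sum_(0 <= i < n) nuR (F i))); last first.
  by apply/funext => n; rewrite /= -sumEFin.
apply: cvg_EFin; first exact: nearW.
have mcvg : \sum_(0 <= i < n) m (F i) @[n --> \oo] --> m (\bigcup_i F i).
  have : (\sum_(0 <= i < n) mu (D `&` F i))%E @[n --> \oo] --> mu (D `&` \bigcup_i F i).
    rewrite setI_bigcupr; apply: measure_semi_sigma_additive.
    - by move=> i; exact: measurableI.
    - exact: trivIset_setIl.
    - by rewrite -setI_bigcupr; exact: measurableI.
  rewrite -(@fineK _ (mu (D `&` \bigcup_i F i))); last by rewrite ge0_fin_numE// DAoo.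
  move=> /fine_cvg; apply: cvg_trans.
  rewrite (_ : (fun n => _) = fine \o (fun n : nat => (\sum_(0 <= i < n) mu (D `&` F i))%E))//.
  apply/funext => n /=; rewrite -sum_fine// => i _.
  by rewrite ge0_fin_numE// DAoo.
apply/cvgrPdist_le => e e0.
have L1 : 0 < L + 1 by rewrite ltr_wpDl.
have /cvgrPdist_le/(_ (e / (L + 1))) := mcvg; rewrite divr_gt0// => /(_ isT).
apply: filterS => n; have [h1 h2] := m_sum n mF tF.
rewrite h1 h2 => mn.
have mB : measurable (\bigcup_(i >= n) F i) by exact: bigcup_measurable.
rewrite (le_trans (nuR_bound mB))//.
have mB0 : 0 <= m (\bigcup_(i >= n) F i) by rewrite /m fine_ge0.
rewrite ger0_norm// in mn; rewrite ler_pdivlMr// in mn.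
by apply: le_trans mn; rewrite mulrC ler_wpM2l// lerDl.
Qed.

Let nu_dominated (nu' : {charge set T -> \bar R}) : nu' = nu :> (set T -> _) -> nu' `<< mu.
Proof.
move=> nuE; apply/null_content_dominatesP => A mA A0; rewrite nuE /nu.
have : `|nuR A| <= 0.
  rewrite (le_trans (nuR_bound mA))// /m (_ : mu _ = 0)%E ?mulr0//.
  by apply: (subset_measure0 _ _ _ A0) => //; exact: measurableI.
by rewrite normr_le0 => /eqP ->.
Qed.

Let density : exists2 g : T -> R, mu.-integrable setT (EFin \o g) &
  forall A, measurable A -> nuR A = \int[mu]_(x in A) g x.
Proof.
pose H := isCharge.Build _ T R nu nu0 nu_fin nu_sigma_additive.
pose nu' : {charge set T -> \bar R} := HB.pack nu H.
have dom := @nu_dominated nu' erefl.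
have gfin x := Radon_Nikodym_fin_num x dom.
exists (fine \o Radon_Nikodym nu' mu).
  rewrite (_ : _ \o _ = Radon_Nikodym nu' mu); first exact: Radon_Nikodym_integrable.
  by apply/funext => x /=; rewrite fineK.
move=> A mA; have := Radon_Nikodym_integral dom mA; rewrite /= /nu => h.
rewrite /Rintegral -[LHS]/(fine (nuR A)%:E) h; congr fine.
by apply: eq_integral => x _ /=; rewrite fineK.
Qed.

(** Bounded sequences in L^oo(D) are weak-star relatively compact. The limits of
the integrals over subsets of D define a charge dominated by mu, whose
Radon-Nikodym derivative is the limit; simple functions then approximate phi
uniformly. *)
Lemma weak_star_limit : exists2 g : T -> R,
  measurable_fun setT g /\ forall x, `|g x| <= L &
  forall phi, bounded_meas D phi ->
    (\int[mu]_(x in D) (f k x * phi x)) @[k --> U] --> \int[mu]_(x in D) (g x * phi x).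
Proof.
have [g0 ig0 nug] := density.
have mg0 : measurable_fun setT g0 by exact/measurable_EFinP/(measurable_int mu).
pose g x := Num.max (- L) (Num.min L (g0 x)).
have gL x : `|g x| <= L.
  by rewrite ler_norml /g le_max lexx/= ge_max ge_min lexx andbT ge0_cp.
have mg : measurable_fun setT g.
  by apply: measurable_maxr => //; exact: measurable_minr.
exists g => //.
have igD A : measurable A -> mu.-integrable A (EFin \o g0).
  by move=> mA; exact: integrableS ig0.
have DA A : A `<=` D -> D `&` A = A by move=> AD; rewrite setIidr.
have up : mu (D `&` [set x | L < g0 x]) = 0%E.
  apply: Rintegral_le_ae_le => //; first exact: igD.
  move=> A mA AD; rewrite -nug// (le_trans (ler_norm _))//.
  by rewrite (le_trans (nuR_bound mA))// /m DA.
have dn : mu (D `&` [set x | L < - g0 x]) = 0%E.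
  apply: (@Rintegral_le_ae_le _ _ _ mu D (fun x => - g0 x)) => //.
    exact: integrableN (igD _ mD).
  move=> A mA AD; have -> : \int[mu]_(x in A) - g0 x = - nuR A.
    rewrite nug// -[RHS]mulN1r -RintegralZl//; last exact: igD.
    by apply: eq_Rintegral => x _; rewrite mulN1r.
  rewrite (le_trans (ler_norm _))// normrN.
  by rewrite (le_trans (nuR_bound mA))// /m DA.
have ggA A : measurable A -> \int[mu]_(x in D `&` A) g x = nuR A.
  move=> mA; have mDA : measurable (D `&` A) by exact: measurableI.
  have -> : nuR A = \int[mu]_(x in D `&` A) g0 x.
    rewrite -nug//; apply: nuR_unique => //.
    by rewrite -{1}[D]setIid -setIA; exact: nuR_cvg.
  rewrite /Rintegral; congr fine; apply: ae_eq_integral => //.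
  - by apply/measurable_EFinP; exact: measurable_funS mg.
  - by apply/measurable_EFinP; exact: measurable_funS mg0.
  pose N := (D `&` [set x | L < g0 x]) `|` (D `&` [set x | L < - g0 x]).
  have mL (h : T -> R) : measurable_fun setT h -> measurable (D `&` [set x | L < h x]).
    move=> mh; rewrite (_ : [set x | _] = h @^-1` `]L, +oo[%classic).
      by apply: measurableI => //; rewrite -[X in measurable X]setTI; exact: mh.
    by apply/seteqP; split=> x /=; rewrite in_itv/= andbT.
  exists N; split.
  - by apply: measurableU; apply: mL => //; exact: measurableT_comp.
  - by apply: null_set_setU => //; apply: mL => //; exact: measurableT_comp.
  - move=> x /= /not_implyP[[Dx _] gg]; rewrite /N.
    have [h1|h1] := ltP L (g0 x); first by left.
    have [h2|h2] := ltP L (- g0 x); first by right.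
    exfalso; apply: gg; congr EFin.
    rewrite /g (min_idPr h1); apply/max_idPr.
    by rewrite lerNl.
have Lf k : bounded_meas D (f k) by split; [exact: mf|exists L => x; exact: fL].
have bg : bounded_meas D g by split; [exact: measurable_funS mg|exists L => x _].
pose P phi := (\int[mu]_(x in D) (f k x * phi x)) @[k --> U] --> \int[mu]_(x in D) (g x * phi x).
have Pindic A : measurable A -> P (\1_A).
  move=> mA; rewrite /P Rintegral_indic_mul ggA//.
  by under eq_fun do rewrite Rintegral_indic_mul; exact: nuR_cvg.
have Psum (n : nat) (c : nat -> R) (A : nat -> set T) : (forall j, measurable (A j)) ->
    P (fun x => \sum_(0 <= j < n) c j * \1_(A j) x).
  move=> mA.
  have E h : bounded_meas D h ->
     \int[mu]_(x in D) (h x * (\sum_(0 <= j < n) c j * \1_(A j) x)) =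
     \sum_(0 <= j < n) c j * \int[mu]_(x in D) (h x * \1_(A j) x).
    move=> bh; have bhj j : bounded_meas D (fun x => h x * \1_(A j) x).
      by apply: bounded_measM => //; exact: bounded_meas_indic.
    under eq_bigr do rewrite -bounded_RintegralZ//.
    rewrite -bounded_Rintegral_sum//; last first.
      by move=> j; apply: bounded_measM => //; exact: bounded_meas_cst.
    apply: eq_Rintegral => x _; rewrite mulr_sumr; apply: eq_bigr => j _.
    by rewrite mulrCA.
  rewrite /P E//; under eq_fun do rewrite E//.
  elim: n {E} => [|n IH].
    by rewrite big_geq//; under eq_fun do rewrite big_geq//; exact: cvg_cst.
  rewrite big_nat_recr//= (_ : (fun k => _) = fun k =>
      \sum_(0 <= j < n) c j * \int[mu]_(x in D) (f k x * \1_(A j) x) +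
      c n * \int[mu]_(x in D) (f k x * \1_(A n) x)); last first.
    by apply/funext => k; rewrite big_nat_recr.
  by apply: cvgD => //; apply: cvgMl_tmp; exact: Pindic.
move=> phi bphi.
have [mphi [C phiC]] := bphi.
have approx eps : 0 < eps -> exists psi, [/\ P psi, bounded_meas D psi &
    forall x, D x -> `|phi x - psi x| <= eps].
  move=> eps0; pose C' := `|C| + 1.
  have C'0 : 0 < C' by rewrite ltr_wpDl.
  pose N := (Num.truncn (2 * C' / eps)).+1.
  have N0 : 0 < N%:R :> R by rewrite ltr0n.
  have NC : 2 * C' / N%:R <= eps.
    by rewrite ler_pdivrMr// (mulrC eps) -ler_pdivrMr// ltW// truncnS_gt.
  pose t x := N%:R * (phi x + C') / (2 * C').
  have t0N x : D x -> 0 <= t x <= N%:R.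
    move=> Dx; have := phiC x Dx; rewrite ler_norml => /andP[h1 h2].
    have h3 := ler_norm C.
    rewrite /t -mulrA; apply/andP; split.
      apply: mulr_ge0; rewrite ?ler0n//; apply: divr_ge0; last by rewrite mulr_ge0// ltW.
      by rewrite /C'; lra.
    rewrite ler_piMr// ler_pdivrMr ?mulr_gt0// mul1r /C'; lra.
  pose c (j : nat) : R := if j is _.+1 then 2 * C' / N%:R else - C'.
  pose A (j : nat) := if j is i.+1 then D `&` [set x | i.+1%:R <= t x] else D.
  have mt : measurable_fun D t.
    by apply: measurable_funM => //; apply: measurable_funM => //; exact: measurable_funD.
  have mA j : measurable (A j).
    case: j => //= i; rewrite (_ : [set x | _] = t @^-1` `[i.+1%:R, +oo[%classic).
      exact: (mt mD _ (measurable_itv _)).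
    by apply/seteqP; split=> x /=; rewrite in_itv/= andbT.
  exists (fun x => \sum_(0 <= j < N.+1) c j * \1_(A j) x); split; first exact: Psum.
    apply: bounded_meas_sum => j; apply: bounded_measM; first exact: bounded_meas_cst.
    exact: bounded_meas_indic.
  move=> x Dx; rewrite big_nat_recl//= indicE mem_set// mulr1.
  under eq_bigr => j _.
    rewrite indicE (_ : (x \in _) = (j.+1%:R <= t x)); last first.
      by apply/idP/idP => [/set_mem[]//|h]; apply/mem_set.
    over.
  rewrite -mulr_sumr.
  have /andP[t1 t2] := t0N x Dx.
  have tN : t x <= N%:R + 1 by rewrite (le_trans t2)// lerDl.
  have := sum_step_approx t1 tN; set S := \sum_(0 <= j < N) _ => hS.
  rewrite (_ : _ - _ = 2 * C' / N%:R * (t x - S)); last first.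
    by rewrite /t; field; rewrite !gt_eqF.
  rewrite normrM ger0_norm; last by rewrite divr_ge0// mulr_ge0// ltW.
  by apply: le_trans NC; rewrite ler_piMr// divr_ge0// mulr_ge0// ltW.
pose M := fine (mu D).
have M0 : 0 <= M by rewrite fine_ge0.
have LM1 : 0 < 3 * (L * M + 1) by rewrite mulr_gt0// ltr_wpDl// mulr_ge0.
apply/cvgrPdist_le => e e0.
have [|psi [Ppsi bpsi psie]] := approx (e / (3 * (L * M + 1))); first exact: divr_gt0.
set eps := e / _ in psie.
have close h : bounded_meas D h -> (forall x, D x -> `|h x| <= L) ->
    `|\int[mu]_(x in D) (h x * phi x) - \int[mu]_(x in D) (h x * psi x)| <= e / 3.
  move=> bh hL; rewrite -bounded_RintegralB//; [|exact: bounded_measM..].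
  apply: (@le_trans _ _ (L * eps * M)).
    apply: bounded_Rintegral => //.
      by apply: bounded_measB; exact: bounded_measM.
    by move=> x Dx; rewrite -mulrBr normrM ler_pM// ?hL ?psie.
  have LM : 0 < L * M + 1 by rewrite ltr_wpDl// mulr_ge0.
  rewrite (_ : L * eps * M = e / 3 * (L * M / (L * M + 1))); last first.
    by rewrite /eps; field; rewrite gt_eqF.
  by rewrite ler_piMr ?divr_ge0 ?(ltW e0)// ler_pdivrMr ?mul1r ?lerDl.
have /cvgrPdist_le/(_ (e / 3)) := Ppsi; rewrite divr_gt0// => /(_ isT).
apply: filterS => k hk.
have h1 := close g bg (fun x _ => gL x); have h2 := close (f k) (Lf k) (@fL k).
move: h1 h2 hk; rewrite !ler_norml => /andP[? ?] /andP[? ?] /andP[? ?].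
by apply/andP; split; lra.
Qed.

End weak_star.

(** * Lipschitz functions have bounded weak derivatives *)
Section lipschitz_sobolev.
Variables (R : realType) (n : nat).
Local Notation V := 'rV[R]_n.+1.
Local Notation mu := (lebesgue_rV R n.+1).
Implicit Types (Om : set V) (u g phi : V -> R).

Lemma bounded_Linfty Om g (C : R) : measurable Om -> measurable_fun Om g ->
  (forall x, Om x -> `|g x| <= C) -> Linfty Om g.
Proof.
move=> mOm mg gC; rewrite /Linfty/=; apply/andP; split.
  by rewrite inE/=; apply/(measurable_restrictT _ mOm).
rewrite inE/= /finite_norm unlock; case: ifPn => // _.
apply: (@le_lt_trans _ _ (Num.max C 0)%:E); last exact: ltry.
apply/ess_supP; apply/nearW => x /=; rewrite lee_fin patchE.
by case: ifPn => [/set_mem/gC|_]; rewrite ?normr0 le_max ?lexx ?orbT// => ->.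
Qed.

Lemma Rintegral_support (A B : set V) (f : V -> R) : A `<=` B ->
  (forall x, B x -> ~ A x -> f x = 0) ->
  \int[mu]_(x in A) f x = \int[mu]_(x in B) f x.
Proof.
move=> AB f0; rewrite Rintegral_mkcond [RHS]Rintegral_mkcond.
apply: eq_Rintegral => x _; rewrite !patchE.
case: ifPn => [/set_mem/AB Bx|/negP nA]; first by rewrite mem_set.
case: ifPn => // /set_mem Bx; rewrite f0// => Ax; apply: nA; exact: mem_set.
Qed.

Lemma Rintegral_translate (h : V) (f : V -> R) : measurable_fun setT f ->
  mu.-integrable setT (EFin \o (fun x => f (x + h))) ->
  \int[mu]_x f (x + h) = \int[mu]_x f x.
Proof.
move=> mf fi; have mf' : measurable_fun setT (EFin \o f) by exact/measurable_EFinP.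
have E := @integral_pushforward _ _ _ _ R (@translate R n.+1 h)
  (measurable_translate h) mu setT (EFin \o f) mf' fi measurableT.
rewrite /Rintegral; congr fine.
apply: etrans; first exact: esym E.
apply: eq_measure_integral; first exact: measurable_translate.
by move=> mh A mA _; exact: lebesgue_translate.
Qed.

Section test_functions.
Variables (Om : set V) (phi : V -> R) (i : 'I_n.+1).
Hypothesis tphi : test_function Om phi.
Let e := basis_vec R i.

Lemma test_function_continuous : continuous phi.
Proof. by case: tphi => /(_ 0%N)[]. Qed.

Lemma test_function_derivable x : derivable phi x e.
Proof. by case: tphi => /(_ 1%N)[_ /(_ i)[+ _]] _ _; exact. Qed.

Lemma test_function_derive_continuous : continuous ('D_e phi).
Proof. by case: tphi => /(_ 1%N)[_ /(_ i)[_ []]]. Qed.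

Lemma test_function_out x : ~ Om x -> phi x = 0.
Proof.
move=> Ox; apply: contrapT => /eqP px; apply: Ox; case: tphi => _ _; apply.
exact: subset_closure.
Qed.

Lemma test_function_derive_out x : ~ Om x -> 'D_e phi x = 0.
Proof.
move=> Ox; rewrite -(@derive_cst _ V R 0 x e).
apply: near_eq_derive => //.
have : (~` closure [set x | phi x != 0]) x.
  by move=> cx; apply: Ox; case: tphi => _ _; apply.
move=> nx; have : nbhs x (~` closure [set x | phi x != 0]).
  apply: open_nbhs_nbhs; split=> //; exact/closed_openC/closed_closure.
apply: filterS => z /= nz; apply: contrapT => /eqP pz; apply: nz.
exact: subset_closure.
Qed.

Lemma is_derive_line x (s : R) :
  is_derive s 1 (fun s : R => phi (x + s *: e)) ('D_e phi (x + s *: e)).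
Proof.
have E : (fun h : R => h^-1 *: (((fun s : R => phi (x + s *: e)) \o shift s) (h *: 1) - phi (x + s *: e)))
  = (fun h => h^-1 *: ((phi \o shift (x + s *: e)) (h *: e) - phi (x + s *: e))).
  apply/funext => h /=; congr (_ *: (phi _ - _)).
  by rewrite [h *: 1]mulr1 scalerDl addrCA.
apply: DeriveDef; rewrite /derivable /derive E//.
exact: test_function_derivable.
Qed.

(** The mean value theorem gives the domination needed to differentiate under the
integral. *)
Lemma test_function_quotient_bound (rho : R) : exists C : R, forall x (h : R),
  0 < h -> `|x| + h <= rho -> `|phi (x - h *: e) - phi x| <= C * h.
Proof.
have K := @compact_norm_ball R n rho.
have cD := test_function_derive_continuous.
have /compact_bounded[M [_ MK]] : compact ('D_e phi @` [set z : V | `|z| <= rho]).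
  apply: continuous_compact => //; exact: continuous_subspaceT.
exists (M + 1) => x h h0 xh.
have e1 : `|e| <= 1.
  by apply: mx_norm_le => // j; rewrite mxE; case: (_ && _); rewrite ?normr1 ?normr0.
have [|s _| |c ch E] := @MVT R (fun s => phi (x + s *: e)) (fun s => 'D_e phi (x + s *: e)) (- h) 0.
- by rewrite oppr_lt0.
- exact: is_derive_line.
- apply: derivable_within_continuous => s _.
  by have := is_derive_line x s; case.
rewrite scale0r addr0 sub0r opprK scaleNr in E.
rewrite distrC E normrM (gtr0_norm h0); apply: ler_wpM2r; first exact: ltW.
apply: (MK (M + 1)); first by rewrite ltrDl.
exists (x + c *: e) => //=; rewrite (le_trans (ler_normD _ _))// (le_trans _ xh)//.
rewrite lerD2l normrZ; move: ch; rewrite in_itv/= => /andP[c1 c2].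
rewrite ltr0_norm//; apply: (@le_trans _ _ (- c * 1)); last by rewrite mulr1 lerNl ltW.
by apply: ler_wpM2l => //; rewrite oppr_ge0 ltW.
Qed.

Lemma test_function_quotient_cvg x :
  (k.+1%:R * (phi (x - k.+1%:R^-1 *: e) - phi x)) @[k --> \oo] --> - 'D_e phi x.
Proof.
have dx : (h^-1 *: ((phi \o shift x) (h *: e) - phi x)) @[h --> 0^'] --> 'D_e phi x.
  exact: test_function_derivable.
have hk : (- (k.+1%:R^-1 : R)) @[k --> \oo] --> (0 : R)^'.
  have hk0 : (- (k.+1%:R^-1 : R)) @[k --> \oo] --> (0 : R).
    by rewrite -oppr0; apply: cvgN; exact: cvg_harmonic.
  move=> A /hk0 h.
  have h' : \forall k \near \oo, - (k.+1%:R^-1) != 0 :> R -> A (- (k.+1%:R^-1)) by exact: h.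
  suff : \forall k \near \oo, A (- (k.+1%:R^-1)) by [].
  by apply: filterS h' => k; apply; rewrite oppr_eq0 invr_eq0 pnatr_eq0.
have E k : k.+1%:R * (phi (x - k.+1%:R^-1 *: e) - phi x) =
    - ((- k.+1%:R^-1)^-1 *: ((phi \o shift x) ((- k.+1%:R^-1) *: e) - phi x)).
  by rewrite invrN invrK scaleNr opprK /= scaleNr (addrC _ x).
under eq_fun do rewrite E.
exact: cvgN (cvg_comp _ _ hk dx).
Qed.

End test_functions.

Lemma lipschitz_continuous u (L : R) : 0 <= L ->
  (forall x y, `|u x - u y| <= L * enorm (x - y)) -> continuous u.
Proof.
move=> L0 uL.
move=> x; apply/(@cvgrPdist_le _ _ _ (nbhs x)) => eps eps0.
have Ln : 0 < (L + 1) * n.+1%:R by rewrite mulr_gt0// ltr_wpDl.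
apply/nbhs_ballP; exists (eps / ((L + 1) * n.+1%:R)); first exact: divr_gt0.
move=> y; rewrite -ball_normE /= => xy; rewrite (le_trans (uL _ _))//.
rewrite ltr_pdivlMr// in xy; apply: le_trans (ltW xy).
rewrite (_ : `|x - y| * _ = (L + 1) * (n.+1%:R * `|x - y|)); last by ring.
apply: ler_pM => //; first exact: enorm_ge0.
  by rewrite lerDl.
exact: enorm_le_norm.
Qed.

(** The difference quotients of u are bounded by L, and a weak-star limit of them
is the weak derivative: translation invariance of the measure moves the difference
quotient from u to the test function, where it converges to the derivative. *)
Lemma lipschitz_W1oo Om u (L : R) : open Om -> bounded_set Om -> 0 <= L ->
  (forall x y, `|u x - u y| <= L * enorm (x - y)) -> W1oo Om u.
Proof.
move=> oOm bOm L0 uL.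
have mOm := open_measurable_rV oOm.
have Omoo : (mu Om < +oo)%E by exact: lebesgue_bounded_fin.
have cu := lipschitz_continuous L0 uL.
have mu_ : measurable_fun setT u by exact: continuous_measurable_rV.
have [M0 [_ OmM]] := bOm.
pose k0 := (Num.truncn (M0 + 1)).+1.
have Omk0 x : Om x -> `|x| < k0%:R.
  move=> Ox; apply: le_lt_trans (OmM (M0 + 1) _ x Ox) _; first by rewrite ltrDl.
  exact: truncnS_gt.
(* K contains the unit neighbourhood of Om, hence the translated supports. *)
pose K := @cube R n.+1 k0.+1.
have mK : measurable K by exact: measurable_box.
have Koo : (mu K < +oo)%E by exact: lebesgue_box_fin.
have OmK : Om `<=` K.
  move=> x /Omk0 xk; apply: norm_cube; apply: lt_trans xk _; by rewrite ltr_nat.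
have uB : exists C, forall x, K x -> `|u x| <= C.
  exists (`|u 0| + L * (n.+1%:R * k0.+1%:R)) => x Kx.
  have xk := cube_norm Kx.
  rewrite -[u x](subrK (u 0)) addrC (le_trans (ler_normD _ _))// lerD2l.
  rewrite (le_trans (uL _ _))// ler_wpM2l// subr0 (le_trans (enorm_le_norm _))//.
  by rewrite ler_wpM2l.
have [Cu uCu] := uB.
exists u; split; first exact: aeW.
  apply: (@bounded_Linfty Om u Cu) => //; first exact: measurable_funS mu_.
  by move=> x /OmK; exact: uCu.
move=> i; set e := basis_vec R i.
have e1 : enorm e = 1.
  rewrite /enorm /dotv (bigD1 i)//= big1; last first.
    by move=> j ji; rewrite !mxE (negbTE ji) andbF mul0r.
  by rewrite !mxE !eqxx mulr1 addr0 sqrtr1.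
pose f (k : nat) (x : V) := k.+1%:R * (u (x + k.+1%:R^-1 *: e) - u x).
have fL k x : `|f k x| <= L.
  rewrite normrM ger0_norm// -ler_pdivlMl// mulrC (le_trans (uL _ _))//.
  by rewrite addrAC subrr add0r enormZ e1 mulr1 ger0_norm// invr_ge0.
have mtr (h : V) : measurable_fun setT (fun x : V => u (x + h)).
  apply: (measurableT_comp mu_); exact: (measurable_translate h).
have mf k : measurable_fun setT (f k).
  apply: measurable_funM; first exact: measurable_cst.
  by apply: measurable_funB => //; exact: mtr.
have [U UU Uoo] := ultra_sequence_ex.
have [g [mg gL] gw] := @weak_star_limit _ _ R mu Om mOm Omoo U UU f L
  (fun k => measurable_funS measurableT (@subsetT _ Om) (mf k)) (fun k x _ => fL k x) L0.
exists g.
  by apply: (@bounded_Linfty Om g L) => //; exact: measurable_funS mg.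
move=> phi tphi; rewrite -/e.
have cphi := test_function_continuous tphi.
have mphi : measurable_fun setT phi by exact: continuous_measurable_rV.
have phi0 := test_function_out tphi.
have phiB : exists C, forall x, `|phi x| <= C.
  have := tphi => -[_ cK _].
  have /compact_bounded[C [_ HC]] : compact (phi @` closure [set x | phi x != 0]).
    by apply: continuous_compact => //; exact: continuous_subspaceT.
  exists (Num.max 0 (C + 1)) => x; have [->|px] := eqVneq (phi x) 0.
    by rewrite normr0 le_max lexx.
  rewrite le_max; apply/orP; right; apply: HC; first by rewrite ltrDl.
  by exists x => //; exact: subset_closure.
have [Cp phiCp] := phiB.
have bphi D : measurable D -> bounded_meas D phi.
  by move=> mD; split; [exact: measurable_funS mphi|exists Cp].
have bu : bounded_meas K u by split; [exact: measurable_funS mu_|exists Cu].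
have lim1 := gw phi (bphi _ mOm).
have parts k : \int[mu]_(x in Om) (f k x * phi x) =
    \int[mu]_(x in K) (u x * (k.+1%:R * (phi (x - k.+1%:R^-1 *: e) - phi x))).
  set h := k.+1%:R^-1 *: e.
  have h1 : `|h| <= 1.
    rewrite (le_trans (norm_le_enorm _))// enormZ e1 mulr1 ger0_norm ?invr_ge0//.
    by rewrite invf_le1// ler1n.
  have shiftK x : Om (x - h) -> K x.
    move=> /Omk0 xh; apply: norm_cube; rewrite -[x](subrK h).
    by rewrite (le_lt_trans (ler_normD _ _))// -natr1 ltr_leD.
  rewrite (@Rintegral_support Om K)//; last by move=> x _ /phi0 ->; rewrite mulr0.
  have bph : bounded_meas K (fun x : V => phi (x - h)).
    split; last by exists Cp.
    apply: measurable_funS (measurableT_comp mphi (@measurable_translate R n.+1 (- h))) => //.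
  have mph : measurable_fun setT (fun x : V => phi (x - h)).
    exact: (measurableT_comp mphi (@measurable_translate R n.+1 (- h))).
  have but : bounded_meas K (fun x : V => u (x + h)).
    split; first by apply: measurable_funS (mtr h).
    exists (Cu + L * 1) => x Kx; rewrite -[u (x + h)](subrK (u x)) addrC.
    rewrite (le_trans (ler_normD _ _))// lerD ?uCu// (le_trans (uL _ _))//.
    rewrite ler_wpM2l// addrAC subrr add0r enormZ e1 mulr1 ger0_norm ?invr_ge0//.
    by rewrite invf_le1// ler1n.
  have E : \int[mu]_(x in K) (u (x + h) * phi x) = \int[mu]_(x in K) (u x * phi (x - h)).
    rewrite (@Rintegral_support K setT)//; last first.
      by move=> x _ nK; rewrite phi0 ?mulr0// => /OmK.
    rewrite [RHS](@Rintegral_support K setT)//; last first.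
      by move=> x _ nK; rewrite phi0 ?mulr0// => /shiftK.
    rewrite -(@Rintegral_translate h (fun x => u x * phi (x - h))).
    - by apply: eq_Rintegral => x _; rewrite addrK.
    - exact: measurable_funM.
    - rewrite (_ : _ \o _ = (EFin \o (fun x => u (x + h) * phi x)) \_ K); last first.
        apply/funext => x /=; rewrite patchE addrK; case: ifPn => // /negP nK.
        by rewrite phi0 ?mulr0// => /OmK Kx; apply: nK; exact: mem_set.
      apply/(integrable_mkcond (EFin \o (fun x => u (x + h) * phi x)) mK).
      by apply: bounded_meas_integrable => //; apply: bounded_measM => //; exact: bphi.
  transitivity (k.+1%:R * (\int[mu]_(x in K) (u (x + h) * phi x) - \int[mu]_(x in K) (u x * phi x))).
    rewrite -bounded_RintegralB//; [|by apply: bounded_measM => //; exact: bphi..].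
    rewrite -bounded_RintegralZ//; last first.
      by apply: bounded_measB; apply: bounded_measM => //; exact: bphi.
    by apply: eq_Rintegral => x _; rewrite /f -/h; ring.
  rewrite E -bounded_RintegralB//; [|by apply: bounded_measM => //; exact: bphi..].
  rewrite -bounded_RintegralZ//; last first.
    by apply: bounded_measB; apply: bounded_measM => //; exact: bphi.
  by apply: eq_Rintegral => x _; ring.
have lim2 : (\int[mu]_(x in Om) (f k x * phi x)) @[k --> \oo] -->
    \int[mu]_(x in K) (u x * - 'D_e phi x).
  under eq_fun do rewrite parts.
  have [C HC] := test_function_quotient_bound i tphi (k0.+1%:R + 1).
  apply: (@bounded_Rintegral_cvg _ _ R mu K mK Koo _ _ (Cu * C)).
  - move=> k; apply: measurable_funS (_ : measurable_fun setT _) => //.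
    apply: measurable_funM => //; apply: measurable_funM; first exact: measurable_cst.
    apply: measurable_funB => //.
    exact: (measurableT_comp mphi (@measurable_translate R n.+1 (- _))).
  - apply: measurable_funS (_ : measurable_fun setT _) => //.
    apply: measurable_funM => //; apply: measurableT_comp => //.
    apply: continuous_measurable_rV; exact: test_function_derive_continuous tphi.
  - move=> k x Kx; rewrite normrM; apply: ler_pM => //; first exact: uCu.
    rewrite normrM ger0_norm// -ler_pdivlMl// mulrC.
    apply: HC; first by rewrite invr_gt0.
    rewrite lerD//; last by rewrite invf_le1// ler1n.
    exact: cube_norm.
  - by move=> x Kx; apply: cvgMl_tmp; exact: test_function_quotient_cvg tphi x.
have {}lim2 := cvg_trans (cvg_app _ Uoo) lim2.
have -> : \int[mu]_(x in Om) (g x * phi x) = \int[mu]_(x in K) (u x * - 'D_e phi x).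
  exact: (@norm_cvg_unique _ R^o) lim1 lim2.
rewrite (@Rintegral_support Om K)//; last first.
  by move=> x _ nO; rewrite (test_function_derive_out i tphi nO) mulr0.
have [C HC] : exists C, forall x, K x -> `|'D_e phi x| <= C.
  have cD := @test_function_derive_continuous Om phi i tphi.
  have cK := @compact_norm_ball R n k0.+1%:R.
  have /compact_bounded[M [_ MK]] : compact ('D_e phi @` [set z : V | `|z| <= k0.+1%:R]).
    apply: continuous_compact => //; exact: continuous_subspaceT.
  exists (M + 1) => x Kx; apply: MK; first by rewrite ltrDl.
  exists x => //=; exact: cube_norm.
rewrite -bounded_RintegralN//.
  by apply: eq_Rintegral => x _; rewrite mulrN opprK.
apply: bounded_measM => //; apply: bounded_measN; split; last by exists C.
apply: measurable_funS (_ : measurable_fun setT _) => //.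
apply: continuous_measurable_rV; exact: test_function_derive_continuous tphi.
Qed.

End lipschitz_sobolev.

(** * Smooth profiles on the line *)
Section smooth_functions.
Variable R : realType.
Implicit Types (f g : R -> R) (k m : nat).

(** Functions of class C^k on the line. *)
Fixpoint smooth1 (k : nat) f : Prop :=
  continuous f /\
  if k is k'.+1 then
    exists2 f', (forall x : R, is_derive x 1 f (f' x)) & smooth1 k' f'
  else True.

Lemma is_derive_continuous f f' : (forall x : R, is_derive x 1 f (f' x)) -> continuous f.
Proof. by move=> df x; apply/differentiable_continuous/derivable1_diffP; case: (df x). Qed.

Lemma smooth1S k f f' : (forall x : R, is_derive x 1 f (f' x)) -> smooth1 k f' ->
  smooth1 k.+1 f.
Proof. by move=> df sf'; split; [exact: is_derive_continuous df|exists f']. Qed.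

Lemma smooth1_pred k f : smooth1 k.+1 f -> smooth1 k f.
Proof.
elim: k f => [|k IH] f [cf [f' df sf']]; first by split.
by split=> //; exists f' => //; exact: IH.
Qed.

Lemma smooth1_continuous k f : smooth1 k f -> continuous f.
Proof. by case: k => [|k] []. Qed.

Lemma smooth1_cst k (c : R) : smooth1 k (fun=> c).
Proof.
elim: k c => [|k IH] c; first by split=> // x; exact: cvg_cst.
by apply: (@smooth1S _ _ (fun=> 0)) => // x; exact: is_derive_cst.
Qed.

Lemma smooth1_id k : smooth1 k id.
Proof.
case: k => [|k]; first by split=> // x; exact: cvg_id.
by apply: (@smooth1S _ _ (fun=> 1)) => //; exact: smooth1_cst.
Qed.

Lemma smooth1D k f g : smooth1 k f -> smooth1 k g -> smooth1 k (fun x => f x + g x).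
Proof.
elim: k f g => [|k IH] f g.
  by move=> [cf _] [cg _]; split=> // x; apply: cvgD; [exact: cf|exact: cg].
move=> [cf [f' df sf']] [cg [g' dg sg']].
by apply: (@smooth1S _ _ (fun x => f' x + g' x)); exact: IH.
Qed.

Lemma smooth1M k f g : smooth1 k f -> smooth1 k g -> smooth1 k (fun x => f x * g x).
Proof.
elim: k f g => [|k IH] f g.
  by move=> [cf _] [cg _]; split=> // x; apply: cvgM; [exact: cf|exact: cg].
move=> sf sg; have [cf [f' df sf']] := sf; have [cg [g' dg sg']] := sg.
apply: (@smooth1S _ _ (fun x => f x * g' x + g x * f' x)).
by apply: smooth1D; apply: IH => //; exact: smooth1_pred.
Qed.

Lemma smooth1_comp k f g : smooth1 k f -> smooth1 k g -> smooth1 k (fun x => f (g x)).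
Proof.
elim: k f g => [|k IH] f g.
  move=> [cf _] [cg _]; split=> // x.
  by apply: continuous_comp; [exact: cg|exact: cf].
move=> sf sg; have [cf [f' df sf']] := sf; have [cg [g' dg sg']] := sg.
apply: (@smooth1S _ _ (fun x => f' (g x) * g' x)).
by apply: smooth1M => //; apply: IH => //; exact: smooth1_pred.
Qed.

(** For m = 0 this is the flat function exp (- 1 / t); the powers of 1 / t close the
family under differentiation. *)
Definition flat m (t : R) : R := if 0 < t then t^-1 ^+ m * expR (- t^-1) else 0.

(** The exponential of 1 / t dominates the term of order m + 1 of its series. The
linear decay gives differentiability at 0. *)
Lemma flat_bound m (t : R) : `|flat m t| <= (m.+1)`!%:R * `|t|.
Proof.
rewrite /flat; case: ltP => t0; last by rewrite normr0 mulr_ge0.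
rewrite (gtr0_norm t0) ger0_norm ?mulr_ge0 ?expR_ge0 ?exprn_ge0 ?invr_ge0 ?(ltW t0)//.
rewrite expRN ler_pdivrMr ?expR_gt0// -mulrA.
have ti : 0 < t^-1 by rewrite invr_gt0.
have h := expR_ge1Dxn m (ltW ti).
have h2 : t^-1 ^+ m.+1 / (m.+1)`!%:R <= expR t^-1 by apply: le_trans h; rewrite lerDr.
apply: (@le_trans _ _ ((m.+1)`!%:R * (t * (t^-1 ^+ m.+1 / (m.+1)`!%:R)))); last first.
  by rewrite ler_pM2l ?ltr0n ?fact_gt0// ler_pM2l.
have F0 : (m.+1)`!%:R != 0 :> R by rewrite pnatr_eq0 -lt0n fact_gt0.
have tn : t != 0 by rewrite gt_eqF.
rewrite le_eqVlt exprS; apply/orP; left; apply/eqP.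
by rewrite [t * _]mulrA [t * _]mulrA mulfV// mul1r mulrCA mulfV// mulr1.
Qed.

Lemma is_derive_flat m (t : R) :
  is_derive t 1 (flat m) (flat m.+2 t - m%:R * flat m.+1 t).
Proof.
have [t0|t0|<-] := ltgtP 0 t.
- rewrite /flat t0.
  apply: (@near_eq_is_derive _ _ _ (fun t : R => t^-1 ^+ m * expR (- t^-1))).
    by near=> s; rewrite ifT//; near: s; exact: lt_nbhsr.
  have tn : t != 0 by rewrite gt_eqF.
  have d1 : is_derive t 1 (fun t : R => t^-1) (- t ^- 2).
    have := @is_deriveV R id t 1 1 tn (is_derive_id t 1); rewrite /= => h.
    by rewrite -[- t ^- 2]mulr1; exact: h.
  have d2 : is_derive t 1 (fun t : R => expR (- t^-1)) (expR (- t^-1) * t ^- 2).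
    have h := @is_derive1_comp R expR (fun t => - t^-1) t _ _ (is_derive_expR _)
       (is_deriveN d1).
    by rewrite opprK in h.
  have d3 := is_deriveX m d1; rewrite exprfctE in d3.
  apply: (is_derive_eq (is_deriveM d3 d2)).
  rewrite -[LHS]/(_ * _ + _ * (_ * _)) !exprVn; clear d3.
  case: m => [|m]; first by rewrite /= !expr0; field.
  by rewrite /= !exprS; field; rewrite expf_neq0.
- rewrite /flat !ltNge !(ltW t0)/= mulr0 subrr.
  apply: (@near_eq_is_derive _ _ _ (fun=> 0)).
  by near=> s; rewrite ifF//; apply/negbTE; rewrite -leNgt ltW//; near: s; exact: lt_nbhsl.
- rewrite {2 3}/flat ltxx mulr0 subr0.
  have H : (h^-1 *: ((flat m \o shift 0) (h *: 1) - flat m 0)) @[h --> (0 : R)^'] --> (0 : R).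
    apply: (@cvg_to_0_linear _ _ ((m.+2)`!%:R) 1) => // h /andP[h0 _].
    rewrite /= addr0 [h *: 1]mulr1 (_ : flat m 0 = 0) ?subr0; last by rewrite /flat ltxx.
    rewrite (_ : _ *: _ = flat m.+1 h); first exact: flat_bound.
    by rewrite /flat; case: ifP => _; rewrite ?scaler0// exprS -mulrA.
  by apply: DeriveDef; [exact: cvgP H|exact: cvg_lim H].
Unshelve. all: by end_near. Qed.

Lemma smooth1_flat k m : smooth1 k (flat m).
Proof.
elim: k m => [|k IH] m; first by split=> //; exact: is_derive_continuous (is_derive_flat m).
apply: (@smooth1S _ _ (fun t => flat m.+2 t - m%:R * flat m.+1 t)).
  exact: is_derive_flat.
have -> : (fun t => flat m.+2 t - m%:R * flat m.+1 t) =
    (fun t => flat m.+2 t + - m%:R * flat m.+1 t).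
  by apply/funext => t; rewrite mulNr.
by apply: smooth1D => //; apply: smooth1M => //; exact: smooth1_cst.
Qed.

Lemma flat0_ge0 (t : R) : 0 <= flat 0 t.
Proof. by rewrite /flat; case: ifP => // _; rewrite mul1r expR_ge0. Qed.

Lemma flat0_mono (s t : R) : s <= t -> flat 0 s <= flat 0 t.
Proof.
rewrite /flat; case: (ltP 0 s) => s0 st.
  rewrite (lt_le_trans s0 st) !mul1r ler_expR lerN2 lef_pV2// posrE//.
  exact: lt_le_trans st.
by case: ifP => // _; rewrite mul1r expR_ge0.
Qed.

Lemma flat0_le0 (t : R) : t <= 0 -> flat 0 t = 0.
Proof. by rewrite /flat ltNge => ->. Qed.

Lemma flat0_gt0 (t : R) : 0 < t -> 0 < flat 0 t.
Proof. by rewrite /flat => ->; rewrite mul1r expR_gt0. Qed.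

(** A smooth step from 0 at 0 to 1 at 1; nesting flat 0 leaves only a constant in the
denominator. *)
Definition step (t : R) : R := 1 - flat 0 (flat 0 1 - flat 0 t) / flat 0 (flat 0 1).

Lemma smooth1_step k : smooth1 k step.
Proof.
pose c := flat 0 (flat 0 1).
have -> : step = fun t => 1 + - c^-1 * flat 0 (flat 0 1 + - 1 * flat 0 t).
  by apply/funext => t; rewrite /step mulN1r mulNr mulrC.
apply: smooth1D; first exact: smooth1_cst.
apply: smooth1M; first exact: smooth1_cst.
apply: (@smooth1_comp _ (flat 0)); first exact: smooth1_flat.
apply: smooth1D; first exact: smooth1_cst.
by apply: smooth1M; [exact: smooth1_cst|exact: smooth1_flat].
Qed.

Lemma step_le0 (t : R) : t <= 0 -> step t = 0.
Proof.
move=> t0; rewrite /step (flat0_le0 t0) subr0 divff ?subrr// gt_eqF//.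
by do 2 apply: flat0_gt0.
Qed.

Lemma step_ge1 (t : R) : 1 <= t -> step t = 1.
Proof.
move=> t1; rewrite /step (@flat0_le0 (_ - _)) ?mul0r ?subr0//.
by rewrite subr_le0 flat0_mono.
Qed.

Lemma step_ge0 (t : R) : 0 <= step t.
Proof.
rewrite subr_ge0 ler_pdivrMr ?mul1r; last by do 2 apply: flat0_gt0.
by apply: flat0_mono; rewrite gerBl flat0_ge0.
Qed.

Lemma step_le1 (t : R) : step t <= 1.
Proof. by rewrite gerBl divr_ge0 ?flat0_ge0. Qed.

Lemma step_derivative : exists2 dstep : R -> R,
  (forall x : R, is_derive x 1 step (dstep x)) & continuous dstep.
Proof.
have [_ [f' df sf']] := smooth1_step 1.
by exists f' => //; case: sf'.
Qed.

End smooth_functions.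

Section profiles.
Variables (R : realType) (eta : R).
Hypothesis eta0 : 0 < eta.

Let kap (k : nat) : R := k.+1%:R / eta.

Let kap0 k : 0 < kap k. Proof. by rewrite divr_gt0. Qed.

(** Steps that rise on the interval from 0 to eta / (k + 1). *)
Definition stepn (k : nat) (t : R) : R := step (k.+1%:R / eta * t).

Lemma smooth1_stepn j k : smooth1 j (stepn k).
Proof.
apply: (@smooth1_comp _ _ (@step R)); first exact: smooth1_step.
by apply: smooth1M; [exact: smooth1_cst|exact: smooth1_id].
Qed.

Lemma stepn_le0 k t : t <= 0 -> stepn k t = 0.
Proof. by move=> t0; apply: step_le0; rewrite pmulr_rle0 ?divr_gt0. Qed.

Lemma stepn_ge k t : eta <= t -> stepn k t = 1.
Proof.
move=> te; apply: step_ge1; rewrite mulrAC ler_pdivlMr// mul1r.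
by rewrite (le_trans te)// ler_peMl ?(le_trans _ te) ?(ltW eta0)// ler1n.
Qed.

Lemma kap_large t : 0 < t -> \forall k \near \oo, 1 < kap k * t.
Proof.
move=> t0; exists (Num.truncn (eta / t)) => // k /= hk.
rewrite mulrAC ltr_pdivlMr// mul1r -ltr_pdivrMr//.
by apply: lt_le_trans (truncnS_gt _) _; rewrite ler_nat ltnS.
Qed.

Lemma stepn_cvg t : stepn k t @[k --> \oo] --> ((0 < t)%R%:R : R).
Proof.
have [t0|t0] := ltP 0 t; last first.
  by under eq_fun do rewrite (stepn_le0 _ t0); exact: cvg_cst.
apply: cvg_near_cst; apply: filterS (kap_large t0) => k hk.
by apply: step_ge1; exact: ltW.
Qed.

(** A smooth version of the positive part of t, equal to it outside the interval
from 0 to eta. *)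
Definition ramp (k : nat) (t : R) : R := t * stepn k t.

Lemma smooth1_ramp j k : smooth1 j (ramp k).
Proof. by apply: smooth1M; [exact: smooth1_id|exact: smooth1_stepn]. Qed.

Lemma ramp_le0 k t : t <= 0 -> ramp k t = 0.
Proof. by move=> t0; rewrite /ramp stepn_le0// mulr0. Qed.

Lemma ramp_ge k t : eta <= t -> ramp k t = t.
Proof. by move=> te; rewrite /ramp stepn_ge// mulr1. Qed.

Lemma ramp_bound k t : `|ramp k t| <= `|t|.
Proof. by rewrite normrM ler_piMr// ger0_norm ?step_le1// step_ge0. Qed.

Lemma ramp_cvg t : ramp k t @[k --> \oo] --> Num.max 0 t.
Proof.
have -> : Num.max 0 t = t * (0 < t)%R%:R.
  by case: ltP => t0; [rewrite mulr1|rewrite mulr0].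
by apply: cvgMl_tmp; exact: stepn_cvg.
Qed.

(** The derivative is stepn k t plus s * step'(s) at s = (k + 1) t / eta. The second
term is bounded because the derivative of step vanishes outside [0, 1], and it
tends to 0 pointwise because s leaves that interval unless t = 0. *)
Lemma ramp_derivative : exists (dr : nat -> R -> R) (C : R), [/\
  forall k (x : R), is_derive x 1 (ramp k) (dr k x),
  forall k, continuous (dr k),
  forall k t, `|dr k t| <= C &
  forall t, dr k t @[k --> \oo] --> ((0 < t)%R%:R : R)].
Proof.
have [ds dstep cds] := step_derivative R.
have ds0 (s : R) : s < 0 -> ds s = 0.
  move=> s0; have [_ <-] := dstep s.
  rewrite -(@derive_cst R R^o R^o 0 s 1); apply: near_eq_derive.
  by near=> x; apply: step_le0; apply: ltW; near: x; exact: lt_nbhsl.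
have ds1 (s : R) : 1 < s -> ds s = 0.
  move=> s1; have [_ <-] := dstep s.
  rewrite -(@derive_cst R R^o R^o 1 s 1); apply: near_eq_derive.
  by near=> x; apply: step_ge1; apply: ltW; near: x; exact: lt_nbhsr.
have [C C0 sC] : exists2 C, 0 <= C & forall s, `|s * ds s| <= C.
  have /compact_bounded[M [_ HM]] : compact (ds @` `[0, 1]%classic).
    by apply: continuous_compact; [exact: continuous_subspaceT|exact: segment_compact].
  exists (Num.max 0 (M + 1)) => [|s]; first by rewrite le_max lexx.
  have [s0|s0] := ltP s 0; first by rewrite ds0// mulr0 normr0 le_max lexx.
  have [s1|s1] := ltP 1 s; first by rewrite ds1// mulr0 normr0 le_max lexx.
  rewrite normrM (ger0_norm s0) le_max; apply/orP; right.
  apply: (@le_trans _ _ (1 * `|ds s|)); first by rewrite ler_wpM2r.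
  rewrite mul1r; apply: HM; first by rewrite ltrDl.
  by exists s => //=; rewrite in_itv/= s0.
pose dr k t := stepn k t + kap k * t * ds (kap k * t).
exists dr, (1 + C); split.
- move=> k x.
  have d1 : is_derive x 1 (fun t : R => kap k * t) (kap k).
    have h := is_deriveM (is_derive_cst (kap k : R^o) x 1) (is_derive_id (x : R^o) 1).
    apply: (is_derive_eq h).
    by rewrite -[LHS]/(_ * _ + _ * _) mulr1 mulr0 addr0.
  have d2 : is_derive x 1 (stepn k) (ds (kap k * x) * kap k).
    exact: (@is_derive1_comp R (@step R) (fun t => kap k * t)).
  have h := is_deriveM (is_derive_id (x : R^o) 1) d2.
  apply: (is_derive_eq h).
  by rewrite -[LHS]/(_ * _ + _ * _) /dr; ring.
- move=> k x; apply: cvgD; first exact: (smooth1_continuous (smooth1_stepn 0 k)).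
  apply: cvgM; first by apply: cvgMl_tmp; exact: cvg_id.
  by apply: continuous_comp; [apply: cvgMl_tmp; exact: cvg_id|exact: cds].
- move=> k t; rewrite (le_trans (ler_normD _ _))// lerD//.
  by rewrite ger0_norm ?step_le1 ?step_ge0.
- move=> t; rewrite -[X in _ --> X]addr0; apply: cvgD; first exact: stepn_cvg.
  have [t0|t0|<-] := ltgtP 0 t; last 1 first.
  + by under eq_fun do rewrite mulr0 mul0r; exact: cvg_cst.
  + apply: cvg_near_cst; apply: filterS (kap_large t0) => k hk.
    by rewrite ds1// mulr0.
  + apply: cvg_near_cst; apply: nearW => k.
    by rewrite ds0 ?mulr0// pmulr_rlt0.
Unshelve. all: by end_near. Qed.

(** A smooth version of the indicator of ]c, d]. *)
Definition plateau (c d : R) (k : nat) (s : R) : R := stepn k (s - c) * (1 - stepn k (s - d)).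

Lemma smooth1_shift j f (c : R) : smooth1 j f -> smooth1 j (fun s => f (s - c)).
Proof.
move=> sf; apply: (@smooth1_comp _ _ f) => //.
by apply: smooth1D; [exact: smooth1_id|exact: smooth1_cst].
Qed.

Lemma smooth1_plateau j c d k : smooth1 j (plateau c d k).
Proof.
apply: smooth1M; first by apply: smooth1_shift; exact: smooth1_stepn.
rewrite (_ : (fun x => _) = fun s => 1 + -1 * stepn k (s - d)); last first.
  by apply/funext => s; rewrite mulN1r.
apply: smooth1D; first exact: smooth1_cst.
apply: smooth1M; first exact: smooth1_cst.
by apply: smooth1_shift; exact: smooth1_stepn.
Qed.

Lemma plateau_itv c d k s : 0 <= plateau c d k s <= 1.
Proof.
rewrite mulr_ge0 ?step_ge0 ?subr_ge0 ?step_le1//=.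
by rewrite mulr_ile1 ?step_ge0 ?step_le1 ?subr_ge0 ?step_le1// lerBlDr lerDl step_ge0.
Qed.

Lemma plateau_neq0 c d k s : plateau c d k s != 0 -> c <= s <= d + eta.
Proof.
move=> h; apply/andP; split; rewrite leNgt; apply: contra h => h; apply/eqP.
  by rewrite /plateau stepn_le0 ?mul0r// subr_le0 ltW.
by rewrite /plateau (@stepn_ge _ (s - d)) ?subrr ?mulr0// lerBrDl ltW.
Qed.

Lemma plateau_cvg c d s : plateau c d k s @[k --> \oo] --> ((c < s <= d)%R%:R : R).
Proof.
have -> : (c < s <= d)%R%:R = (0 < s - c)%R%:R * (1 - (0 < s - d)%R%:R) :> R.
  rewrite !subr_gt0 (ltNge d s).
  by case: (c < s); case: (s <= d); rewrite /= ?subr0 ?subrr ?mulr1 ?mulr0 ?mul0r.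
by apply: cvgM; [exact: stepn_cvg|apply: cvgB; [exact: cvg_cst|exact: stepn_cvg]].
Qed.

End profiles.

(** * Products of profiles as test functions *)
Section product_test_functions.
Variables (R : realType) (n : nat).
Local Notation V := 'rV[R]_n.+1.

Lemma CkS k (f : V -> R) : continuous f ->
  (forall i, exists2 g, (forall x, is_derive x (basis_vec R i) f (g x)) & Ck k g) ->
  Ck k.+1 f.
Proof.
move=> cf df; split=> // i; have [g fg Cg] := df i; split.
  by move=> x; case: (fg x).
rewrite (_ : derive f ^~ _ = g)//.
by apply/funext => x; case: (fg x).
Qed.

Lemma Ck_inv k (f : V -> R) : Ck k.+1 f ->
  forall i, exists2 g, (forall x, is_derive x (basis_vec R i) f (g x)) & Ck k g.
Proof.
move=> [cf df] i; have [d1 d2] := df i; exists ('D_(basis_vec R i) f) => //.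
Qed.

Lemma Ck_continuous k (f : V -> R) : Ck k f -> continuous f.
Proof. by case: k => [|k] []. Qed.

Lemma Ck_pred k (f : V -> R) : Ck k.+1 f -> Ck k f.
Proof.
elim: k f => [|k IH] f [cf df]; first by split.
by split=> // i; have [d1 d2] := df i; split=> //; exact: IH.
Qed.

Lemma Ck_cst k (c : R) : Ck k (fun _ : V => c).
Proof.
elim: k c => [|k IH] c; first by split=> //; exact: cst_continuous.
apply: CkS => [|i]; first exact: cst_continuous.
by exists (fun=> 0) => // x; exact: is_derive_cst.
Qed.

Lemma CkD k (f g : V -> R) : Ck k f -> Ck k g -> Ck k (fun x => f x + g x).
Proof.
elim: k f g => [|k IH] f g.
  by move=> [cf _] [cg _]; split=> // x; apply: continuousD; [exact: cf|exact: cg].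
move=> Cf Cg; apply: CkS => [x|i].
  by apply: continuousD; [exact: (Ck_continuous Cf)|exact: (Ck_continuous Cg)].
have [f' df Cf'] := Ck_inv Cf i; have [g' dg Cg'] := Ck_inv Cg i.
by exists (fun x => f' x + g' x); [move=> x; exact: is_deriveD|exact: IH].
Qed.

Lemma CkM k (f g : V -> R) : Ck k f -> Ck k g -> Ck k (fun x => f x * g x).
Proof.
elim: k f g => [|k IH] f g.
  by move=> [cf _] [cg _]; split=> // x; apply: continuousM; [exact: cf|exact: cg].
move=> Cf Cg; apply: CkS => [x|i].
  by apply: continuousM; [exact: (Ck_continuous Cf)|exact: (Ck_continuous Cg)].
have [f' df Cf'] := Ck_inv Cf i; have [g' dg Cg'] := Ck_inv Cg i.
exists (fun x => f x * g' x + g x * f' x); first by move=> x; exact: is_deriveM.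
by apply: CkD; apply: IH => //; exact: Ck_pred.
Qed.

Lemma is_derive_coord_line (f : V -> R) (F : R -> R) (x : V) i (D : R) :
  (forall h, f (h *: basis_vec R i + x) = F (h + x ord0 i)) ->
  is_derive (x ord0 i) 1 F D -> is_derive x (basis_vec R i) f D.
Proof.
move=> fF dF.
have E : (fun h : R => h^-1 *: ((f \o shift x) (h *: basis_vec R i) - f x)) =
    (fun h : R => h^-1 *: ((F \o shift (x ord0 i)) (h *: 1) - F (x ord0 i))).
  apply/funext => h /=; rewrite fF [h *: 1]mulr1.
  by have := fF 0; rewrite scale0r !add0r => ->.
by case: dF => dF <-; apply: DeriveDef; rewrite /derivable /derive E.
Qed.

Lemma Ck_coord k (chi : R -> R) j : smooth1 k chi -> Ck k (fun y : V => chi (y ord0 j)).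
Proof.
elim: k chi => [|k IH] chi sc.
  split=> // y; apply: (@continuous_comp _ _ _ (fun y : V => y ord0 j) chi).
    exact: coord_continuous.
  exact: (smooth1_continuous sc).
have [cc [chi' dchi schi']] := sc; apply: CkS => [y|i].
  apply: (@continuous_comp _ _ _ (fun y : V => y ord0 j) chi).
    exact: coord_continuous.
  exact: cc.
have [<-|ij] := eqVneq j i.
  exists (fun y : V => chi' (y ord0 j)); last exact: IH.
  move=> y; apply: is_derive_coord_line (dchi _) => h.
  by rewrite !mxE !eqxx mulr1.
exists (fun=> 0); last exact: Ck_cst.
move=> y; apply: (@is_derive_coord_line _ (fun=> chi (y ord0 j))).
  by move=> h; rewrite !mxE (negbTE ij) andbF mulr0 add0r.
Qed.

Lemma Ck_prod k (chi : 'I_n.+1 -> R -> R) (s : seq 'I_n.+1) (P : pred 'I_n.+1) :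
  (forall j, smooth1 k (chi j)) ->
  Ck k (fun y : V => \prod_(j <- s | P j) chi j (y ord0 j)).
Proof.
move=> sc; elim: s => [|j s IH].
  by under eq_fun do rewrite big_nil; exact: Ck_cst.
under eq_fun do rewrite big_cons.
by case: (P j) => //; apply: CkM => //; exact: Ck_coord.
Qed.

Lemma is_derive_prod (chi : 'I_n.+1 -> R -> R) i (D : R) (y : V) :
  is_derive (y ord0 i) 1 (chi i) D ->
  is_derive y (basis_vec R i) (fun y : V => \prod_j chi j (y ord0 j))
    (D * \prod_(j | j != i) chi j (y ord0 j)).
Proof.
move=> dD; set Psi := \prod_(j | _) _.
apply: (@is_derive_coord_line _ (fun t => chi i t * Psi)).
  move=> h; rewrite (bigD1 i)//= !mxE !eqxx mulr1; congr (_ * _).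
  by apply: eq_bigr => j ji; rewrite !mxE (negbTE ji) andbF mulr0 add0r.
have h := is_deriveM dD (is_derive_cst (Psi : R^o) (y ord0 i : R^o) 1).
apply: (is_derive_eq h).
by rewrite -[LHS]/(_ * _ + _ * _) mulr0 add0r mulrC.
Qed.

Lemma cbox_compact (a b : V) : compact (cbox a b).
Proof.
have := @rV_compact R n.+1 (fun i => `[a ord0 i, b ord0 i]%classic)
  (fun i => @segment_compact R _ _).
by congr compact.
Qed.

Lemma product_test_function Om (chi : 'I_n.+1 -> R -> R) (a b : V) :
  (forall k j, smooth1 k (chi j)) ->
  (forall j s, chi j s != 0 -> a ord0 j <= s <= b ord0 j) -> cbox a b `<=` Om ->
  test_function Om (fun y : V => \prod_j chi j (y ord0 j)).
Proof.
move=> sc supp abOm.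
have sub : closure [set x : V | \prod_j chi j (x ord0 j) != 0] `<=` cbox a b.
  have cl : closed (cbox a b).
    by apply: compact_closed; [exact: norm_hausdorff|exact: cbox_compact].
  rewrite (closure_id (cbox a b)).1//; apply: closureS => x /= px i.
  by apply: supp; apply: contra px => /eqP p0; rewrite (bigD1 i)//= p0 mul0r.
split.
- by move=> k; exact: Ck_prod.
- by apply: (subclosed_compact _ (@cbox_compact a b)) => //; exact: closed_closure.
- exact: subset_trans sub abOm.
Qed.

End product_test_functions.

(** * A profile that compares two intervals *)
Section transition.
Variables (R : realType) (eta c d c' d' : R).
Hypotheses (eta0 : 0 < eta) (cc' : c <= c') (cd' : c' < d') (dd' : d' <= d).

(** The derivative converges to the difference of the normalized indicators of
]c, d] and ]c', d']. This difference has integral 0, which is why the profile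
vanishes to the right of d + eta and can enter a test function. *)
Definition transition (k : nat) (s : R) : R :=
  (d - c)^-1 * (ramp eta k (s - c) + -1 * ramp eta k (s - d)) +
  - (d' - c')^-1 * (ramp eta k (s - c') + -1 * ramp eta k (s - d')).

Let l0 : 0 < d - c. Proof. by rewrite subr_gt0 (le_lt_trans cc') ?(lt_le_trans cd'). Qed.
Let l0' : 0 < d' - c'. Proof. by rewrite subr_gt0. Qed.

Lemma smooth1_transition j k : smooth1 j (transition k).
Proof.
have sr a : smooth1 j (fun s => ramp eta k (s - a)).
  by apply: smooth1_shift; exact: smooth1_ramp.
by apply: smooth1D; (apply: smooth1M; first exact: smooth1_cst);
  apply: smooth1D => //; apply: smooth1M => //; exact: smooth1_cst.
Qed.

Lemma transition_neq0 k s : transition k s != 0 -> c <= s <= d + eta.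
Proof.
have [e0 [h1c [h2c h3c]]] := conj eta0 (conj cc' (conj cd' dd')).
move=> h; apply/andP; split; rewrite leNgt; apply: contra h => h; apply/eqP.
  by rewrite /transition !ramp_le0 //; [rewrite !(mulr0, addr0)|lra..].
by rewrite /transition !ramp_ge //; [field; rewrite !gt_eqF|lra..].
Qed.

Lemma transition_bounded : exists C : R, forall k s, `|transition k s| <= C.
Proof.
have [e0 [h1c [h2c h3c]]] := conj eta0 (conj cc' (conj cd' dd')).
pose La := d - c + eta.
have La0 : 0 <= La by rewrite addr_ge0// ltW.
exists ((d - c)^-1 * (La + La) + (d' - c')^-1 * (La + La)) => k s.
have C0 : 0 <= (d - c)^-1 * (La + La) + (d' - c')^-1 * (La + La).
  by rewrite addr_ge0// mulr_ge0 ?invr_ge0 ?(ltW l0) ?(ltW l0')// addr_ge0.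
have [->|/transition_neq0/andP[s1 s2]] := eqVneq (transition k s) 0.
  by rewrite normr0.
have rb t : `|t| <= La -> `|ramp eta k t| <= La.
  by apply: le_trans; exact: ramp_bound.
have h a : c <= a <= d -> `|ramp eta k (s - a)| <= La.
  by move=> /andP[a1 a2]; apply: rb; rewrite ler_norml /La; apply/andP; split; lra.
have h2 a b : c <= a <= d -> c <= b <= d ->
    `|ramp eta k (s - a) + -1 * ramp eta k (s - b)| <= La + La.
  move=> ha hb; rewrite (le_trans (ler_normD _ _))// mulN1r normrN.
  by apply: lerD; apply: h.
have h3 l a b : 0 < l -> c <= a <= d -> c <= b <= d ->
    `|l^-1 * (ramp eta k (s - a) + -1 * ramp eta k (s - b))| <= l^-1 * (La + La).
  move=> l1 ha hb; rewrite normrM gtr0_norm ?invr_gt0//.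
  by apply: ler_wpM2l; [rewrite invr_ge0 ltW|exact: h2].
rewrite (le_trans (ler_normD _ _))//; apply: lerD; last rewrite -normrN -mulNr opprK.
  by apply: h3 => //; apply/andP; split; lra.
by apply: h3 => //; apply/andP; split; lra.
Qed.

Definition transition_lim (s : R) : R :=
  (d - c)^-1 * (Num.max 0 (s - c) + -1 * Num.max 0 (s - d)) +
  - (d' - c')^-1 * (Num.max 0 (s - c') + -1 * Num.max 0 (s - d')).

Lemma transition_cvg s : transition k s @[k --> \oo] --> transition_lim s.
Proof.
have r a : ramp eta k (s - a) @[k --> \oo] --> Num.max 0 (s - a) by exact: ramp_cvg.
by apply: cvgD; apply: cvgMl_tmp; apply: cvgD => //; apply: cvgMl_tmp.
Qed.

(** Both normalized ramps rise from 0 to 1 within ]c, d]. *)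
Lemma transition_lim_bound s : `|transition_lim s| <= (c < s <= d)%R%:R.
Proof.
have [e0 [h1c [h2c h3c]]] := conj eta0 (conj cc' (conj cd' dd')).
rewrite /transition_lim.
have [sc|cs] := leP s c.
  by rewrite !(max_idPl _); [rewrite !(mulr0, addr0) normr0|lra..].
have [sd|ds] := leP s d; last first.
  rewrite !(max_idPr _); [|lra..].
  by rewrite [X in `|X|](_ : _ = 0) ?normr0//; field; rewrite !gt_eqF.
rewrite /=.
have A : 0 <= (d - c)^-1 * (Num.max 0 (s - c) + -1 * Num.max 0 (s - d)) <= 1.
  rewrite (max_idPr _) ?subr_ge0 ?(ltW cs)// (max_idPl _) ?subr_le0// mulr0 addr0.
  rewrite mulr_ge0 ?invr_ge0 ?(ltW l0) ?subr_ge0 ?(ltW cs)//=.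
  by rewrite ler_pdivrMl// mulr1 lerD2r.
have B : 0 <= (d' - c')^-1 * (Num.max 0 (s - c') + -1 * Num.max 0 (s - d')) <= 1.
  rewrite ler_pdivrMl// mulr1 pmulr_rge0 ?invr_gt0// mulN1r.
  by case: (leP 0 (s - c')) => h1; case: (leP 0 (s - d')) => h2; apply/andP; split; lra.
rewrite ler_norml mulNr; move: A B => /andP[? ?] /andP[? ?].
by apply/andP; split; lra.
Qed.

Lemma transition_derivative : exists (dt : nat -> R -> R) (C : R), [/\
  forall k (x : R), is_derive x 1 (transition k) (dt k x),
  forall k, continuous (dt k),
  forall k t, `|dt k t| <= C &
  forall s, dt k s @[k --> \oo] -->
    ((d - c)^-1 * (c < s <= d)%R%:R - (d' - c')^-1 * (c' < s <= d')%R%:R : R)].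
Proof.
have [e0 [h1c [h2c h3c]]] := conj eta0 (conj cc' (conj cd' dd')).
have [dr [C [drd drc drC drl]]] := ramp_derivative eta0.
have C0 : 0 <= C by rewrite (le_trans _ (drC 0%N 0)).
pose dt k s := (d - c)^-1 * (dr k (s - c) + -1 * dr k (s - d)) +
  - (d' - c')^-1 * (dr k (s - c') + -1 * dr k (s - d')).
exists dt, ((d - c)^-1 * (C + C) + (d' - c')^-1 * (C + C)); split.
- move=> k x.
  have ds a : is_derive x 1 (fun s : R => s - a) 1.
    have h := is_deriveB (is_derive_id (x : R^o) 1) (is_derive_cst (a : R^o) x 1).
    by apply: (is_derive_eq h); rewrite subr0.
  have d1 a : is_derive x 1 (fun s : R => ramp eta k (s - a)) (dr k (x - a)).
    have h := @is_derive1_comp R (ramp eta k) (fun s => s - a) x _ _ (drd k (x - a)) (ds a).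
    by rewrite mulr1 in h.
  have dZ (e : R) (f : R -> R) (D : R) : is_derive x 1 f D -> is_derive x 1 (fun s => e * f s) (e * D).
    move=> df; have h := is_deriveM (is_derive_cst (e : R^o) x 1) df.
    apply: (is_derive_eq h).
    by rewrite -[LHS]/(_ * _ + _ * _) mulr0 addr0.
  have dD (f f' : R -> R) (D D' : R) : is_derive x 1 f D -> is_derive x 1 f' D' ->
      is_derive x 1 (fun s => f s + f' s) (D + D').
    by move=> h1 h2; exact: is_deriveD.
  by apply: dD; apply: dZ; apply: dD => //; exact: dZ.
- move=> k x.
  have cs a : {for x, continuous (fun s => dr k (s - a))}.
    apply: continuous_comp; last exact: drc.
    by apply: cvgB; [exact: cvg_id|exact: cvg_cst].
  by apply: cvgD; apply: cvgMl_tmp; apply: cvgD; [exact: cs| |exact: cs|];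
    apply: cvgMl_tmp; exact: cs.
- move=> k t.
  have h2 a b : `|dr k a + -1 * dr k b| <= C + C.
    by rewrite (le_trans (ler_normD _ _))// mulN1r normrN lerD.
  have h3 l a b : 0 < l -> `|l^-1 * (dr k a + -1 * dr k b)| <= l^-1 * (C + C).
    move=> l1; rewrite normrM gtr0_norm ?invr_gt0//.
    by apply: ler_wpM2l; [rewrite invr_ge0 ltW|exact: h2].
  rewrite (le_trans (ler_normD _ _))//; apply: lerD; first exact: h3.
  by rewrite -normrN -mulNr opprK; exact: h3.
- move=> s.
  have ind a b : a <= b -> (a < s <= b)%R%:R = (0 < s - a)%R%:R + -1 * (0 < s - b)%R%:R :> R.
    move=> ab; rewrite !subr_gt0; case: (leP s b) => sb; case: (ltP a s) => sa /=;
      rewrite ?mulr0 ?mulr1 ?addr0 ?subrr//; lra.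
  rewrite ind ?(le_trans cc' (le_trans (ltW cd') dd'))// (ind _ _ (ltW cd')) -mulNr.
  by apply: cvgD; apply: cvgMl_tmp; apply: cvgD; (try apply: cvgMl_tmp); exact: drl.
Qed.

End transition.

(** * Averages over boxes *)
Section box_averages.
Variables (R : realType) (n : nat).
Local Notation V := 'rV[R]_n.+1.
Local Notation mu := (lebesgue_rV R n.+1).
Implicit Types (Om : set V) (a b c d x y : V) (i j : 'I_n.+1).

Definition upd c i (t : R) : V := \row_j if j == i then t else c ord0 j.

Lemma box_indicE c d x :
  \1_(box c d) x = \prod_j (c ord0 j < x ord0 j <= d ord0 j)%R%:R :> R.
Proof.
rewrite indicE; have [/set_mem xQ|xQ] := boolP (x \in box c d).
  by rewrite big1// => j _; rewrite xQ.
have [j jP] : exists j, ~~ (c ord0 j < x ord0 j <= d ord0 j).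
  apply: contrapT => h; move/negP : xQ; apply; apply/mem_set => j.
  by apply: contrapT => /negP hj; apply: h; exists j.
by rewrite (bigD1 j)//= (negbTE jP) mul0r.
Qed.

Lemma box_upd_indicE c d x i (s t : R) : \1_(box (upd c i s) (upd d i t)) x =
  (s < x ord0 i <= t)%R%:R *
    \prod_(j | j != i) (c ord0 j < x ord0 j <= d ord0 j)%R%:R :> R.
Proof.
rewrite box_indicE (bigD1 i)//= !mxE eqxx; congr (_ * _).
by apply: eq_bigr => j ji; rewrite !mxE (negbTE ji).
Qed.

Definition volume c d : R := \prod_j (d ord0 j - c ord0 j).

Lemma volume_upd c d i (s t : R) : volume (upd c i s) (upd d i t) =
  (t - s) * \prod_(j | j != i) (d ord0 j - c ord0 j).
Proof.
rewrite /volume (bigD1 i)//= !mxE eqxx; congr (_ * _).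
by apply: eq_bigr => j ji; rewrite !mxE (negbTE ji).
Qed.

Lemma upd_id c i : upd c i (c ord0 i) = c.
Proof. by apply/rowP => j; rewrite !mxE; case: eqP => [->|]. Qed.

Lemma inner_box_volume Om c d : inner_box Om c d -> 0 < volume c d.
Proof. by move=> [cd _]; apply: prodr_gt0 => j _; rewrite subr_gt0. Qed.

Lemma inner_box_measure Om c d : inner_box Om c d -> fine (mu (box c d)) = volume c d.
Proof. by move=> [cd _]; rewrite lebesgue_box// => i; rewrite ltW. Qed.

Variables (Om : set V) (v : V -> R) (g : 'I_n.+1 -> V -> R) (Cv G : R).
Hypotheses (mOm : measurable Om) (Omoo : (mu Om < +oo)%E).
Hypotheses (mv : measurable_fun Om v) (vC : forall x, Om x -> `|v x| <= Cv).
Hypotheses (mg : forall i, measurable_fun Om (g i)).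
Hypotheses (gG : forall i x, Om x -> `|g i x| <= G).
Hypothesis vg : forall i, weak_partial Om i v (g i).

Definition avg c d : R := (\int[mu]_(x in box c d) v x) / volume c d.

Lemma coord_measurable (f : R -> R) j : measurable_fun setT f ->
  measurable_fun Om (fun x : V => f (x ord0 j)).
Proof.
move=> mf; apply: measurable_funS (_ : measurable_fun setT _) => //.
exact: (measurableT_comp mf (@measurable_rV_coord R n.+1 j)).
Qed.

(** The weak derivative in direction i is tested against a transition profile in
the coordinate i times plateaus in the others. In the limit the left-hand side is
the difference of the two averages times the product of the other sides, and the
right-hand side is at most G times the volume of the larger box. *)
Lemma avg_shrink i c d (c' d' : R) : inner_box Om c d ->
  c ord0 i <= c' -> c' < d' -> d' <= d ord0 i ->
  `|avg c d - avg (upd c i c') (upd d i d')| <= G * (d ord0 i - c ord0 i).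
Proof.
move=> gd cc' cd' dd'; have [cd [eta eta0 sub]] := gd.
set ci := c ord0 i in cc' *; set di := d ord0 i in dd' *.
have [dt [Cd [ddt cdt dtC dtl]]] := transition_derivative eta0 cc' cd' dd'.
have [Ct tC] := transition_bounded eta0 cc' cd' dd'.
pose chi k j := if j == i then transition eta ci di c' d' k
  else plateau eta (c ord0 j) (d ord0 j) k.
have chi_i k : chi k i = transition eta ci di c' d' k by rewrite /chi eqxx.
have chi_j k j : j != i -> chi k j = plateau eta (c ord0 j) (d ord0 j) k.
  by move=> ji; rewrite /chi (negbTE ji).
pose phi k (y : V) := \prod_j chi k j (y ord0 j).
pose Psi k (y : V) := \prod_(j | j != i) plateau eta (c ord0 j) (d ord0 j) k (y ord0 j).
have tphi k : test_function Om (phi k).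
  apply: (@product_test_function _ _ Om (chi k) c (d + const_mx eta)) => //.
    move=> m j; rewrite /chi; case: ifP => _; first exact: smooth1_transition.
    exact: smooth1_plateau.
  move=> j s; rewrite !mxE; have [->|ji] := eqVneq j i.
    by rewrite chi_i; exact: transition_neq0.
  by rewrite chi_j//; exact: plateau_neq0.
have PsiE k y : \prod_(j | j != i) chi k j (y ord0 j) = Psi k y.
  by apply: eq_bigr => j ji; rewrite chi_j.
have phiE k y : phi k y = transition eta ci di c' d' k (y ord0 i) * Psi k y.
  by rewrite /phi (bigD1 i)//= chi_i PsiE.
have dphiE k y : 'D_(basis_vec R i) (phi k) y = dt k (y ord0 i) * Psi k y.
  have := @is_derive_prod R n (chi k) i (dt k (y ord0 i)) y.
  by rewrite chi_i PsiE => /(_ (ddt k _))[].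
have Psi01 k y : `|Psi k y| <= 1.
  have P0 : 0 <= Psi k y.
    by apply: prodr_ge0 => j _; case/andP: (plateau_itv eta (c ord0 j) (d ord0 j) k (y ord0 j)).
  rewrite ger0_norm//; apply: (@le_trans _ _ (\prod_(j | j != i) (1 : R))).
    by apply: ler_prod => j _; exact: plateau_itv.
  by rewrite big1.
pose Psil (y : V) : R := \prod_(j | j != i) (c ord0 j < y ord0 j <= d ord0 j)%R%:R.
have Psi_cvg y : Psi k y @[k --> \oo] --> Psil y.
  rewrite /Psi /Psil; elim: (index_enum _) => [|j s IH].
    by under eq_fun do rewrite big_nil; rewrite big_nil; exact: cvg_cst.
  rewrite big_cons (_ : (fun k => _) = fun k => if j != i then
      plateau eta (c ord0 j) (d ord0 j) k (y ord0 j) *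
      \prod_(j <- s | j != i) plateau eta (c ord0 j) (d ord0 j) k (y ord0 j)
    else \prod_(j <- s | j != i) plateau eta (c ord0 j) (d ord0 j) k (y ord0 j)); last first.
    by apply/funext => k; rewrite big_cons.
  by case: (j != i) => //; apply: cvgM => //; exact: plateau_cvg.
have mPsi k : measurable_fun Om (Psi k).
  rewrite /Psi; elim: (index_enum _) => [|j s IH].
    by under eq_fun do rewrite big_nil; exact: measurable_cst.
  under eq_fun do rewrite big_cons.
  case: (j != i) => //; apply: measurable_funM => //.
  apply: (@coord_measurable (plateau eta (c ord0 j) (d ord0 j) k)).
  apply: continuous_measurable_fun; apply: (@smooth1_continuous R 0%N).
  exact: smooth1_plateau.
have mPsil : measurable_fun Om Psil.
  exact: (@measurable_fun_cvg _ _ _ Om Psi Psil mPsi (fun y _ => Psi_cvg y)).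
have mdt k : measurable_fun Om (fun y : V => dt k (y ord0 i)).
  by apply: coord_measurable; exact: continuous_measurable_fun.
have mtr k : measurable_fun Om (fun y : V => transition eta ci di c' d' k (y ord0 i)).
  apply: coord_measurable; apply: continuous_measurable_fun.
  by apply: (@smooth1_continuous R 0%N); exact: smooth1_transition.
have trl s : transition eta ci di c' d' k s @[k --> \oo] --> transition_lim ci di c' d' s.
  exact: transition_cvg.
have mtl : measurable_fun Om (fun y : V => transition_lim ci di c' d' (y ord0 i)).
  exact: (measurable_fun_cvg mtr (fun y _ => trl (y ord0 i))).
pose dl (s : R) : R := (di - ci)^-1 * (ci < s <= di)%R%:R - (d' - c')^-1 * (c' < s <= d')%R%:R.
have mdl : measurable_fun Om (fun y : V => dl (y ord0 i)).
  exact: (measurable_fun_cvg mdt (fun y _ => dtl (y ord0 i))).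
have Cv0 x : Om x -> 0 <= Cv by move=> /vC; exact: le_trans.
have Ct0 : 0 <= Ct by apply: le_trans (tC 0%N 0).
have Cd0 : 0 <= Cd by apply: le_trans (dtC 0%N 0).
have lim1 : (\int[mu]_(x in Om) (v x * 'D_(basis_vec R i) (phi k) x)) @[k --> \oo] -->
    \int[mu]_(x in Om) (v x * (dl (x ord0 i) * Psil x)).
  apply: (@bounded_Rintegral_cvg _ _ R mu Om mOm Omoo _ _ (Cv * (Cd * 1))).
  - move=> k; apply: measurable_funM => //; rewrite (_ : 'D__ _ = fun y => dt k (y ord0 i) * Psi k y).
      exact: measurable_funM.
    by apply/funext => y; exact: dphiE.
  - by apply: measurable_funM => //; exact: measurable_funM.
  - move=> k x Ox; rewrite dphiE normrM ler_pM ?vC// normrM ler_pM ?dtC//.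
  - move=> x Ox; under eq_fun do rewrite dphiE.
    by apply: cvgMl_tmp; apply: cvgM; [exact: dtl|exact: Psi_cvg].
have lim2 : (\int[mu]_(x in Om) (g i x * phi k x)) @[k --> \oo] -->
    \int[mu]_(x in Om) (g i x * (transition_lim ci di c' d' (x ord0 i) * Psil x)).
  apply: (@bounded_Rintegral_cvg _ _ R mu Om mOm Omoo _ _ (G * (Ct * 1))).
  - move=> k; apply: measurable_funM => //; rewrite (_ : phi k = fun y => transition eta ci di c' d' k (y ord0 i) * Psi k y).
      exact: measurable_funM.
    by apply/funext => y; exact: phiE.
  - by apply: measurable_funM => //; exact: measurable_funM.
  - by move=> k x Ox; rewrite phiE normrM ler_pM ?gG// normrM ler_pM ?tC.
  - move=> x Ox; under eq_fun do rewrite phiE.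
    by apply: cvgMl_tmp; apply: cvgM; [exact: trl|exact: Psi_cvg].
have lim12 : \int[mu]_(x in Om) (v x * (dl (x ord0 i) * Psil x)) =
    - \int[mu]_(x in Om) (g i x * (transition_lim ci di c' d' (x ord0 i) * Psil x)).
  rewrite (_ : (fun k => _) = fun k => - \int[mu]_(x in Om) (g i x * phi k x)) in lim1; last first.
    by apply/funext => k; exact: vg (tphi k).
  exact: (@norm_cvg_unique _ R^o _ _ _ _ lim1 (cvgN lim2)).
have QOm := inner_box_sub gd.
pose Q' := box (upd c i c') (upd d i d').
have Q'Q : Q' `<=` box c d.
  move=> y yQ j; have := yQ j; rewrite !mxE; case: eqP => [->|//] /andP[y1 y2].
  by rewrite (le_lt_trans cc' y1) (le_trans y2 dd').
have mQ : measurable (box c d) by exact: measurable_box.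
have mQ' : measurable Q' by exact: measurable_box.
have bv : bounded_meas Om v by split=> //; exists Cv.
have Ev A : A `<=` Om -> measurable A ->
    \int[mu]_(x in Om) (v x * \1_A x) = \int[mu]_(x in A) v x.
  by move=> AO mA; rewrite Rintegral_indic_mul setIidr.
have lhs : \int[mu]_(x in Om) (v x * (dl (x ord0 i) * Psil x)) =
    (di - ci)^-1 * (\int[mu]_(x in box c d) v x) - (d' - c')^-1 * \int[mu]_(x in Q') v x.
  have bvi A : measurable A -> bounded_meas Om (fun x => v x * \1_A x).
    by move=> mA; apply: bounded_measM => //; exact: bounded_meas_indic.
  have bvZ (e : R) A : measurable A -> bounded_meas Om (fun x => e * (v x * \1_A x)).
    by move=> mA; apply: bounded_measM; [exact: bounded_meas_cst|exact: bvi].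
  rewrite -(Ev _ QOm mQ) -(Ev _ (subset_trans Q'Q QOm) mQ').
  rewrite -!bounded_RintegralZ//; [|exact: bvi..].
  rewrite -bounded_RintegralB//; [|exact: bvZ..].
  apply: eq_Rintegral => x _; rewrite /Q' box_upd_indicE.
  have -> : \1_(box c d) x = (ci < x ord0 i <= di)%R%:R * Psil x.
    by rewrite -box_upd_indicE !upd_id.
  by rewrite /dl -/(Psil x); ring.
have tlb s : `|transition_lim ci di c' d' s| <= (ci < s <= di)%R%:R.
  exact: (@transition_lim_bound _ eta).
have Psil0 x : 0 <= Psil x by apply: prodr_ge0 => j _; rewrite ler0n.
have tP x : `|transition_lim ci di c' d' (x ord0 i) * Psil x| <= \1_(box c d) x.
  rewrite -(upd_id c i) -(upd_id d i) box_upd_indicE normrM (ger0_norm (Psil0 x)).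
  by rewrite ler_wpM2r.
have tP1 x : `|transition_lim ci di c' d' (x ord0 i) * Psil x| <= 1.
  by rewrite (le_trans (tP x))// indicE lern1 leq_b1.
have rhs : `|\int[mu]_(x in Om) (g i x * (transition_lim ci di c' d' (x ord0 i) * Psil x))| <=
    G * volume c d.
  rewrite -(@Rintegral_support _ _ (box c d) Om)//; last first.
    move=> x _ nQ; suff -> : transition_lim ci di c' d' (x ord0 i) * Psil x = 0 by rewrite mulr0.
    by apply/eqP; rewrite -normr_le0 (le_trans (tP x))// indicE memNset.
  rewrite -(inner_box_measure gd); apply: bounded_Rintegral => //.
  - by have := lebesgue_box_fin c d.
  - apply: (@bounded_measS _ _ _ Om) => //; split.
      by apply: measurable_funM => //; exact: measurable_funM.
    by exists (G * 1) => x Ox; rewrite normrM ler_pM ?gG.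
  - by move=> x xQ; rewrite -[leRHS]mulr1 normrM ler_pM ?gG//; exact: QOm.
have P0 : 0 < \prod_(j | j != i) (d ord0 j - c ord0 j).
  by apply: prodr_gt0 => j _; rewrite subr_gt0.
have volE : volume c d = (di - ci) * \prod_(j | j != i) (d ord0 j - c ord0 j).
  by rewrite -volume_upd !upd_id.
rewrite /avg volume_upd volE -/Q'.
rewrite -normrN -lim12 lhs volE in rhs.
move: P0 rhs; set P := \prod_(j | _) _ => P0 rhs.
have [di0 d'0] : 0 < di - ci /\ 0 < d' - c'.
  by rewrite !subr_gt0; split=> //; exact: cd.
rewrite [X in `|X|](_ : _ = P^-1 * ((di - ci)^-1 * (\int[mu]_(x in box c d) v x) -
    (d' - c')^-1 * \int[mu]_(x in Q') v x)); last by field; rewrite !gt_eqF.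
by rewrite normrM gtr0_norm ?invr_gt0// mulrC ler_pdivrMr// -mulrA.
Qed.

Definition side c d : R := \sum_j (d ord0 j - c ord0 j).

Lemma inner_subbox c d a b : inner_box Om c d -> (forall j, c ord0 j <= a ord0 j) ->
  (forall j, a ord0 j < b ord0 j) -> (forall j, b ord0 j <= d ord0 j) -> inner_box Om a b.
Proof.
move=> [_ [eta eta0 sub]] ca ab bd; split=> //; exists eta => //.
apply: subset_trans sub => y yab j; have := yab j; rewrite !mxE => /andP[y1 y2].
by rewrite (le_trans (ca j) y1) (le_trans y2) ?lerD2r.
Qed.

(** The sides are shrunk one at a time. *)
Lemma avg_subbox c d a b : inner_box Om c d -> (forall j, c ord0 j <= a ord0 j) ->
  (forall j, a ord0 j < b ord0 j) -> (forall j, b ord0 j <= d ord0 j) ->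
  `|avg c d - avg a b| <= G * side c d.
Proof.
move=> gcd ca ab bd; have [cd _] := gcd.
(* The first k coordinates come from q, the others from p. *)
pose hyb (p q : V) (k : nat) : V := \row_j if (j < k)%N then q ord0 j else p ord0 j.
suff : forall k, (k <= n.+1)%N -> `|avg c d - avg (hyb c a k) (hyb d b k)| <=
    G * \sum_(j < n.+1 | (j < k)%N) (d ord0 j - c ord0 j).
  move=> /(_ n.+1 (leqnn _)).
  have hybE p q : hyb p q n.+1 = q by apply/rowP => j; rewrite !mxE ltn_ord.
  rewrite !hybE; congr (_ <= G * _); apply: eq_bigl => j; exact: ltn_ord.
elim=> [_|k IH kn].
  have hybE p q : hyb p q 0%N = p by apply/rowP => j; rewrite !mxE.
  by rewrite !hybE subrr normr0 big_pred0// mulr0.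
pose i := Ordinal kn.
have hybS p q : hyb p q k.+1 = upd (hyb p q k) i (q ord0 i).
  apply/rowP => j; rewrite !mxE ltnS leq_eqVlt -val_eqE /=.
  by case: eqP => // e; congr (q ord0 _); apply: val_inj.
have hi p q : hyb p q k ord0 i = p ord0 i by rewrite mxE ltnn.
rewrite (bigD1 i)//= (eq_bigl (fun j : 'I_n.+1 => (j < k)%N)); last first.
  by move=> j; rewrite -val_eqE /= ltnS ltn_neqAle andbC.
rewrite mulrDr [leRHS]addrC; apply: (le_trans (ler_distD (avg (hyb c a k) (hyb d b k)) _ _)).
apply: lerD; first exact: IH (ltnW kn).
rewrite !hybS -[in leRHS](hi c a) -[in leRHS](hi d b); apply: avg_shrink.
- by apply: (inner_subbox gcd) => j; rewrite !mxE; case: ifP.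
- by rewrite hi.
- exact: ab.
- by rewrite hi.
Qed.

End box_averages.

(** * A pointwise representative *)
Section inner_box_size.
Variables (R : realType) (n : nat).
Local Notation V := 'rV[R]_n.+1.
Implicit Types (Om : set V) (a b c d x y : V) (i j : 'I_n.+1).

Lemma side_le c d (s : R) : (forall j, d ord0 j - c ord0 j <= s) ->
  side c d <= n.+1%:R * s.
Proof.
move=> h; apply: (@le_trans _ _ (\sum_(j < n.+1) s)); first exact: ler_sum.
by rewrite sumr_const card_ord mulr_natl.
Qed.

Lemma small_inner_box Om x (e : R) : open Om -> Om x -> 0 < e ->
  exists c d, [/\ inner_box Om c d, box c d x & side c d <= e].
Proof.
move=> oOm Ox e0; have /nbhs_ballP[r /= r0 xr] := open_nbhs_nbhs (conj oOm Ox).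
pose s := Num.min (r / 2) (e / (2 * n.+1%:R)).
have s0 : 0 < s by rewrite lt_min !divr_gt0// mulr_gt0// ltr0n.
have sr : s < r by rewrite gt_min; apply/orP; left; lra.
have ns : `|const_mx s : V| = s.
  rewrite [LHS]/Num.Def.normr /= mx_normrE; apply/eqP; rewrite eq_le; apply/andP; split.
    by apply/bigmax_leP; split=> [|[a j] _ /=]; rewrite ?(ltW s0)// mxE gtr0_norm.
  by apply/bigmax_geP; right; exists (ord0, ord0) => //=; rewrite mxE gtr0_norm.
exists (x - const_mx s), (x + const_mx s); split.
- apply: (@inner_box_ball _ _ Om x _ _ r).
  + by move=> y xy; apply: xr; rewrite -ball_normE.
  + by move=> j; rewrite !mxE; lra.
  + by rewrite opprB addrC subrK ns.
  + by rewrite opprD addrA subrr add0r normrN ns.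
- by move=> j; rewrite !mxE; lra.
- apply: (le_trans (@side_le _ _ (2 * s) _)).
    by move=> j; rewrite !mxE; lra.
  have : s <= e / (2 * n.+1%:R) by rewrite ge_min lexx orbT.
  by rewrite ler_pdivlMr ?mulr_gt0 ?ltr0n//; lra.
Qed.

Lemma inner_box_setI Om a b c d x : inner_box Om a b -> inner_box Om c d -> box a b x -> box c d x ->
  exists c' d', [/\ inner_box Om c' d', box c' d' x,
    forall j, a ord0 j <= c' ord0 j /\ d' ord0 j <= b ord0 j &
    forall j, c ord0 j <= c' ord0 j /\ d' ord0 j <= d ord0 j].
Proof.
move=> gab gcd xab xcd.
pose c' : V := \row_i Num.max (a ord0 i) (c ord0 i).
pose d' : V := \row_i Num.min (b ord0 i) (d ord0 i).
have xQ : box c' d' x by rewrite -box_setI.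
exists c', d'; split=> //; first 1 last.
- by move=> j; rewrite !mxE le_max ge_min !lexx.
- by move=> j; rewrite !mxE le_max ge_min !lexx !orbT.
- apply: (inner_subbox gab) => j.
  + by rewrite mxE le_max lexx.
  + by have /andP[] := xQ j; exact: lt_le_trans.
  + by rewrite mxE ge_min lexx.
Qed.

End inner_box_size.

Section representative.
Variables (R : realType) (n : nat).
Local Notation V := 'rV[R]_n.+1.
Variables (Om : set V) (A : V -> V -> R) (G C : R).
Implicit Types (a b c d x y : V) (i j : 'I_n.+1).
Hypotheses (oOm : open Om) (G0 : 0 <= G).
Hypothesis A_subbox : forall c d a b, inner_box Om c d -> (forall j, c ord0 j <= a ord0 j) ->
  (forall j, a ord0 j < b ord0 j) -> (forall j, b ord0 j <= d ord0 j) ->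
  `|A c d - A a b| <= G * side c d.
Hypothesis A_bounded : forall c d, inner_box Om c d -> `|A c d| <= C.

(** The limit of A over boxes shrinking to x, as the best of the lower bounds that
the stability of A under shrinking gives. *)
Definition box_rep x : R := sup [set s | exists c d,
  [/\ inner_box Om c d, box c d x & s = A c d - G * side c d]].

(** Both values are close to the value on the intersection. *)
Lemma A_overlap a b c d x : inner_box Om a b -> inner_box Om c d -> box a b x -> box c d x ->
  `|A a b - A c d| <= G * (side a b + side c d).
Proof.
move=> gab gcd xab xcd; have [c' [d' [g' x' h1 h2]]] := inner_box_setI gab gcd xab xcd.
have lt' j : c' ord0 j < d' ord0 j by case: g'.
rewrite mulrDr (le_trans (ler_distD (A c' d') _ _))// lerD//.
  by apply: A_subbox => // j; case: (h1 j).
by rewrite distrC; apply: A_subbox => // j; case: (h2 j).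
Qed.

Lemma box_rep_close c d x : inner_box Om c d -> box c d x -> `|A c d - box_rep x| <= G * side c d.
Proof.
move=> gcd xcd; rewrite /box_rep; set S := [set s | _].
have Sub : ubound S (A c d + G * side c d).
  move=> _ [a [b [gab xab ->]]]; have := A_overlap gab gcd xab xcd.
  by rewrite ler_norml mulrDr => /andP[_]; lra.
have Scd : S (A c d - G * side c d) by exists c, d.
have h1 : sup S <= A c d + G * side c d by apply: ge_sup => //; exists (A c d - G * side c d).
have h2 : A c d - G * side c d <= sup S.
  by apply: ub_le_sup => //; exists (A c d + G * side c d).
by rewrite ler_norml; apply/andP; split; lra.
Qed.

Lemma box_rep_bounded x : Om x -> `|box_rep x| <= C + G.
Proof.
move=> Ox; have [c [d [gcd xcd s1]]] := small_inner_box oOm Ox ltr01.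
have h := box_rep_close gcd xcd; rewrite -[box_rep x](subKr (A c d)).
rewrite (le_trans (ler_normB _ _))// lerD ?A_bounded//.
by rewrite (le_trans h)// -[leRHS]mulr1 ler_wpM2l.
Qed.

(** Two points at sup distance s lie in a common box with sides at most 2 s. *)
Lemma box_rep_lipschitz_ball x (r : R) : (forall y, `|x - y| < 3 * r -> Om y) ->
  forall y z, `|x - y| < r -> `|x - z| < r ->
  `|box_rep y - box_rep z| <= 4 * G * n.+1%:R * `|y - z|.
Proof.
move=> xr y z xy xz.
have [->|yz] := eqVneq y z; first by rewrite !subrr !normr0 mulr0.
pose s := `|y - z|; have s0 : 0 < s by rewrite normr_gt0 subr_eq0.
have s2 : s < 2 * r.
  by rewrite (le_lt_trans (ler_distD x _ _))// distrC; lra.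
(* Lowered by s because boxes do not contain their lower faces. *)
pose c : V := \row_j (Num.min (y ord0 j) (z ord0 j) - s).
pose d : V := \row_j Num.max (y ord0 j) (z ord0 j).
have r0 : 0 < 3 * r by move: (normr_ge0 (x - y)); lra.
have xyj j : `|x ord0 j - y ord0 j| < r.
  by have := mx_norm_coord (x - y) j; rewrite !mxE => /le_lt_trans; apply.
have xzj j : `|x ord0 j - z ord0 j| < r.
  by have := mx_norm_coord (x - z) j; rewrite !mxE => /le_lt_trans; apply.
have yzj j : `|y ord0 j - z ord0 j| <= s by have := mx_norm_coord (y - z) j; rewrite !mxE.
have gcd : inner_box Om c d.
  apply: (@inner_box_ball _ _ Om x _ _ (3 * r)) => //.
  - by move=> j; rewrite !mxE; case: (lerP (y ord0 j) (z ord0 j)); lra.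
  - apply: mx_norm_lt => // j; rewrite !mxE; move: (xyj j) (xzj j); rewrite !ltr_norml.
    by case: (lerP (y ord0 j) (z ord0 j)) => ? /andP[? ?] /andP[? ?]; apply/andP; split; lra.
  - apply: mx_norm_lt => // j; rewrite !mxE; move: (xyj j) (xzj j); rewrite !ltr_norml.
    by case: (lerP (y ord0 j) (z ord0 j)) => ? /andP[? ?] /andP[? ?]; apply/andP; split; lra.
have ycd : box c d y.
  by move=> j; rewrite !mxE; case: (lerP (y ord0 j) (z ord0 j)); lra.
have zcd : box c d z.
  by move=> j; rewrite !mxE; case: (lerP (y ord0 j) (z ord0 j)); lra.
have sd : side c d <= n.+1%:R * (2 * s).
  apply: side_le => j; rewrite !mxE; move: (yzj j); rewrite ler_norml.
  by case: (lerP (y ord0 j) (z ord0 j)) => ? /andP[? ?]; lra.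
rewrite (le_trans (ler_distD (A c d) _ _))//.
have -> : 4 * G * n.+1%:R * s = G * (n.+1%:R * (2 * s)) + G * (n.+1%:R * (2 * s)) by ring.
apply: lerD; [rewrite distrC|]; apply: (@le_trans _ _ (G * side c d)).
- exact: box_rep_close.
- exact: ler_wpM2l.
- exact: box_rep_close.
- exact: ler_wpM2l.
Qed.

End representative.

(** * Functions with small integrals over boxes *)
Section vanishing.
Variables (R : realType) (n : nat).
Local Notation V := 'rV[R]_n.+1.
Local Notation mu := (lebesgue_rV R n.+1).
Variables (Om : set V) (f : V -> R).
Implicit Types (a b c d x y : V) (i j : 'I_n.+1).
Hypotheses (mOm : measurable Om) (bf : bounded_meas Om f).

Lemma longest_side c d : exists i, side c d <= n.+1%:R * (d ord0 i - c ord0 i).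
Proof.
case: (@Order.TotalTheory.arg_maxP _ _ _ ord0 xpredT (fun j => d ord0 j - c ord0 j) isT)
  => i _ hi.
by exists i; apply: side_le => j; exact: hi.
Qed.

Lemma side_upd c d i (s t : R) :
  side (upd c i s) (upd d i t) = side c d - (d ord0 i - c ord0 i) + (t - s).
Proof.
rewrite /side (bigD1 i)//= [in RHS](bigD1 i)//= !mxE eqxx.
rewrite (eq_bigr (fun j => d ord0 j - c ord0 j)); first by ring.
by move=> j ji; rewrite !mxE (negbTE ji).
Qed.

Lemma box_split c d i (s : R) : c ord0 i <= s <= d ord0 i ->
  box c d = box c (upd d i s) `|` box (upd c i s) d /\
  [disjoint box c (upd d i s) & box (upd c i s) d].
Proof.
move=> /andP[cs sd]; split; last first.
  apply/disj_setPS => x [h1 h2]; have := h1 i; have := h2 i; rewrite !mxE eqxx.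
  by move=> /andP[h _] /andP[_]; rewrite leNgt h.
apply/seteqP; split=> [x xcd|x].
  have [xs|xs] := leP (x ord0 i) s; [left|right] => j; have := xcd j;
    rewrite !mxE; case: eqP => // -> /andP[h1 h2]; apply/andP; split=> //.
case=> h j; have := h j; rewrite !mxE; case: eqP => // -> /andP[h1 h2];
  apply/andP; split=> //; first exact: le_trans sd.
exact: le_lt_trans h1.
Qed.

(** Halving the longest side lowers the sum of the sides by at least the fraction
1 / (2 (n + 1)), and the halves share the volume. *)
Lemma box_integral_halving (K : R) : 0 <= K ->
  (forall c d, inner_box Om c d ->
    `|\int[mu]_(x in box c d) f x| <= K * side c d * volume c d) ->
  forall c d, inner_box Om c d -> `|\int[mu]_(x in box c d) f x| <=
    K * (1 - (2 * n.+1%:R)^-1) * side c d * volume c d.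
Proof.
move=> K0 h c d gcd; have [cd _] := gcd; have [i li] := longest_side c d.
pose s := (c ord0 i + d ord0 i) / 2; have := cd i => cdi.
have csd : c ord0 i <= s <= d ord0 i by rewrite /s; apply/andP; split; lra.
have [E D] := box_split csd.
have g1 : inner_box Om c (upd d i s).
  apply: (inner_subbox gcd) => // j; rewrite !mxE; case: eqP => // ->; rewrite /s; lra.
have g2 : inner_box Om (upd c i s) d.
  apply: (inner_subbox gcd) => // j; rewrite !mxE; case: eqP => // ->; rewrite /s; lra.
rewrite E Rintegral_setU//; first last.
- rewrite -E; apply: bounded_meas_integrable; [exact: measurable_box| |].
    by have := lebesgue_box_fin c d.
  by apply: (@bounded_measS _ _ _ Om) => //; exact: inner_box_sub.
- exact: measurable_box.
- exact: measurable_box.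
apply: (le_trans (ler_normD _ _)); apply: (le_trans (lerD (h _ _ g1) (h _ _ g2))).
pose P := \prod_(j | j != i) (d ord0 j - c ord0 j).
have P0 : 0 <= P by apply: prodr_ge0 => j _; rewrite subr_ge0 ltW.
have v1 : volume c (upd d i s) = (s - c ord0 i) * P by rewrite -volume_upd upd_id.
have v2 : volume (upd c i s) d = (d ord0 i - s) * P by rewrite -volume_upd upd_id.
have v0 : volume c d = (d ord0 i - c ord0 i) * P by rewrite -volume_upd !upd_id.
have s1 : side c (upd d i s) = side c d - (d ord0 i - c ord0 i) + (s - c ord0 i).
  by rewrite -side_upd upd_id.
have s2 : side (upd c i s) d = side c d - (d ord0 i - c ord0 i) + (d ord0 i - s).
  by rewrite -side_upd upd_id.
rewrite v1 v2 v0 s1 s2 /s; move: (d ord0 i) (c ord0 i) (side c d) li cdi => di ci S li cdi.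
rewrite [leLHS](_ : _ = K * ((S - (di - ci) / 2) * ((di - ci) * P))); last by field.
rewrite -!mulrA ler_wpM2l// !mulrA ler_wpM2r// ler_wpM2r ?subr_ge0 ?(ltW cdi)//.
suff : (2 * n.+1%:R)^-1 * S <= (di - ci) / 2.
  by move: ((2 * n.+1%:R)^-1) => t; rewrite [(1 - t) * S]mulrBl mul1r; move: (t * S) => ?; lra.
rewrite mulrC ler_pdivrMr ?mulr_gt0 ?ltr0n//.
by rewrite (_ : _ / 2 * _ = n.+1%:R * (di - ci))//; field.
Qed.

Lemma box_integral_eq0 (K : R) : 0 <= K ->
  (forall c d, inner_box Om c d ->
    `|\int[mu]_(x in box c d) f x| <= K * side c d * volume c d) ->
  forall c d, inner_box Om c d -> \int[mu]_(x in box c d) f x = 0.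
Proof.
move=> K0 h; pose th : R := 1 - (2 * n.+1%:R)^-1.
have n1 : 1 <= n.+1%:R :> R by rewrite ler1n.
have i1 : (2 * n.+1%:R)^-1 <= 1 :> R by rewrite invf_le1 ?mulr_gt0 ?ltr0n//; lra.
have th0 : 0 <= th by rewrite subr_ge0.
have th1 : th < 1 by rewrite ltrBlDr ltrDl invr_gt0 mulr_gt0 ?ltr0n.
have hk k : forall c d, inner_box Om c d ->
    `|\int[mu]_(x in box c d) f x| <= K * th ^+ k * side c d * volume c d.
  elim: k => [|k IH] c d gcd; first by rewrite expr0 mulr1; exact: h.
  rewrite exprSr mulrA; apply: box_integral_halving => //.
  by rewrite mulr_ge0// exprn_ge0.
move=> c d gcd; apply/eqP; rewrite -normr_le0.
have lim : K * th ^+ k * side c d * volume c d @[k --> \oo] --> (0 : R).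
  have -> : (0 : R) = K * 0 * side c d * volume c d by rewrite mulr0 !mul0r.
  by do 2 apply: cvgMr_tmp; apply: cvgMl_tmp; apply: cvg_expr; rewrite ger0_norm.
by apply: (cvgr_to_ge lim); apply: nearW => k; exact: hk.
Qed.

(** The sets on whose intersection with the box f has integral 0 form a Dynkin
system that contains all boxes. *)
Lemma box_integral_ae_eq0 c d : inner_box Om c d ->
  (forall a b, inner_box Om a b -> \int[mu]_(x in box a b) f x = 0) ->
  {ae mu, forall x, box c d x -> f x = 0}.
Proof.
move=> gcd f0; have mQ := measurable_box c d.
have iQ : mu.-integrable (box c d) (EFin \o f).
  apply: bounded_meas_integrable => //; first by have := lebesgue_box_fin c d.
  by apply: (@bounded_measS _ _ _ Om) => //; exact: inner_box_sub.
pose P : set_system V := [set E | (\int[mu]_(x in box c d `&` E) (f x)%:E = 0)%E].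
have iE E : measurable E -> mu.-integrable (box c d `&` E) (EFin \o f).
  by move=> mE; apply: integrableS iQ => //; exact: measurableI.
have P_T : P setT.
  rewrite /P/= setIT -(@fineK _ (\int[mu]_(x in box c d) (f x)%:E)).
    by congr EFin; exact: f0.
  exact: integrable_fin_num.
have PE : forall E, measurable E -> P E.
  rewrite boxes_generate; apply: dynkin_induction.
  - exact: boxes_generate.
  - exact: boxes_setI_closed.
  - exact: P_T.
  - move=> _ [a [b ->]]; rewrite /P/= box_setI.
    set c' := \row_i _; set d' := \row_i _.
    have [cd'|ncd'] := pselect (forall j, c' ord0 j < d' ord0 j); last first.
      rewrite (_ : box c' d' = set0) ?integral_set0//.
      apply/seteqP; split=> // x xQ; apply: ncd' => j.
      by have /andP[] := xQ j; exact: lt_le_trans.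
    have g' : inner_box Om c' d'.
      by apply: (inner_subbox gcd) => // j; rewrite mxE ?le_max ?ge_min lexx.
    rewrite -[LHS]fineK; first by congr EFin; exact: f0.
    apply: integrable_fin_num; first exact: measurable_box.
    by have := iE _ (measurable_box a b); rewrite box_setI.
  - move=> E mE PEE; rewrite /P/=; move: P_T; rewrite /P/= setIT.
    rewrite -[X in (\int[mu]_(x in X) _)%E]setIT -[setT](setUv E) setIUr.
    rewrite integral_setU//; first 1 last.
    + exact: measurableI.
    + by apply: measurableI => //; exact: measurableC.
    + by rewrite -setIUr setUv setIT; exact: measurable_int iQ.
    + by apply/disj_setPS => x [[_ ?] []].
    by move: PEE; rewrite /P/= => ->; rewrite add0e.
  - move=> F mF tF PF; rewrite /P/= setI_bigcupr integral_bigcup//.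
    + by apply: eseries0 => k _ _; exact: PF.
    + exact: trivIset_setIl.
    + by move=> k; exact: measurableI.
    + by rewrite -setI_bigcupr; apply: iE; exact: bigcup_measurable.
have : ae_eq mu (box c d) (EFin \o f) (cst 0%E).
  apply: integral_ae_eq => // E EQ mE; rewrite integral0.
  by have := PE E mE; rewrite /P/= (setIidr EQ).
by apply: filterS => x h xQ; have [] := h xQ.
Qed.

Lemma boxes_integral_ae_eq0 (K : R) : open Om -> 0 <= K ->
  (forall c d, inner_box Om c d ->
    `|\int[mu]_(x in box c d) f x| <= K * side c d * volume c d) ->
  {ae mu, forall x, Om x -> f x = 0}.
Proof.
move=> oOm K0 h; have f0 := box_integral_eq0 K0 h.
have [Q [gQ OmE]] := inner_box_cover oOm.
have : {ae mu, forall x, forall k, box (Q k).1 (Q k).2 x -> f x = 0}.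
  apply: ae_foralln => k; have [gk|Q0] := gQ k; first exact: box_integral_ae_eq0.
  by apply: aeW => x; rewrite Q0.
by apply: filterS => x hx; rewrite OmE => -[k _]; exact: hx.
Qed.

End vanishing.

(** * From local to global Lipschitz bounds *)
(** Continuation argument: at the supremum of the parameters up to which the bound
is known, the local bound takes it further, unless the supremum is 1. *)
Lemma interval_lipschitz (R : realType) (F : R -> R) (M : R) : 0 <= M ->
  (forall t, 0 <= t <= 1 -> exists2 r, 0 < r & forall s s', 0 <= s <= 1 ->
    0 <= s' <= 1 -> `|s - t| < r -> `|s' - t| < r -> `|F s - F s'| <= M * `|s - s'|) ->
  `|F 0 - F 1| <= M.
Proof.
move=> M0 h; pose S := [set t | 0 <= t <= 1 /\ `|F 0 - F t| <= M * t].
have S0 : S 0 by split; rewrite ?lexx ?ler01// subrr normr0 mulr0.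
have ub1 : ubound S 1 by move=> t [/andP[]].
have hS : has_sup S by split; [exists 0|exists 1].
have s0 : 0 <= sup S by apply: ub_le_sup => //; exists 1.
have s1 : sup S <= 1 by apply: ge_sup => //; exists 0.
have [|r r0 hr] := h (sup S); first by rewrite s0.
have [t [/andP[t0 t1] Ft] st] := sup_adherent r0 hS.
have ts : t <= sup S by apply: ub_le_sup; [exists 1|split=> //; apply/andP].
pose u := Num.min 1 (sup S + r / 2).
have tu : t <= u by rewrite le_min t1 (le_trans ts)// lerDl divr_ge0// ltW.
have u01 : 0 <= u <= 1 by rewrite (le_trans t0 tu) ge_min lexx.
have ur : `|u - sup S| < r.
  have : u <= sup S + r / 2 by rewrite ge_min lexx orbT.
  have : sup S <= u by rewrite le_min s1/= lerDl divr_ge0// ltW.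
  by rewrite ltr_norml => ? ?; apply/andP; split; lra.
have tr : `|t - sup S| < r by rewrite ltr_norml; apply/andP; split; lra.
have Su : S u.
  split=> //; apply: (le_trans (ler_distD (F t) _ _)).
  have -> : M * u = M * t + M * (u - t) by ring.
  apply: lerD => //; rewrite -[u - t]ger0_norm ?subr_ge0// distrC.
  by rewrite distrC [`|u - t|]distrC; apply: hr => //; apply/andP.
have us : u <= sup S by apply: ub_le_sup => //; exists 1.
have u1 : u = 1.
  move: us; rewrite /u; case: (leP 1 (sup S + r / 2)) => // _; lra.
by move: Su; rewrite u1 => -[_]; rewrite mulr1.
Qed.

Section matrix_bounds.
Variables (R : realType).

Lemma norm_col' n (x : 'rV[R]_n.+1) : `|col' ord_max x| <= `|x|.
Proof. by apply: mx_norm_le => // j; rewrite mxE mx_norm_coord. Qed.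

Lemma norm_mulmx_ex n (Q : 'M[R]_n.+1) : exists2 C : R, 0 < C &
  forall x : 'rV[R]_n.+1, `|x *m Q| <= C * `|x|.
Proof.
pose C : R := \sum_i \sum_j `|Q i j|.
have C0 : 0 <= C by do 2 apply: sumr_ge0 => ? _.
exists (C + 1) => [|x]; first by rewrite ltr_wpDl.
apply: mx_norm_le => [|j]; first by rewrite mulr_ge0// addr_ge0.
rewrite mxE (le_trans (ler_norm_sum _ _ _))//.
apply: (@le_trans _ _ (\sum_i (\sum_j `|Q i j|) * `|x|)).
  apply: ler_sum => i _; rewrite normrM mulrC ler_pM ?mx_norm_coord//.
  by rewrite (bigD1 j)//= lerDl; apply: sumr_ge0.
by rewrite -mulr_suml ler_wpM2r// lerDl.
Qed.

End matrix_bounds.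

Section globalization.
Variables (R : realType) (n : nat).
Local Notation V := 'rV[R]_n.+1.
Variables (Om : set V) (w : V -> R) (K B : R).
Implicit Types x y z : V.
Hypotheses (oOm : open Om) (bOm : bounded_set Om) (lOm : lipschitz_boundary Om).
Hypotheses (K0 : 0 <= K) (wB : forall x, Om x -> `|w x| <= B).
Hypothesis w_loc : forall x, Om x -> exists2 r, 0 < r & forall y z,
  `|x - y| < r -> `|x - z| < r -> `|w y - w z| <= K * `|y - z|.

Lemma segment_lipschitz y z : (forall t, 0 <= t <= 1 -> Om (y + t *: (z - y))) ->
  `|w y - w z| <= K * `|y - z|.
Proof.
move=> seg; pose F t := w (y + t *: (z - y)).
have -> : w y = F 0 by rewrite /F scale0r addr0.
have -> : w z = F 1 by rewrite /F scale1r addrC subrK.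
apply: interval_lipschitz => [|t t01]; first by rewrite mulr_ge0.
have [r r0 hr] := w_loc (seg t t01).
have D0 : 0 < `|y - z| + 1 by rewrite ltr_wpDl.
have E s s' : `|(y + s *: (z - y)) - (y + s' *: (z - y))| = `|y - z| * `|s - s'|.
  by rewrite opprD addrACA subrr add0r -scalerBl normrZ mulrC [`|z - y|]distrC.
have small s : `|s - t| < r / (`|y - z| + 1) ->
    `|(y + t *: (z - y)) - (y + s *: (z - y))| < r.
  rewrite E distrC ltr_pdivlMr// => /(le_lt_trans _); apply.
  by rewrite mulrC ler_wpM2l// lerDl.
exists (r / (`|y - z| + 1)); first by rewrite divr_gt0.
by move=> s s' _ _ /small h1 /small h2; rewrite -mulrA -E; exact: hr.
Qed.

(** In the rotated coordinates the segment that rises vertically from y stays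
above the graph, and so does the segment from its top to z if the height T of the
rise beats the slope of the graph. Both have length at most a constant times
|y - z|, and the bounds along segments add up. *)
Lemma boundary_lipschitz x : boundary Om x -> exists K' rho, [/\ 0 <= K', 0 < rho &
  forall y z, Om y -> Om z -> `|x - y| < rho -> `|x - z| < rho ->
    `|w y - w z| <= K' * `|y - z|].
Proof.
move=> /lOm[Q [g [QQ lg /(nbhs_normP _ _).1[r /= r0 graph]]]].
have [M M0 gM] := pinfty_ex_gt0 lg.
have {}gM a b : `|g a - g b| <= M * `|a - b| by exact: (gM (a, b)).
have [C C0 hC] := norm_mulmx_ex Q.
(* The vertical direction in the original coordinates. *)
pose u : V := delta_mx ord0 ord_max *m Q^T.
have uQ : u *m Q = delta_mx ord0 ord_max.
  by rewrite -mulmxA (mulmx1C QQ) mulmx1.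
(* C' times |y - z| bounds the length of the vertical segment. *)
pose C' := 2 * (M + 1) * C * (`|u| + 1).
have C'0 : 0 < C' by rewrite !mulr_gt0// ?addr_gt0// ltr_wpDl.
exists (K * (2 * C' + 1)), (r / (1 + 2 * C')); split.
- by rewrite mulr_ge0// addr_ge0// mulr_ge0// ltW.
- by rewrite divr_gt0// addr_gt0// mulr_gt0.
move=> y z Oy Oz xy xz; set rho := r / (1 + 2 * C') in xy xz.
have rho0 : 0 < rho by rewrite divr_gt0// addr_gt0// mulr_gt0.
have rhoE : rho * (1 + 2 * C') = r by rewrite divfK// gt_eqF// addr_gt0// mulr_gt0.
pose d := `|y *m Q - z *m Q|; have d0 : 0 <= d by exact: normr_ge0.
have yz : `|y - z| <= 2 * rho.
  by rewrite (le_trans (ler_distD x _ _))// [`|y - x|]distrC; lra.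
have dC : d <= C * `|y - z| by rewrite /d -mulmxBl.
(* M d makes up for the slope of the graph, d for the heights of y and z. *)
pose T := (M + 1) * d.
have T0 : 0 <= T by rewrite mulr_ge0// addr_ge0// ltW.
have Tu : T * `|u| <= C' * `|y - z|.
  have h : T <= (M + 1) * (C * `|y - z|) by rewrite ler_wpM2l// addr_ge0// ltW.
  apply: (@le_trans _ _ ((M + 1) * (C * `|y - z|) * (`|u| + 1))).
    by rewrite ler_pM// lerDl.
  have -> : C' * `|y - z| = 2 * ((M + 1) * (C * `|y - z|) * (`|u| + 1)).
    by rewrite /C'; ring.
  rewrite ler_peMl ?ler1n// !mulr_ge0// ?addr_ge0// ltW//.
pose p := y + T *: u.
have yp : `|y - p| = T * `|u|.
  by rewrite /p opprD addrA subrr add0r normrN normrZ ger0_norm.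
have graphP q : `|x - q| < r -> g (col' ord_max (q *m Q)) < (q *m Q) ord0 ord_max -> Om q.
  by move=> xq; move/(graph q): xq => [_]; exact.
have graph' q : `|x - q| < r -> Om q -> g (col' ord_max (q *m Q)) < (q *m Q) ord0 ord_max.
  by move=> xq; move/(graph q): xq => [+ _]; exact.
have rhor : rho < r by rewrite -rhoE ltr_pMr// ltrDl mulr_gt0.
have gy := graph' y (lt_trans xy rhor) Oy.
have gz := graph' z (lt_trans xz rhor) Oz.
have xp : `|x - p| < r.
  rewrite (le_lt_trans (ler_distD y _ _))// yp -rhoE mulrDr mulr1.
  rewrite ltr_leD// (le_trans Tu)//.
  have -> : rho * (2 * C') = C' * (2 * rho) by ring.
  by rewrite ler_wpM2l// ltW.
have ball_conv a b (t : R) : 0 <= t <= 1 -> `|x - a| < r -> `|x - b| < r ->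
    `|x - (a + t *: (b - a))| < r.
  move=> /andP[t0 t1] xa xb.
  have -> : x - (a + t *: (b - a)) = (1 - t) *: (x - a) + t *: (x - b).
    by apply/rowP => j; rewrite !mxE; ring.
  rewrite (le_lt_trans (ler_normD _ _))// !normrZ !ger0_norm ?subr_ge0//.
  case: (eqVneq t 0) => [->|tn0]; first by rewrite subr0 mul1r mul0r addr0.
  have tp : 0 < t by rewrite lt_def tn0.
  have -> : r = (1 - t) * r + t * r by ring.
  apply: ler_ltD; last by rewrite ltr_pM2l.
  by apply: ler_wpM2l; [rewrite subr_ge0|exact: ltW].
have lift_max (j : 'I_n) : (lift ord_max j == ord_max) = false.
  by rewrite eq_sym (negbTE (neq_lift _ _)).
have um : (delta_mx ord0 ord_max : V) ord0 ord_max = 1 by rewrite mxE !eqxx.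
have seg1 t : 0 <= t <= 1 -> Om (y + t *: (p - y)).
  move=> t01; apply: graphP; first exact: ball_conv (lt_trans xy rhor) xp.
  have E : (y + t *: (p - y)) *m Q = y *m Q + (t * T) *: delta_mx ord0 ord_max.
    have -> : p - y = T *: u by rewrite /p addrAC subrr add0r.
    by rewrite scalerA mulmxDl -scalemxAl uQ.
  rewrite E; have -> : col' ord_max (y *m Q + (t * T) *: delta_mx ord0 ord_max) =
      col' ord_max (y *m Q).
    by apply/rowP => j; rewrite !mxE lift_max andbF mulr0 addr0.
  rewrite mxE [X in _ + X]mxE um mulr1 (lt_le_trans gy)// lerDl mulr_ge0//.
  by case/andP: t01.
have seg2 t : 0 <= t <= 1 -> Om (p + t *: (z - p)).
  move=> t01; apply: graphP; first exact: ball_conv xp (lt_trans xz rhor).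
  have /andP[t0 t1] := t01; have s0 : 0 <= 1 - t by rewrite subr_ge0.
  have E : (p + t *: (z - p)) *m Q = z *m Q + (1 - t) *: (y *m Q - z *m Q) +
      ((1 - t) * T) *: delta_mx ord0 ord_max.
    rewrite -uQ /p; have -> : y + T *: u + t *: (z - (y + T *: u)) =
        z + (1 - t) *: (y - z) + ((1 - t) * T) *: u.
      by apply/rowP => j; rewrite !mxE; ring.
    by rewrite !mulmxDl -!scalemxAl mulmxBl.
  have val (a b : V) (s s' : R) : (a + s *: b + s' *: delta_mx ord0 ord_max) ord0 ord_max =
      a ord0 ord_max + s * b ord0 ord_max + s' by rewrite !mxE !eqxx mulr1.
  rewrite E val.
  have h1 : g (col' ord_max (z *m Q + (1 - t) *: (y *m Q - z *m Q) +
      ((1 - t) * T) *: delta_mx ord0 ord_max)) <= g (col' ord_max (z *m Q)) + M * ((1 - t) * d).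
    rewrite -lerBlDl (le_trans (ler_norm _))// (le_trans (gM _ _))//.
    rewrite ler_wpM2l ?(ltW M0)//.
    have -> : col' ord_max (z *m Q + (1 - t) *: (y *m Q - z *m Q) +
      ((1 - t) * T) *: delta_mx ord0 ord_max) - col' ord_max (z *m Q) =
      (1 - t) *: col' ord_max (y *m Q - z *m Q).
      apply/rowP => j; rewrite !mxE lift_max andbF mulr0 addr0.
      by ring.
    by rewrite normrZ (ger0_norm s0) ler_wpM2l// norm_col'.
  have h2 : - d <= (y *m Q - z *m Q) ord0 ord_max.
    by have := mx_norm_coord (y *m Q - z *m Q) ord_max; rewrite ler_norml => /andP[].
  have h3 : (1 - t) * (- d) <= (1 - t) * (y *m Q - z *m Q) ord0 ord_max by rewrite ler_wpM2l.
  have h4 : (1 - t) * T = M * ((1 - t) * d) + (1 - t) * d by rewrite /T; ring.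
  move: h1 h3 gz; rewrite h4 mulrN; move: ((1 - t) * d) => dd; lra.
have h1 := segment_lipschitz seg1; have h2 := segment_lipschitz seg2.
rewrite (le_trans (ler_distD (w p) _ _))// (le_trans (lerD h1 h2))//.
rewrite -mulrDr -mulrA ler_wpM2l//.
have := ler_distD y p z; rewrite [`|p - y|]distrC; lra.
Qed.

Lemma closure_lipschitz x : closure Om x -> exists K' rho, [/\ 0 <= K', 0 < rho &
  forall y z, Om y -> Om z -> `|x - y| < rho -> `|x - z| < rho ->
    `|w y - w z| <= K' * `|y - z|].
Proof.
move=> cx; have [Ox|nOx] := pselect (Om x).
  by have [r r0 hr] := w_loc Ox; exists K, r; split=> // y z _ _; exact: hr.
apply: boundary_lipschitz; by rewrite /boundary ((interior_id Om).1 oOm).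
Qed.

(** By compactness of the square of the closure of Om: near the diagonal the local
bounds apply, and away from it the boundedness of w suffices. *)
Lemma global_lipschitz : exists2 K', 0 <= K' &
  forall y z, Om y -> Om z -> `|w y - w z| <= K' * `|y - z|.
Proof.
have cpt : compact (closure Om).
  have [M [_ OM]] := bOm; have cM := @compact_norm_ball R n (M + 1).
  apply: (subclosed_compact _ cM); first exact: closed_closure.
  rewrite (closure_id [set z : V | `|z| <= M + 1]).1.
    by apply: closureS => z; apply: OM; rewrite ltrDl.
  by apply: compact_closed cM; exact: norm_hausdorff.
have /compact_near_coveringP := compact_setX cpt cpt.
move=> /(_ nat \oo (fun k q => Om q.1 -> Om q.2 -> `|w q.1 - w q.2| <= k%:R * `|q.1 - q.2|)).
case=> [|k _ /(_ k (leqnn _)) hk]; last first.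
  exists k%:R => // y z Oy Oz; apply: (hk (y, z)) => //.
  by split; exact: subset_closure.
move=> [x x'] /= [cx cx']; have [<-|xx'] := eqVneq x x'.
  have [K' [rho [K'0 rho0 h]]] := closure_lipschitz cx.
  exists (ball x rho `*` ball x rho, [set k | K' <= k%:R]).
    split; last exact: nbhs_infty_ger.
    by exists (ball x rho, ball x rho) => //; split; exact: nbhsx_ballx.
  move=> [[y z] k] /= [[xy xz] Kk] Oy Oz; move: xy xz; rewrite -!ball_normE => xy xz.
  by rewrite (le_trans (h y z _ _ _ _))// ler_wpM2r.
pose r := `|x - x'| / 3; have r0 : 0 < r by rewrite divr_gt0// normr_gt0 subr_eq0.
exists (ball x r `*` ball x' r, [set k | 2 * B / r <= k%:R]).
  split; last exact: nbhs_infty_ger.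
  by exists (ball x r, ball x' r) => //; split; exact: nbhsx_ballx.
move=> [[y z] k] /= [[xy xz] Kk] Oy Oz; move: xy xz; rewrite -!ball_normE /= => xy xz.
have far : r <= `|y - z|.
  have := ler_distD y x x'; have := ler_distD z y x'; rewrite [`|z - x'|]distrC.
  by move: xy xz; rewrite /r => ? ? ? ?; lra.
apply: (@le_trans _ _ (2 * B)).
  by rewrite (le_trans (ler_normB _ _))//; move: (wB Oy) (wB Oz); lra.
by apply: (le_trans _ (ler_wpM2l (ler0n _ k) far)); rewrite -ler_pdivrMr.
Qed.

End globalization.

(** * Lipschitz representatives of bounded Sobolev functions *)
Section extension.
Variables (R : realType) (n : nat).
Local Notation V := 'rV[R]_n.+1.

(** The least L-Lipschitz extension of w, cut off from below at - B. *)
Lemma mcshane_extension (A : set V) (w : V -> R) (L B : R) : 0 <= L -> 0 <= B ->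
  (forall y, A y -> `|w y| <= B) ->
  (forall y z, A y -> A z -> `|w y - w z| <= L * enorm (y - z)) ->
  exists W : V -> R, [/\ forall x y, `|W x - W y| <= L * enorm (x - y),
    forall x, `|W x| <= B & forall x, A x -> W x = w x].
Proof.
move=> L0 B0 wB wL; have [A0|/set0P[a Aa]] := eqVneq A set0.
  exists (fun=> 0); split=> [x y|x|x]; last by rewrite A0.
  - by rewrite subrr normr0 mulr_ge0// enorm_ge0.
  - by rewrite normr0.
pose S x := sup [set w y - L * enorm (x - y) | y in A].
have Sub x : has_sup [set w y - L * enorm (x - y) | y in A].
  split; first by exists (w a - L * enorm (x - a)); exists a.
  exists B => _ [y Ay <-]; rewrite lerBlDr (le_trans (ler_norm _))//.
  by rewrite (le_trans (wB y Ay))// lerDl mulr_ge0// enorm_ge0.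
have SB x : S x <= B.
  apply: ge_sup; first by case: (Sub x).
  move=> _ [y Ay <-]; rewrite lerBlDr (le_trans (ler_norm _))//.
  by rewrite (le_trans (wB y Ay))// lerDl mulr_ge0// enorm_ge0.
have SL x y : S x <= S y + L * enorm (x - y).
  apply: ge_sup; first by case: (Sub x).
  move=> _ [z Az <-]; have : w z - L * enorm (y - z) <= S y.
    by apply: ub_le_sup; [case: (Sub y)|exists z].
  have : L * enorm (y - z) <= L * enorm (x - y) + L * enorm (x - z).
    by rewrite -mulrDr ler_wpM2l// [enorm (x - y)]enormB enorm_dist.
  lra.
have Sw x : A x -> S x = w x.
  move=> Ax; apply/le_anti/andP; split.
    apply: ge_sup; first by case: (Sub x).
    move=> _ [y Ay <-]; have := wL y x Ay Ax; rewrite enormB ler_norml.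
    by move=> /andP[_]; lra.
  apply: ub_le_sup; first by case: (Sub x).
  by exists x => //; rewrite subrr enorm0 mulr0 subr0.
exists (fun x => Num.max (- B) (S x)); split=> [x y|x|x Ax].
- have := SL x y; have := SL y x; rewrite enormB.
  have : 0 <= L * enorm (x - y) by rewrite mulr_ge0// enorm_ge0.
  move: (L * _) => D D0 h1 h2; rewrite ler_norml.
  by case: (leP (- B) (S x)); case: (leP (- B) (S y)) => ? ?; apply/andP; split; lra.
- by rewrite ler_norml le_max lexx ge_max SB andbT/=; lra.
- by rewrite Sw//; apply/max_idPr; have := wB x Ax; rewrite ler_norml => /andP[].
Qed.

End extension.

Section truncation.
Variables (R : realType) (n : nat).
Local Notation V := 'rV[R]_n.+1.
Local Notation mu := (lebesgue_rV R n.+1).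
Variables (Om : set V).
Hypothesis mOm : measurable Om.

Lemma Linfty_bounded_rep (v : V -> R) : Linfty Om v -> exists (v' : V -> R) (C : R),
  [/\ measurable_fun Om v, measurable_fun Om v', forall x, `|v' x| <= C &
     {ae mu, forall x, Om x -> v x = v' x}].
Proof.
rewrite /Linfty/= => /andP[]; rewrite !inE/= => mv fv.
have {}mv : measurable_fun Om v by exact/(measurable_restrictT _ mOm).
have [C vC] : exists C : R, {ae mu, forall x, Om x -> `|v x| <= C}.
  have [mu0|mu0] := ltP 0%E (mu [set: V]); last first.
    (* The norm in L^oo is 0 by convention when the whole space is null. *)
    exists 0; exists setT; split=> //.
    by apply/eqP; rewrite eq_le mu0 measure_ge0.
  move: fv; rewrite /finite_norm unlock mu0 => fv.
  have {}fv : (ess_supr mu (Num.Def.normr \o (v \_ Om)) < +oo)%E by [].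
  have [C vC] := ess_supr_bounded fv.
  exists C; apply: filterS vC => x; rewrite /= patchE => vC Ox.
  by move: vC; rewrite mem_set.
exists (fun x => Num.max (- `|C|) (Num.min `|C| (v x))), `|C|; split=> //.
- apply: measurable_maxr => //; exact: measurable_minr.
- move=> x; have := normr_ge0 C => C0; rewrite ler_norml le_max lexx/=.
  by rewrite ge_max ge_min lexx/= andbT; lra.
- apply: filterS vC => x vC Ox; have := vC Ox => {}vC.
  have {}vC := le_trans vC (ler_norm C); move: vC; rewrite ler_norml => /andP[h1 h2].
  by rewrite (min_idPr h2) (max_idPr h1).
Qed.

Lemma ae_weak_partial i (v v' g g' : V -> R) :
  measurable_fun Om v -> measurable_fun Om v' -> measurable_fun Om g ->
  measurable_fun Om g' ->
  {ae mu, forall x, Om x -> v x = v' x} -> {ae mu, forall x, Om x -> g x = g' x} ->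
  weak_partial Om i v g -> weak_partial Om i v' g'.
Proof.
move=> mv mv' mg mg' vv gg vg phi tphi; have := vg phi tphi.
have eqI (f f' h : V -> R) : measurable_fun Om f -> measurable_fun Om f' ->
    measurable_fun Om h -> {ae mu, forall x, Om x -> f x = f' x} ->
    \int[mu]_(x in Om) (f x * h x) = \int[mu]_(x in Om) (f' x * h x).
  move=> mf mf' mh ff; rewrite /Rintegral; congr fine.
  apply: ae_eq_integral => //.
  - by apply/measurable_EFinP; exact: measurable_funM.
  - by apply/measurable_EFinP; exact: measurable_funM.
  - by apply: filterS ff => x ff Ox; rewrite ff.
have mphi : measurable_fun Om phi.
  apply: (measurable_funS (E := setT)) => //; apply: continuous_measurable_rV.
  exact: test_function_continuous tphi.
have mdphi : measurable_fun Om ('D_(basis_vec R i) phi).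
  apply: (measurable_funS (E := setT)) => //; apply: continuous_measurable_rV.
  exact: test_function_derive_continuous tphi.
by rewrite (eqI v v')// (eqI g g').
Qed.

End truncation.

Section lipschitz_representative.
Variables (R : realType) (n : nat).
Local Notation V := 'rV[R]_n.+1.
Local Notation mu := (lebesgue_rV R n.+1).

(** The averages of a bounded representative v of b converge to a function w that
is Lipschitz on Om, with extension W. On an inner box W differs from the average
of v by at most G times the sum of the sides, so the integral of v - W is too
small on boxes for v - W not to vanish almost everywhere. *)
Lemma W1oo_lipschitz_rep (Om : set V) (b : V -> R) : open Om -> bounded_set Om ->
  lipschitz_boundary Om -> W1oo Om b -> exists (W : V -> R) (L M : R),
  [/\ 0 <= L, forall x y, `|W x - W y| <= L * enorm (x - y), forall x, `|W x| <= M &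
    {ae mu, forall x, Om x -> W x = b x}].
Proof.
move=> oOm bOm lOm [v0 [bv0 Lv0 gv0]].
have mOm := open_measurable_rV oOm.
have Omoo : (mu Om < +oo)%E by exact: lebesgue_bounded_fin.
have [v [Cv [mv0 mv vC v0v]]] := Linfty_bounded_rep mOm Lv0.
have Cv0 : 0 <= Cv by exact: le_trans (vC 0).
have : forall i, exists (gC : (V -> R) * R), [/\ measurable_fun Om gC.1,
    forall x, `|gC.1 x| <= gC.2 & weak_partial Om i v gC.1].
  move=> i; have [g0 Lg0 vg0] := gv0 i.
  have [g [C [mg0 mg gC g0g]]] := Linfty_bounded_rep mOm Lg0.
  by exists (g, C); split=> //; exact: ae_weak_partial vg0.
move=> /choice[gC gCP].
pose g i := (gC i).1; pose G := \sum_i (gC i).2.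
have C0 i : 0 <= (gC i).2 by have [_ /(_ 0) h _] := gCP i; exact: le_trans h.
have G0 : 0 <= G by apply: sumr_ge0.
have mg i : measurable_fun Om (g i) by case: (gCP i).
have gG i x : Om x -> `|g i x| <= G.
  move=> _; have [_ h _] := gCP i; rewrite (le_trans (h x))// /G (bigD1 i)//=.
  by rewrite lerDl sumr_ge0.
have vg i : weak_partial Om i v (g i) by case: (gCP i).
have vC' x : Om x -> `|v x| <= Cv by [].
have bv : bounded_meas Om v by split=> //; exists Cv.
have A_sub := avg_subbox mOm Omoo mv vC' mg gG vg.
have fin_box c d : (mu (box c d) < +oo)%E by exact: lebesgue_box_fin.
have A_bnd c d : inner_box Om c d -> `|avg v c d| <= Cv.
  move=> gcd; have vol0 := inner_box_volume gcd; rewrite normrM normfV (gtr0_norm vol0).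
  rewrite ler_pdivrMr// -(inner_box_measure gcd); apply: bounded_Rintegral => //.
  - exact: measurable_box.
  - exact: fin_box.
  - by apply: (@bounded_measS _ _ _ Om) => //; exact: inner_box_sub.
pose w := box_rep Om (avg v) G.
pose K := 4 * G * n.+1%:R; have K0 : 0 <= K by rewrite !mulr_ge0.
have wB x : Om x -> `|w x| <= Cv + G by exact: box_rep_bounded.
have w_loc x : Om x -> exists2 r, 0 < r & forall y z, `|x - y| < r -> `|x - z| < r ->
    `|w y - w z| <= K * `|y - z|.
  move=> Ox; have [r /= r0 xr] := (nbhs_normP _ _).1 (open_nbhs_nbhs (conj oOm Ox)).
  exists (r / 3); first by rewrite divr_gt0.
  apply: box_rep_lipschitz_ball => // y; rewrite mulrC divfK//; exact: xr.
have [L L0 wL] := global_lipschitz oOm bOm lOm K0 wB w_loc.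
have [||y z Oy Oz|W [WL WB Ww]] := @mcshane_extension R n Om w L (Cv + G) _ _ wB.
- by [].
- exact: addr_ge0.
- by rewrite (le_trans (wL y z Oy Oz))// ler_wpM2l// norm_le_enorm.
exists W, L, (Cv + G); split=> //.
have mW : measurable_fun Om W.
  apply: (measurable_funS (E := setT)) => //; apply: continuous_measurable_rV.
  exact: lipschitz_continuous WL.
have bW : bounded_meas Om W by split=> //; exists (Cv + G).
have bf : bounded_meas Om (fun x => v x - W x) by exact: bounded_measB.
have : {ae mu, forall x, Om x -> v x - W x = 0}.
  apply: (boxes_integral_ae_eq0 mOm bf oOm G0) => c d gcd.
  have QO := inner_box_sub gcd; have Qoo := fin_box c d; have mQ := measurable_box c d.
  have bS f : bounded_meas Om f -> bounded_meas (box c d) f by exact: bounded_measS.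
  have vol0 := inner_box_volume gcd.
  rewrite bounded_RintegralB//; [|exact: bS..].
  have -> : \int[mu]_(x in box c d) v x = \int[mu]_(x in box c d) (avg v c d).
    by rewrite Rintegral_cst// (inner_box_measure gcd) divfK// gt_eqF.
  rewrite -bounded_RintegralB//; [|exact: bounded_meas_cst|exact: bS].
  rewrite -(inner_box_measure gcd); apply: bounded_Rintegral => //.
  - by apply: bounded_measB; [exact: bounded_meas_cst|exact: bS].
  - by move=> x xQ; rewrite Ww; [exact: box_rep_close|exact: QO].
move: bv0 v0v; apply: filterS3 => x h1 h2 h3 Ox.
by rewrite (h1 Ox) (h2 Ox); apply/esym/eqP; rewrite -subr_eq0 h3.
Qed.

End lipschitz_representative.

(** * Existence *)
Theorem theorem1 (R : realType) (n : nat) (Om : set 'rV[R]_n.+1)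
    (b : 'rV[R]_n.+1 -> R) :
  open Om -> bounded_set Om -> lipschitz_boundary Om -> W1oo Om b ->
  exists u : 'rV[R]_n.+1 -> R, viscosity_solution Om b u /\ W1oo Om u.
Proof.
move=> oOm bOm lOm Wb.
have [W [L [M [L0 WL WM Wb_ae]]]] := W1oo_lipschitz_rep oOm bOm lOm Wb.
have [B OmB] : exists B : R, forall x, Om x -> enorm x <= B.
  have [B [_ hB]] := bOm; exists (n.+1%:R * (B + 1)) => x Ox.
  by rewrite (le_trans (enorm_le_norm _))// ler_wpM2l// hB// ltrDl.
have [u [uL _ uW u_above u_below]] := cone_extension_exists L0 OmB WM WL.
exists u; split; last exact: lipschitz_W1oo uL.
have within_continuous (f : 'rV[R]_n.+1 -> R) : (forall x y, `|f x - f y| <= L * enorm (x - y)) ->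
    {within closure Om, continuous f}.
  by move=> fL; apply: continuous_subspaceT; exact: lipschitz_continuous fL.
split.
- exact: within_continuous.
- exists W; first by split; [exact: within_continuous|].
  by move=> x [_ nOx]; apply: uW; move: nOx; rewrite ((interior_id Om).1 oOm).
- by move=> x p X Ox; exact: cones_above_superjet u_above Ox.
- by move=> x p X Ox; exact: cones_below_subjet u_below Ox.
Qed.
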